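(* Assume $\frac{np}{\sigma^2}\rightarrow\infty$ and $\frac{np}{\log n}\rightarrow\infty$. Let $\widehat{Z}$ be a global maximizer of the semidefinite program $$\max_{Z=Z^{\mathrm H}\in\mathbb{C}^{n\times n}}\operatorname{Tr}((A\circ Y)Z)\quad\text{subject to}\quad \operatorname{diag}(Z)=I_n\text{ and }Z\succeq 0,$$ and let $\widehat{z}_j=u_j/|u_j|$ for $j\in[n]$, with $u\in\mathbb{C}^n$ being the leading eigenvector of $\widehat{Z}$. Then there exists some $\delta=o(1)$ such that $$\frac{1}{n^2}\|\widehat{Z}-z^*z^{*\mathrm H}\|_{\mathrm F}^2 \leq (1+\delta)\frac{\sigma^2}{np},\qquad \ell(\widehat{z},z^* )\leq (1+\delta)\frac{\sigma^2}{2np},$$ with probability at least $1-n^{-8}-\exp\left(-\left(\frac{np}{\sigma^2}\right)^{1/4}\right)$.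
   Context: Phase synchronization model. Let $\mathbb{C}_1=\{x\in\mathbb{C}:|x|=1\}$ and let $z^*\in\mathbb{C}_1^n$ be an arbitrary fixed vector; let $\sigma>0$ and $p\in(0,1]$ (both may depend on $n$, and asymptotics are as $n\to\infty$). For $1\le j<k\le n$, let $A_{jk}\sim\mathrm{Bernoulli}(p)$ and $W_{jk}\sim\mathcal{CN}(0,1)$ (i.e. $\mathrm{Re}(W_{jk})$ and $\mathrm{Im}(W_{jk})$ are independent $\mathcal N(0,1/2)$), all mutually independent, and $Y_{jk}=z_j^*\bar z_k^*+\sigma W_{jk}$. The matrices are extended to be Hermitian: $A_{jk}=A_{kj}$, $W_{jk}=\bar W_{kj}$, $Y_{jk}=\bar Y_{kj}$ for $k<j$, and $A_{jj}=W_{jj}=0$, $Y_{jj}=1$ for all $j\in[n]=\{1,\dots,n\}$; thus $Y=z^*z^{*\mathrm H}+\sigma W$. Only $A$ and the Hadamard (entrywise) product $A\circ Y$ are observed. The superscript $\mathrm H$ denotes conjugate transpose, $\|\cdot\|_{\mathrm F}$ the Frobenius norm, and $\operatorname{diag}(Z)=I_n$ means that all diagonal entries of $Z$ equal $1$. For $\widehat z,z\in\mathbb{C}_1^n$, $$\ell(\widehat z,z)=\min_{a\in\mathbb{C}_1}\frac1n\sum_{j=1}^n|\widehat z_j-z_ja|^2.$$ The leading eigenvector is an eigenvector for the largest eigenvalue. If $u_j=0$, set $\widehat z_j=1$. *)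

(* Defs.v *)
From HB Require Import structures.
From mathcomp Require Import all_boot all_order all_algebra.
From mathcomp Require Import sesquilinear spectral.
From mathcomp Require Export complex.
From mathcomp Require Import all_classical all_reals all_analysis.

Set Implicit Arguments.
Unset Strict Implicit.
Unset Printing Implicit Defensive.

Import Order.TTheory GRing.Theory Num.Theory.
Import numFieldNormedType.Exports.
Import Normc.

Local Open Scope classical_set_scope.
Local Open Scope ring_scope.
Local Open Scope complex_scope.
Local Open Scope sesquilinear_scope.

(* Complex numbers are [R[i]].  The norm [`|x|] of [x : R[i]] is itself an
   element of [R[i]]; [normc x] is the same modulus as an element of [R]. *)

Section ComplexMatrices.
Variables (R : realType) (n : nat).
Implicit Types (M Z : 'M[R[i]]_n) (z u : 'cV[R[i]]_n).

(* The diagonal is zero, as for the matrices A and W of the model. *)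
Definition herm_ext (X : 'I_n -> 'I_n -> R[i]) : 'M[R[i]]_n :=
  \matrix_(j, k) if (j < k)%N then X j k
                 else if (k < j)%N then (X k j)^* else 0.

Definition hadamard (M N : 'M[R[i]]_n) : 'M[R[i]]_n := map2_mx *%R M N.

Definition frobenius_norm M : R :=
  Num.sqrt (\sum_j \sum_k normc (M j k) ^+ 2).

(* For [x : R[i]], [0 <= x] says that [x] is real and nonnegative. *)
Definition psd M : Prop :=
  forall x : 'cV[R[i]]_n, 0 <= (x ^t* *m M *m x) 0 0.

Definition sdp_feasible Z : Prop :=
  [/\ Z \is hermsymmx, forall j, Z j j = 1 & psd Z].

(* The order of [R[i]] compares numbers with equal imaginary parts; [M] will be
   Hermitian, and then the traces below are real. *)
Definition sdp_maximizer M Z : Prop :=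
  sdp_feasible Z /\
  forall Z', sdp_feasible Z' -> \tr (M *m Z') <= \tr (M *m Z).

(* [eigenvalue] is about row vectors, but the spectrum is the same. *)
Definition leading_eigenvector Z u : Prop :=
  u != 0 /\
  exists lam : R[i], Z *m u = lam *: u /\
    forall mu, eigenvalue Z mu -> mu <= lam.

Definition phases u : 'cV[R[i]]_n :=
  \col_j if u j 0 == 0 then 1 else u j 0 / `|u j 0|.

(* The infimum is a minimum, the unit circle being compact. *)
Definition phase_loss (zh z : 'cV[R[i]]_n) : R :=
  inf [set n%:R^-1 * \sum_j normc (zh j 0 - z j 0 * a) ^+ 2
      | a in [set a : R[i] | `|a| = 1]].

End ComplexMatrices.

Section Probability.
Context {d : measure_display} {T : measurableType d} {R : realType}.
Variable P : probability T R.

Definition has_law {d'} {T' : measurableType d'} (X : {RV P >-> T'})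
    (mu : set T' -> \bar R) : Prop :=
  forall V, measurable V -> distribution P X V = mu V.

Definition sigma_of {d'} {T' : measurableType d'} (X : {RV P >-> T'}) :
    set (set T) :=
  preimage_set_system setT X measurable.

Definition mutually_independent (I : finType) (F : I -> set (set T)) : Prop :=
  forall (J : {set I}) (E : I -> set T), (forall i, i \in J -> F i (E i)) ->
    P (\bigcap_(i in [set` J]) E i) = (\prod_(i in J) P (E i))%E.

(* A possibly non-measurable [Q] holds with probability at least [q] when it
   contains a measurable event of probability at least [q]. *)
Definition with_prob_ge (q : R) (Q : set T) : Prop :=
  exists E : set T, [/\ measurable E, (q%:E <= P E)%E & E `<=` Q].

End Probability.

Section Model.
Context {d : measure_display} {T : measurableType d} {R : realType}.
Context {P : probability T R} {n : nat}.
Variables (A : 'I_n -> 'I_n -> {RV P >-> bool}).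
Variables (ReW ImW : 'I_n -> 'I_n -> {RV P >-> R}).

(* Only the variables with [j < k] are constrained, and used below. *)
Definition upper_pair := {e : 'I_n * 'I_n | (e.1 < e.2)%N}.

Definition model_sigma (i : upper_pair + (upper_pair + upper_pair)) :
    set (set T) :=
  match i with
  | inl e => sigma_of (A (val e).1 (val e).2)
  | inr (inl e) => sigma_of (ReW (val e).1 (val e).2)
  | inr (inr e) => sigma_of (ImW (val e).1 (val e).2)
  end.

(* The second parameter of [normal_prob] is the standard deviation. *)
Definition sync_model (p : R) : Prop :=
  (forall j k : 'I_n, (j < k)%N ->
    [/\ has_law (A j k) (bernoulli_prob p),
        has_law (ReW j k) (normal_prob 0 (Num.sqrt (2^-1))) &
        has_law (ImW j k) (normal_prob 0 (Num.sqrt (2^-1)))]) /\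
  mutually_independent P model_sigma.

Definition adj_mx (w : T) : 'M[R[i]]_n :=
  herm_ext (fun j k => (A j k w)%:R).

Definition noise_mx (w : T) : 'M[R[i]]_n :=
  herm_ext (fun j k => ReW j k w +i* ImW j k w).

Definition data_mx (sigma : R) (z : 'cV[R[i]]_n) (w : T) : 'M[R[i]]_n :=
  z *m z ^t* + sigma%:C *: noise_mx w.

Definition observed_mx (sigma : R) (z : 'cV[R[i]]_n) (w : T) : 'M[R[i]]_n :=
  hadamard (adj_mx w) (data_mx sigma z w).

End Model.

(* Main.v *)
Require Import Defs.
From HB Require Import structures.
From mathcomp Require Import all_boot all_order all_algebra.
From mathcomp Require Import sesquilinear spectral complex.
From mathcomp Require Import all_classical all_reals all_analysis.
From mathcomp Require Import measurable_realfun.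
From mathcomp Require Import ring lra.

(** Write N for n p and om for N / sigma^2.  Rotating the coordinates by the true
    phases turns the truth into the all-ones vector and the data into
    M = A + sigma T, where T j k = A j k * conj(z j) * W j k * z k.

    A maximizer is the Gram matrix of n unit vectors V_j.  Replacing one of them
    at a time shows that V_j is the normalization of sum_k M j k V_k, that is,
    M V = Lam V with Lam diagonal and nonnegative ([stationarity]).  With
    V_k = a + h_k, where a is the normalized mean of the V_k, this sum is
    (d_j + sigma (T 1)_j) a + e_j, where d_j is about N and
    e = (A - p J) h + sigma T h, with J the all-ones matrix.  Normalizing kills,
    to first order, the real part of (T 1)_j; what stays is sigma Im (T 1)_j / N,
    and the sum of its squares is about n / (2 om).  This is where the sharp
    constant comes from.
    The remainder e is of smaller order: A - p J has small norm, and T is small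
    on vectors that are small on average ([local_noise_bound]).  Hence the sum of
    |V_j - a|^2 is at most (1 + O(eps)) n / (2 om) ([fixed_point_bound]).  The
    leading eigenvector u inherits the equation M u = Lam u from V
    ([eigenvector_stationary]), so that the same estimate applies to its phases.

    To start, one needs that the h_k are small at all.  This follows by comparing
    the objective with its value at the truth ([initial_bound]).  It requires a
    bound on T against unit vectors of any dimension; the little Grothendieck
    inequality ([little_grothendieck]) reduces it to sign vectors, and the same
    reduction, on a sparse set of coordinates, gives [local_noise_bound].  Sign
    vectors are few enough for a union bound.

    All the random input is thus contained in finitely many events
    ([deterministic_bounds]).  For the graph, these are the concentration of the
    degrees (exponential moments) and of the operator norm (closed walks,
    [operator_norm_prob_le]).  Given the graph, the noise sums are linear forms
    in independent Gaussians, and the exponential moments of sums of their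
    squares are computed by linearizing one square at a time
    ([integral_expR_sum_sqr]).  The events hold where one nonnegative random
    variable is smaller than 1, and the mean of this variable is at most
    n^-8 + exp(- om^(1/4)) for large n ([sync_event], [risk_le]).  As eps is
    arbitrary, a diagonal choice of eps gives delta. *)

Set Implicit Arguments.
Unset Strict Implicit.
Unset Printing Implicit Defensive.

Import Order.TTheory GRing.Theory Num.Theory.
Import numFieldNormedType.Exports.

Local Open Scope classical_set_scope.
Local Open Scope ring_scope.
Local Open Scope sesquilinear_scope.


(** * Products of Bernoulli variables *)

Lemma eq_le_imp d (T : porderType d) (x y : T) : x = y -> (x <= y)%O.
Proof. by move->. Qed.

Lemma half01 (R : realFieldType) : 0 <= (2^-1 : R) <= 1.
Proof. by lra. Qed.

Section BernoulliProducts.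
Context {R : realType} {I : finType}.
Implicit Types (p x c : I -> R) (a : {ffun I -> bool}).

(** The law of independent Bernoulli variables of parameters p i. Expectations
    over the graph are finite sums against this weight. *)
Definition bern_weight p a : R := \prod_i (if a i then p i else 1 - p i).

Definition bern_mean p (f : {ffun I -> bool} -> R) : R :=
  \sum_a bern_weight p a * f a.

Lemma bern_mean_prod p (f : I -> bool -> R) :
  bern_mean p (fun a => \prod_i f i (a i)) =
  \prod_i (p i * f i true + (1 - p i) * f i false).
Proof.
transitivity (\sum_(a : {ffun I -> bool})
    \prod_i ((if a i then p i else 1 - p i) * f i (a i))).
  by apply: eq_bigr => a _; rewrite big_split.
rewrite -(bigA_distr_bigA (fun i b => (if b then p i else 1 - p i) * f i b)) /=.
by apply: eq_bigr => i _; rewrite big_bool.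
Qed.

Lemma bern_mean1 p : bern_mean p (fun=> 1) = 1.
Proof.
transitivity (bern_mean p (fun a => \prod_(i : I) (fun _ _ => 1) i (a i))).
  by apply: eq_bigr => a _; rewrite big1.
rewrite (bern_mean_prod p (fun _ _ => 1)).
by apply: big1 => i _; ring.
Qed.

Lemma bern_meanD p f g :
  bern_mean p (fun a => f a + g a) = bern_mean p f + bern_mean p g.
Proof. by rewrite /bern_mean -big_split; apply: eq_bigr => a _; rewrite mulrDr. Qed.

Lemma bern_meanZ p k f : bern_mean p (fun a => k * f a) = k * bern_mean p f.
Proof. by rewrite /bern_mean mulr_sumr; apply: eq_bigr => a _; rewrite mulrCA. Qed.

Lemma bern_mean_sum p (J : finType) (D : pred J) (f : J -> {ffun I -> bool} -> R) :
  bern_mean p (fun a => \sum_(j | D j) f j a) = \sum_(j | D j) bern_mean p (f j).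
Proof.
by rewrite /bern_mean exchange_big; apply: eq_bigr => a _; rewrite mulr_sumr.
Qed.

Lemma eq_bern_mean p f g : f =1 g -> bern_mean p f = bern_mean p g.
Proof. by move=> fg; apply: eq_bigr => a _; rewrite fg. Qed.

Section Probabilities.
Variable p : I -> R.
Hypothesis p01 : forall i, 0 <= p i <= 1.

Lemma bern_weight_ge0 a : 0 <= bern_weight p a.
Proof.
apply: prodr_ge0 => i _; have /andP[p0 p1] := p01 i.
by case: ifP; rewrite ?subr_ge0.
Qed.

Lemma bern_mean_le f g : (forall a, f a <= g a) -> bern_mean p f <= bern_mean p g.
Proof. by move=> fg; apply: ler_sum => a _; rewrite ler_wpM2l ?bern_weight_ge0. Qed.

Lemma bern_mean_ge0 f : (forall a, 0 <= f a) -> 0 <= bern_mean p f.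
Proof. by move=> f0; apply: sumr_ge0 => a _; rewrite mulr_ge0 ?bern_weight_ge0. Qed.

Lemma sqr_bern_mean_le f : bern_mean p f ^+ 2 <= bern_mean p (fun a => f a ^+ 2).
Proof.
set m := bern_mean p f.
have : 0 <= bern_mean p (fun a => (f a - m) ^+ 2).
  by apply: bern_mean_ge0 => a; exact: sqr_ge0.
rewrite (@eq_bern_mean _ _ (fun a => f a ^+ 2 + ((- 2 * m) * f a + m ^+ 2 * 1))); last first.
  by move=> a; ring.
rewrite bern_meanD bern_meanD !bern_meanZ bern_mean1 -/m; lra.
Qed.

End Probabilities.

Definition sgnb (b : bool) : R := if b then 1 else -1.

Lemma sgnbM b : sgnb b * sgnb b = 1.
Proof. by case: b; rewrite /sgnb; ring. Qed.

Lemma bern_mean_sgn x k :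
  bern_mean (fun i => (1 + x i) / 2) (fun a => sgnb (a k)) = x k.
Proof.
transitivity (bern_mean (fun i => (1 + x i) / 2)
    (fun a => \prod_i (if i == k then sgnb (a i) else 1))).
  by apply: eq_bern_mean => a; rewrite (bigD1 k)//= eqxx big1 ?mulr1// => i /negPf ->.
rewrite (bern_mean_prod _ (fun i b => if i == k then sgnb b else 1)) (bigD1 k)//= eqxx.
rewrite big1 => [|i /negPf ->]; rewrite /sgnb; [by field|by ring].
Qed.

(** A point of the cube is the mean of a random sign vector with independent
    coordinates, so that a convex function is at most its mean over signs. *)
Lemma sqr_sum_le_signs (D : pred I) x c : (forall k, -1 <= x k <= 1) ->
  (\sum_(k | D k) c k * x k) ^+ 2 <=
  bern_mean (fun i => (1 + x i) / 2) (fun a => (\sum_(k | D k) c k * sgnb (a k)) ^+ 2).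
Proof.
move=> x1; apply: le_trans (sqr_bern_mean_le _ _); last first.
  by move=> i; have := x1 i; lra.
rewrite bern_mean_sum [leRHS](_ : _ = (\sum_(k | D k) c k * x k) ^+ 2)//.
congr (_ ^+ 2); apply: eq_bigr => k _.
by rewrite (bern_meanZ _ _ (fun a => sgnb (a k))) bern_mean_sgn.
Qed.

Definition rademacher (f : {ffun I -> bool} -> R) : R := bern_mean (fun=> 2^-1) f.

Lemma rademacher2 i j : rademacher (fun a => sgnb (a i) * sgnb (a j)) = (i == j)%:R.
Proof.
have [<-|ij] := eqVneq i j.
  by rewrite -[RHS](bern_mean1 (fun=> 2^-1)); apply: eq_bern_mean => a; rewrite sgnbM.
transitivity (rademacher (fun a => \prod_k
    ((if k == i then sgnb (a k) else 1) * (if k == j then sgnb (a k) else 1)))).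
  apply: eq_bern_mean => a; rewrite big_split /=; congr (_ * _).
    by rewrite (bigD1 i)//= eqxx big1 ?mulr1// => k /negPf ->.
  by rewrite (bigD1 j)//= eqxx big1 ?mulr1// => k /negPf ->.
rewrite /rademacher (bern_mean_prod _ (fun k b => (if k == i then sgnb b else 1) * (if k == j then sgnb b else 1))).
rewrite (bigD1 i)//= eqxx (negPf ij) /sgnb.
by rewrite [X in X * _](_ : _ = 0) ?mul0r//; field.
Qed.

Lemma rademacher_sqr_sum c :
  rademacher (fun a => (\sum_i sgnb (a i) * c i) ^+ 2) = \sum_i c i ^+ 2.
Proof.
transitivity (rademacher (fun a => \sum_i \sum_j (c i * c j) * (sgnb (a i) * sgnb (a j)))).
  apply: eq_bern_mean => a; rewrite expr2 mulr_suml; apply: eq_bigr => i _.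
  by rewrite mulr_sumr; apply: eq_bigr => j _; ring.
rewrite /rademacher bern_mean_sum; apply: eq_bigr => i _; rewrite bern_mean_sum.
have E j : bern_mean (fun=> 2^-1) (fun a => c i * c j * (sgnb (a i) * sgnb (a j))) =
    c i * c j * (i == j)%:R.
  by rewrite (bern_meanZ _ _ (fun a => sgnb (a i) * sgnb (a j))) -rademacher2.
rewrite (bigD1 i)//= E eqxx mulr1 -expr2.
by rewrite big1 ?addr0// => j ji; rewrite E eq_sym (negPf ji) mulr0.
Qed.

Lemma expR_le_quadratic (t : R) : -(1/2) <= t <= 1/2 -> expR t <= 1 + t + 2 * t ^+ 2.
Proof.
move=> t12; have t1 : 0 < 1 - t by lra.
have : 1 - t <= expR (- t) by rewrite -[1 - t]/(1 + - t) expR_ge1Dx.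
rewrite expRN => H; have e0 := expR_gt0 t.
have : (1 - t) * expR t <= 1 by rewrite -ler_pdivlMr// mul1r.
move=> H1; have : (1 - t) * expR t <= (1 - t) * (1 + t + 2 * t ^+ 2) by nra.
by rewrite ler_pM2l.
Qed.

Lemma expR_half_sum (t : R) : -(1/2) <= t <= 1/2 ->
  (expR t + expR (- t)) / 2 <= expR (2 * t ^+ 2).
Proof.
move=> t12; have h1 := expR_le_quadratic t12.
have /expR_le_quadratic h2 : -(1/2) <= - t <= 1/2 by lra.
have := expR_ge1Dx (2 * t ^+ 2); move: h2; rewrite sqrrN; lra.
Qed.

Lemma rademacher_expR c (t : R) : (forall i, -(1/2) <= t * c i <= 1/2) ->
  rademacher (fun a => expR (t * \sum_i sgnb (a i) * c i)) <=
  expR (2 * t ^+ 2 * \sum_i c i ^+ 2).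
Proof.
move=> tc.
rewrite [leLHS](_ : _ = rademacher (fun a => \prod_i expR (t * (sgnb (a i) * c i)))); last first.
  by apply: eq_bern_mean => a; rewrite mulr_sumr expR_sum.
rewrite /rademacher (bern_mean_prod _ (fun i b => expR (t * (sgnb b * c i)))).
rewrite mulr_sumr expR_sum; apply: ler_prod => i _; apply/andP; split.
  by rewrite addr_ge0// mulr_ge0 ?expR_ge0//; lra.
have := expR_half_sum (tc i); rewrite /sgnb exprMn mulN1r mulrN mul1r mulrA; lra.
Qed.

(** From x / 8 <= exp (x / 8), raised to the fourth power. *)
Lemma pow4_le_expR (x : R) : x ^+ 4 <= 8 ^+ 4 * (expR (x / 2) + expR (- x / 2)).
Proof.
wlog x0 : x / 0 <= x.
  move=> H; have [/H//|x0] := leP 0 x.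
  have := H (- x); rewrite oppr_ge0 (ltW x0) opprK => /(_ isT).
  have -> : (- x) ^+ 4 = x ^+ 4 by ring.
  by rewrite addrC.
have h : x / 8 <= expR (x / 8) by apply: le_trans (expR_ge1Dx _); lra.
have : (x / 8) ^+ 4 <= expR (x / 8) ^+ 4 by rewrite lerXn2r ?nnegrE ?expR_ge0//; lra.
rewrite -expRM_natl (_ : 4%:R * (x / 8) = x / 2); last by field.
rewrite expr_div_n ler_pdivrMr ?exprn_gt0// => H.
by rewrite (le_trans H)// mulrC ler_wpM2l ?exprn_ge0// lerDl expR_ge0.
Qed.

(** The bound does not depend on the number of terms: the fourth moment is dominated
    by the moment generating function at 1/2 and -1/2. *)
Lemma rademacher_pow4 c : \sum_i c i ^+ 2 <= 1 ->
  rademacher (fun a => (\sum_i sgnb (a i) * c i) ^+ 4) <= 4 * 8 ^+ 4.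
Proof.
move=> c1; have ci i : -1 <= c i <= 1.
  have ci2 : c i ^+ 2 <= 1.
    apply: le_trans c1; rewrite (bigD1 i)//= lerDl sumr_ge0// => j _; exact: sqr_ge0.
  by apply/andP; split; nra.
apply: (@le_trans _ _ (8 ^+ 4 * (rademacher (fun a => expR (1/2 * \sum_i sgnb (a i) * c i)) +
   rademacher (fun a => expR (-(1/2) * \sum_i sgnb (a i) * c i))))).
  rewrite /rademacher -bern_meanD -bern_meanZ; apply: bern_mean_le => [i|a]; first exact: half01.
  apply: (le_trans (pow4_le_expR _)); rewrite ler_wpM2l//.
  by rewrite mulNr (mulrC (1/2)) mulNr mul1r mulrC.
have e2 : expR (1/2 * \sum_i c i ^+ 2) <= 2.
  apply: (@le_trans _ _ (expR (1/2))); first by rewrite ler_expR; lra.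
  have := @expR_le_quadratic (1/2); lra.
have h1 := @rademacher_expR c (1/2).
have h2 := @rademacher_expR c (-(1/2)).
have : rademacher (fun a => expR (1/2 * \sum_i sgnb (a i) * c i)) <= 2.
  apply: le_trans (h1 _) _ => [i|]; first by have := ci i; lra.
  by apply: le_trans e2; rewrite ler_expR; lra.
have : rademacher (fun a => expR (-(1/2) * \sum_i sgnb (a i) * c i)) <= 2.
  apply: le_trans (h2 _) _ => [i|]; first by have := ci i; lra.
  by apply: le_trans e2; rewrite ler_expR; lra.
move=> H1 H2; rewrite mulrC ler_wpM2r ?exprn_ge0//; lra.
Qed.

End BernoulliProducts.

(** * The little Grothendieck inequality *)

Lemma CauchySchwarz_sum (R : realFieldType) (I : finType) (D : pred I)
    (x y : I -> R) :
  (\sum_(i | D i) x i * y i) ^+ 2 <=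
  (\sum_(i | D i) x i ^+ 2) * (\sum_(i | D i) y i ^+ 2).
Proof.
have : 0 <= \sum_(i | D i) \sum_(j | D j) (x i * y j - x j * y i) ^+ 2.
  by apply: sumr_ge0 => i _; apply: sumr_ge0 => j _; exact: sqr_ge0.
rewrite (eq_bigr (fun i => \sum_(j | D j) (x i ^+ 2 * y j ^+ 2) +
    (\sum_(j | D j) (y i ^+ 2 * x j ^+ 2) +
     \sum_(j | D j) (- 2 * (x i * y i) * (x j * y j))))); last first.
  by move=> i _; rewrite -!big_split; apply: eq_bigr => j _ /=; ring.
have sumM (f g : I -> R) (c : R) :
    \sum_(i | D i) \sum_(j | D j) (c * f i * g j) =
    c * ((\sum_(i | D i) f i) * (\sum_(i | D i) g i)).
  rewrite mulr_suml mulr_sumr; apply: eq_bigr => i _.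
  by rewrite !mulr_sumr; apply: eq_bigr => j _; rewrite mulrA.
rewrite !big_split /= (sumM (fun i => x i * y i) (fun i => x i * y i)).
have -> : \sum_(i | D i) \sum_(j | D j) (x i ^+ 2 * y j ^+ 2) =
    (\sum_(i | D i) x i ^+ 2) * (\sum_(i | D i) y i ^+ 2).
  by rewrite mulr_suml; apply: eq_bigr => i _; rewrite mulr_sumr.
have -> : \sum_(i | D i) \sum_(j | D j) (y i ^+ 2 * x j ^+ 2) =
    (\sum_(i | D i) x i ^+ 2) * (\sum_(i | D i) y i ^+ 2).
  by rewrite mulrC mulr_suml; apply: eq_bigr => i _; rewrite mulr_sumr.
rewrite -expr2; lra.
Qed.

Section Rounding.
Context {R : realType} {J K : finType}.
Variables (T : J -> K -> R) (S : pred K) (s : R).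

Let form (I : finType) (h : K -> I -> R) : R :=
  \sum_i \sum_j (\sum_(k | S k) T j k * h k i) ^+ 2.

Hypothesis sign_bound : forall a : {ffun K -> bool},
  \sum_j (\sum_(k | S k) T j k * sgnb (a k)) ^+ 2 <= s.

(** By convexity, the maximum over the cube is attained at a vertex. *)
Lemma cube_form_le (x : K -> R) : (forall k, -1 <= x k <= 1) ->
  \sum_j (\sum_(k | S k) T j k * x k) ^+ 2 <= s.
Proof.
move=> x1.
apply: (@le_trans _ _ (bern_mean (fun k => (1 + x k) / 2)
    (fun a => \sum_j (\sum_(k | S k) T j k * sgnb (a k)) ^+ 2))).
  by rewrite bern_mean_sum; apply: ler_sum => j _; exact: sqr_sum_le_signs.
apply: (@le_trans _ _ (bern_mean (fun k => (1 + x k) / 2) (fun=> s * 1))).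
  by apply: bern_mean_le => [k|a]; [have := x1 k; lra|rewrite mulr1].
by rewrite (bern_meanZ _ _ (fun=> 1)) bern_mean1 mulr1.
Qed.

Let sqrD_le (x y : R) : (x + y) ^+ 2 <= 2 * x ^+ 2 + 2 * y ^+ 2.
Proof. by have := sqr_ge0 (x - y); nra. Qed.

(* The truncation level: M^2 is four times the bound of [rademacher_pow4], so that
   the part above M has second moment at most 1/4. *)
Let M : R := locked (4 * 8 ^+ 2).

Let M_gt0 : 0 < M.
Proof. by rewrite /M -lock mulr_gt0// exprn_gt0. Qed.

Let M2 : M ^+ 2 = 16 * 8 ^+ 4.
Proof. by rewrite /M -lock; ring. Qed.

Lemma truncated_form_le (X : K -> R) :
  \sum_j (\sum_(k | S k) T j k * (if `|X k| <= M then X k else 0)) ^+ 2 <=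
  M ^+ 2 * s.
Proof.
have -> : \sum_j (\sum_(k | S k) T j k * (if `|X k| <= M then X k else 0)) ^+ 2 =
    M ^+ 2 * \sum_j (\sum_(k | S k) T j k * ((if `|X k| <= M then X k else 0) / M)) ^+ 2.
  rewrite mulr_sumr; apply: eq_bigr => j _; rewrite -exprMn mulr_sumr.
  congr (_ ^+ 2); apply: eq_bigr => k _.
  by rewrite mulrA mulrCA divff ?mulr1// ?gt_eqF// mulrC -mulrA mulVf ?mulr1// gt_eqF.
rewrite ler_wpM2l ?sqr_ge0//; apply: cube_form_le => k.
case: ifP => [|_]; last by rewrite mul0r; lra.
by rewrite -ler_norml normrM normfV (gtr0_norm M_gt0) ler_pdivrMr// mul1r.
Qed.

Let feasible (I : finType) (h : K -> I -> R) := forall k, \sum_i h k i ^+ 2 <= 1.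

Let values : set R := [set v | exists (I : finType) (h : K -> I -> R),
  feasible h /\ v = form h].

Let form_crude (I : finType) (h : K -> I -> R) : feasible h ->
  form h <= \sum_j ((\sum_(k | S k) T j k ^+ 2) * #|K|%:R).
Proof.
move=> fh; rewrite /form exchange_big /=; apply: ler_sum => j _.
apply: (le_trans (ler_sum _ (fun i _ => CauchySchwarz_sum _ _ _))).
rewrite -mulr_sumr ler_wpM2l ?sumr_ge0// => [k _|]; first exact: sqr_ge0.
rewrite exchange_big /= -sum1_card natr_sum big_mkcond /=.
by apply: ler_sum => k _; case: ifP => _ //; exact: fh.
Qed.

Let bootstrap (I : finType) (h : K -> I -> R) (F : R) : feasible h ->
  (forall (I' : finType) (h' : K -> I' -> R), feasible h' -> form h' <= F) ->
  form h <= 2 * M ^+ 2 * s + F / 2.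
Proof.
move=> fh bF.
pose X (a : {ffun I -> bool}) k := \sum_i sgnb (a i) * h k i.
pose lo a k := if `|X a k| <= M then X a k else 0.
pose hi a k := if `|X a k| <= M then 0 else X a k.
have formE : form h = rademacher (fun a => \sum_j (\sum_(k | S k) T j k * X a k) ^+ 2).
  rewrite /form exchange_big /= /rademacher bern_mean_sum; apply: eq_bigr => j _.
  rewrite -rademacher_sqr_sum; apply: eq_bern_mean => a; congr (_ ^+ 2).
  rewrite /X; under [RHS]eq_bigr do rewrite mulr_sumr.
  rewrite exchange_big /=; apply: eq_bigr => i _; rewrite mulr_sumr.
  by apply: eq_bigr => k _; rewrite mulrCA.
(* The tail, as a vector indexed by the sign patterns, scaled to norm at most 1. *)
pose h' k (a : {ffun I -> bool}) := 2 * Num.sqrt (bern_weight (fun=> 2^-1) a) * hi a k.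
have w0 (a : {ffun I -> bool}) : 0 <= bern_weight (fun=> 2^-1 : R) a.
  by apply: bern_weight_ge0 => i; exact: half01.
have fh' : feasible h'.
  move=> k; rewrite (_ : \sum_a _ = 4 * rademacher (fun a => hi a k ^+ 2)); last first.
    rewrite /rademacher /bern_mean mulr_sumr; apply: eq_bigr => a _.
    by rewrite /h' !exprMn sqr_sqrtr//; ring.
  have h2 := rademacher_pow4 (fh k).
  have h1 : rademacher (fun a => M ^+ 2 * hi a k ^+ 2) <= rademacher (fun a => X a k ^+ 4).
    apply: bern_mean_le => [i|a]; first exact: half01.
    rewrite /hi; case: ifP => [_|/negbT]; first by rewrite expr0n mulr0 (exprM _ 2 2) sqr_ge0.
    rewrite -ltNge => MX; rewrite -[4%N]/(2 + 2)%N exprD ler_wpM2r ?sqr_ge0//.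
    by rewrite -[leRHS]real_normK ?num_real// lerXn2r ?nnegrE// ?(ltW M_gt0)// ltW.
  have := le_trans h1 h2; rewrite /rademacher (bern_meanZ _ _ (fun a => hi a k ^+ 2)) M2.
  rewrite mulrAC ler_pM2r ?exprn_gt0//; lra.
have split_form : form h <=
    2 * rademacher (fun a => \sum_j (\sum_(k | S k) T j k * lo a k) ^+ 2) +
    2 * rademacher (fun a => \sum_j (\sum_(k | S k) T j k * hi a k) ^+ 2).
  rewrite formE /rademacher -!bern_meanZ -bern_meanD.
  apply: bern_mean_le => [i|a]; first exact: half01.
  rewrite !mulr_sumr -big_split /=; apply: ler_sum => j _.
  apply: le_trans (sqrD_le _ _); rewrite -big_split /=; apply: eq_le_imp.
  congr (_ ^+ 2); apply: eq_bigr => k _; rewrite -mulrDr; congr (_ * _).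
  by rewrite /lo /hi; case: ifP; rewrite ?addr0 ?add0r.
have lo_bound : rademacher (fun a => \sum_j (\sum_(k | S k) T j k * lo a k) ^+ 2) <= M ^+ 2 * s.
  apply: (@le_trans _ _ (rademacher (fun=> (M ^+ 2 * s) * 1 : R))).
    apply: bern_mean_le => [i|a]; first exact: half01.
    by rewrite mulr1; exact: truncated_form_le.
  by rewrite /rademacher (bern_meanZ _ _ (fun=> 1)) bern_mean1 mulr1.
have hi_bound : 4 * rademacher (fun a => \sum_j (\sum_(k | S k) T j k * hi a k) ^+ 2) <= F.
  apply: le_trans (bF _ _ fh'); apply: eq_le_imp.
  rewrite /rademacher /bern_mean mulr_sumr; apply: eq_bigr => a _.
  rewrite !mulr_sumr; apply: eq_bigr => j _.
  under [in RHS]eq_bigr do rewrite /h' mulrCA.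
  by rewrite -mulr_sumr !exprMn sqr_sqrtr//; ring.
by rewrite -mulrA; lra.
Qed.

(** Replace the vectors h k by the random scalars X_k = sum_i g_i h k i with
    independent signs g_i: the form is the mean of the scalar forms at X. The part
    of X below the level M lies in a cube, and there the sign bound applies. The
    part above M is itself a family of vectors, in the finite-dimensional space of
    functions of g, and of norm at most 1/2 by Markov; it is bounded by the
    supremum that is being estimated. This gives F <= 2 M^2 s + F / 2. *)
Lemma little_grothendieck (I : finType) (h : K -> I -> R) :
  (forall k, \sum_i h k i ^+ 2 <= 1) ->
  \sum_i \sum_j (\sum_(k | S k) T j k * h k i) ^+ 2 <= 8 ^+ 6 * s.
Proof.
move=> fh.
have sup_values : has_sup values.
  split; first by exists (form h), I, h.
  exists (\sum_j ((\sum_(k | S k) T j k ^+ 2) * #|K|%:R)) => _ [I' [h' [fh' ->]]].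
  exact: form_crude.
have le_sup (I' : finType) (h' : K -> I' -> R) : feasible h' -> form h' <= sup values.
  by move=> fh'; apply: sup_upper_bound => //; exists I', h'.
have : sup values <= 2 * M ^+ 2 * s + sup values / 2.
  apply: ge_sup => [|_ [I' [h' [fh' ->]]]]; first by exists (form h), I, h.
  exact: bootstrap.
move: (le_sup _ _ fh); rewrite -/(form h) M2.
have -> : (8 : R) ^+ 6 = 64 * 8 ^+ 4 by ring.
rewrite !mulrA -!(mulrA _ _ s); set q := 8 ^+ 4 * s; lra.
Qed.

End Rounding.

(** * Complex scalars and the underlying real inner product *)

Section ComplexScalars.
Context {R : realType}.
Implicit Types (x y : R[i]) (r : R).
Local Open Scope complex_scope.

Lemma ReD x y : complex.Re (x + y) = complex.Re x + complex.Re y.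
Proof. by case: x; case: y. Qed.

Lemma ImD x y : complex.Im (x + y) = complex.Im x + complex.Im y.
Proof. by case: x; case: y. Qed.

Lemma ReN x : complex.Re (- x) = - complex.Re x.
Proof. by case: x. Qed.

Lemma ImN x : complex.Im (- x) = - complex.Im x.
Proof. by case: x. Qed.

Lemma ReM x y : complex.Re (x * y) =
  complex.Re x * complex.Re y - complex.Im x * complex.Im y.
Proof. by case: x; case: y. Qed.

Lemma ImM x y : complex.Im (x * y) =
  complex.Re x * complex.Im y + complex.Im x * complex.Re y.
Proof. by case: x => a b; case: y => c e. Qed.

Lemma Re_sum (I : Type) (s : seq I) (D : pred I) (F : I -> R[i]) :
  complex.Re (\sum_(i <- s | D i) F i) = \sum_(i <- s | D i) complex.Re (F i).
Proof. by elim/big_ind2: _ => // x1 x2 y1 y2 <- <-; rewrite ReD. Qed.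

Lemma Im_sum (I : Type) (s : seq I) (D : pred I) (F : I -> R[i]) :
  complex.Im (\sum_(i <- s | D i) F i) = \sum_(i <- s | D i) complex.Im (F i).
Proof. by elim/big_ind2: _ => // x1 x2 y1 y2 <- <-; rewrite ImD. Qed.

Lemma complex_inj x y :
  complex.Re x = complex.Re y -> complex.Im x = complex.Im y -> x = y.
Proof. by case: x => a b; case: y => c e /= -> ->. Qed.

Definition sqn x : R := complex.Re x ^+ 2 + complex.Im x ^+ 2.

Lemma sqn_ge0 x : 0 <= sqn x.
Proof. by rewrite addr_ge0 ?sqr_ge0. Qed.

Lemma sqnM x y : sqn (x * y) = sqn x * sqn y.
Proof. by rewrite /sqn ReM ImM; ring. Qed.

Lemma sqn_conj x : sqn x^* = sqn x.
Proof. by case: x => a b; rewrite /sqn /= sqrrN. Qed.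

Lemma sqn_real r : sqn r%:C = r ^+ 2.
Proof. by rewrite /sqn /= expr0n addr0. Qed.

Lemma sqn0 : sqn 0 = 0.
Proof. by rewrite /sqn /= expr0n addr0. Qed.

Lemma sqn1 : sqn 1 = 1.
Proof. by rewrite /sqn /= expr1n expr0n addr0. Qed.

Lemma sqr_normc x : Normc.normc x ^+ 2 = sqn x.
Proof. by case: x => a b; rewrite /Normc.normc sqr_sqrtr// addr_ge0 ?sqr_ge0. Qed.

Lemma normE x : `|x| = (Num.sqrt (sqn x))%:C.
Proof. exact: normc_def. Qed.

Lemma sqn_unit x : `|x| = 1 -> sqn x = 1.
Proof.
rewrite normE => /(congr1 (@complex.Re R)) /= sx.
by rewrite -[LHS]sqr_sqrtr ?sqn_ge0// sx expr1n.
Qed.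

Lemma unit_sqn x : sqn x = 1 -> `|x| = 1.
Proof. by move=> x1; rewrite normE x1 sqrtr1. Qed.

Lemma mulJ_sqn x : x * x^* = (sqn x)%:C.
Proof. by case: x => a b; apply: complex_inj; rewrite /sqn /=; ring. Qed.

Lemma conjC_conjc x : (Num.conj x : R[i]) = x^*.
Proof. by []. Qed.

End ComplexScalars.

Section RealInnerProduct.
Context {R : realType} {m : nat}.
Implicit Types (v w a : 'rV[R[i]]_m) (c : R[i]) (r : R).
Local Open Scope complex_scope.

(** The real part of the Hermitian product: the geometry of the rows is only used
    through the underlying real inner product. *)
Definition dot v w : R := \sum_i (complex.Re (v 0 i) * complex.Re (w 0 i) +
  complex.Im (v 0 i) * complex.Im (w 0 i)).

Definition nrm2 v : R := dot v v.

Lemma nrm2E v : nrm2 v = \sum_i sqn (v 0 i).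
Proof. by apply: eq_bigr => i _; rewrite /sqn !expr2. Qed.

Lemma nrm2_ge0 v : 0 <= nrm2 v.
Proof. by rewrite nrm2E; apply: sumr_ge0 => i _; exact: sqn_ge0. Qed.

Lemma dotC v w : dot v w = dot w v.
Proof. by apply: eq_bigr => i _; ring. Qed.

Lemma dotDl u v w : dot (u + v) w = dot u w + dot v w.
Proof. by rewrite -big_split; apply: eq_bigr => i _; rewrite !mxE ReD ImD /=; ring. Qed.

Lemma dotDr u v w : dot u (v + w) = dot u v + dot u w.
Proof. by rewrite dotC dotDl !(dotC u). Qed.

Lemma dotZl r v w : dot (r%:C *: v) w = r * dot v w.
Proof. by rewrite mulr_sumr; apply: eq_bigr => i _; rewrite !mxE ReM ImM /=; ring. Qed.

Lemma dotZr r v w : dot v (r%:C *: w) = r * dot v w.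
Proof. by rewrite dotC dotZl dotC. Qed.

Lemma dotNl v w : dot (- v) w = - dot v w.
Proof.
rewrite -sumrN; apply: eq_bigr => i _; rewrite !mxE.
by case: (v 0 i) => a b /=; ring.
Qed.

Lemma dotNr v w : dot v (- w) = - dot v w.
Proof. by rewrite dotC dotNl dotC. Qed.

Lemma dot_suml (I : Type) (s : seq I) (D : pred I) (F : I -> 'rV[R[i]]_m) w :
  dot (\sum_(i <- s | D i) F i) w = \sum_(i <- s | D i) dot (F i) w.
Proof.
elim/big_ind2: _ => // [|x1 x2 y1 y2 <- <-]; last by rewrite dotDl.
by apply: big1 => i _; rewrite !mxE !mul0r addr0.
Qed.

Lemma dot_sumr (I : Type) (s : seq I) (D : pred I) (F : I -> 'rV[R[i]]_m) w :
  dot w (\sum_(i <- s | D i) F i) = \sum_(i <- s | D i) dot w (F i).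
Proof. by rewrite dotC dot_suml; apply: eq_bigr => i _; rewrite dotC. Qed.

Lemma nrm2Z c v : nrm2 (c *: v) = sqn c * nrm2 v.
Proof. by rewrite !nrm2E mulr_sumr; apply: eq_bigr => i _; rewrite mxE sqnM. Qed.

Lemma dot_self_Z c v : dot v (c *: v) = complex.Re c * nrm2 v.
Proof. by rewrite mulr_sumr; apply: eq_bigr => i _; rewrite mxE ReM ImM; ring. Qed.

Lemma nrm2D v w : nrm2 (v + w) = nrm2 v + 2 * dot v w + nrm2 w.
Proof. by rewrite /nrm2 !dotDl !dotDr (dotC w v); ring. Qed.

Lemma nrm2B v w : nrm2 (v - w) = nrm2 v - 2 * dot v w + nrm2 w.
Proof. by rewrite /nrm2 !dotDl !dotDr !dotNl !dotNr (dotC w v); ring. Qed.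

Lemma nrm2_eq0 v : nrm2 v = 0 -> v = 0.
Proof.
rewrite nrm2E => /eqP; rewrite psumr_eq0 => [/allP v0|i _]; last exact: sqn_ge0.
apply/rowP => i; rewrite mxE; have /eqP := v0 i (mem_index_enum i).
by move/eqP; rewrite /sqn paddr_eq0 ?sqr_ge0// !sqrf_eq0 => /andP[/eqP r0 /eqP i0];
  apply: complex_inj.
Qed.

Lemma CauchySchwarz_dot v w : dot v w ^+ 2 <= nrm2 v * nrm2 w.
Proof.
pose f (u : 'rV[R[i]]_m) (i : 'I_m * bool) : R := if i.2 then complex.Re (u 0 i.1) else complex.Im (u 0 i.1).
have E (u u' : 'rV[R[i]]_m) : dot u u' = \sum_i f u i * f u' i.
  rewrite -(pair_bigA _ (fun i b => f u (i, b) * f u' (i, b))) /=.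
  by apply: eq_bigr => i _; rewrite big_bool.
have E2 u : nrm2 u = \sum_i f u i ^+ 2.
  by rewrite /nrm2 E; apply: eq_bigr => i _; rewrite expr2.
by rewrite E !E2; exact: (CauchySchwarz_sum predT).
Qed.

Lemma nrm2D_le v w : nrm2 (v + w) <= 2 * nrm2 v + 2 * nrm2 w.
Proof. by have := nrm2_ge0 (v - w); rewrite nrm2B nrm2D; lra. Qed.

(** The weighted form of (a + b)^2 <= (1 + e) a^2 + (1 + 1/e) b^2, which loses only
    a factor 1 + e on the main term. *)
Lemma nrm2D_young e v w : 0 < e ->
  nrm2 (v + w) <= (1 + e) * nrm2 v + (1 + e^-1) * nrm2 w.
Proof.
move=> e0; rewrite nrm2D; pose r := Num.sqrt e.
have r2 : r ^+ 2 = e by rewrite sqr_sqrtr ?ltW.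
have r0 : r != 0 by rewrite gt_eqF// sqrtr_gt0.
have := nrm2_ge0 (r%:C *: v - r^-1%:C *: w).
rewrite nrm2B dotZl dotZr !nrm2Z !sqn_real exprVn r2 mulrA mulrA mulfK//; lra.
Qed.

Lemma nrm2_proj a v : nrm2 a = 1 -> nrm2 (v - (dot a v)%:C *: a) = nrm2 v - dot a v ^+ 2.
Proof. by move=> a1; rewrite nrm2B dotZr nrm2Z sqn_real a1 (dotC v a); ring. Qed.

Lemma nrm2_norm_ge v w r s : 0 <= r -> 0 <= s -> nrm2 v <= r ^+ 2 -> nrm2 w <= s ^+ 2 ->
  nrm2 (v + w) <= (r + s) ^+ 2.
Proof.
move=> r0 s0 vr ws; have : dot v w <= r * s.
  have [d0|/ltW d0] := leP 0 (dot v w); last by rewrite (le_trans d0) ?mulr_ge0.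
  rewrite -(ler_pXn2r (n := 2)) ?nnegrE ?mulr_ge0//.
  by rewrite (le_trans (CauchySchwarz_dot _ _))// exprMn ler_pM ?nrm2_ge0.
by rewrite nrm2D; nra.
Qed.

End RealInnerProduct.

(** * One step of the fixed-point equation *)

Section OneStep.
Context {R : realType} {m : nat}.
Implicit Types (a f g h e : 'rV[R[i]]_m).
Local Open Scope complex_scope.

(** With c the cosine of the angle, the left side is 2 - 2 c and the right side is
    1 / c^2 - 1, the squared tangent. *)
Lemma normalize_dist a f (rho : R) : nrm2 a = 1 -> nrm2 f = 1 -> 0 <= rho ->
  0 < dot a (rho%:C *: f) ->
  nrm2 (f - a) <=
  nrm2 (rho%:C *: f - (dot a (rho%:C *: f))%:C *: a) / dot a (rho%:C *: f) ^+ 2.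
Proof.
move=> a1 f1 rho0; rewrite dotZr => s0.
have rho_gt0 : 0 < rho.
  by rewrite lt_neqAle rho0 andbT; apply/eqP => r; move: s0; rewrite -r mul0r ltxx.
have d0 : 0 < dot a f by rewrite -(pmulr_rgt0 _ rho_gt0).
rewrite [nrm2 (f - a)]nrm2B nrm2B dotZl dotZr !nrm2Z !sqn_real a1 f1 (dotC f a).
rewrite ler_pdivlMr ?exprn_gt0//.
set c := dot a f; set t := rho * c; have d1 : c <= 1.
  have := nrm2_ge0 (f - a); rewrite nrm2B f1 a1 (dotC f a) -/c; lra.
have -> : rho ^+ 2 * 1 - 2 * (rho * (t * c)) + t ^+ 2 * 1 = rho ^+ 2 * (1 - c ^+ 2).
  by rewrite /t; ring.
rewrite /t exprMn mulrCA ler_wpM2l ?sqr_ge0//.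
have := mulr_ge0 (sqr_ge0 (1 - c)) (ltW d0); rewrite -/c => H.
have : 0 <= (1 - c) * ((1 - c) * (1 + 2 * c)) by rewrite !mulr_ge0//; rewrite /c in d0 d1 *; lra.
nra.
Qed.

(** The component of the right-hand side along a has length at least
    (1 - 4 eps) N, and the orthogonal component is Im w up to e: the real part of
    w only changes the length, which the normalization forgets. *)
Lemma one_step_bound a f e (w : R[i]) (c N eps : R) (lam : R) :
  0 < N -> 0 < eps <= 1 / 100 -> nrm2 a = 1 -> nrm2 f = 1 -> 0 <= lam ->
  (1 - 2 * eps) * N <= c -> `|complex.Re w| <= eps * N ->
  nrm2 e <= eps ^+ 2 * N ^+ 2 ->
  lam%:C *: f = (c%:C + w) *: a + e ->
  nrm2 (f - a) <= ((1 - 4 * eps) * N) ^- 2 *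
    ((1 + eps) * complex.Im w ^+ 2 + (1 + eps^-1) * nrm2 e).
Proof.
move=> N0 /andP[e0 e1] a1 f1 lam0 cN wN eN E.
have ae : `|dot a e| <= eps * N.
  rewrite -(ler_pXn2r (n := 2)) ?nnegrE ?mulr_ge0 ?(ltW e0) ?(ltW N0)//.
  rewrite real_normK ?num_real// exprMn; apply: le_trans eN.
  by apply: (le_trans (CauchySchwarz_dot a e)); rewrite a1 mul1r.
have sE : dot a (lam%:C *: f) = c + complex.Re w + dot a e.
  by rewrite E dotDr dot_self_Z a1 mulr1 ReD.
have sN : (1 - 4 * eps) * N <= dot a (lam%:C *: f).
  rewrite sE; move: wN ae; rewrite !ler_norml => /andP[w1 w2] /andP[e3 e4]; lra.
have N1 : 0 < (1 - 4 * eps) * N by rewrite mulr_gt0//; lra.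
have s0 := lt_le_trans N1 sN.
apply: (le_trans (normalize_dist a1 f1 lam0 s0)).
rewrite mulrC; apply: ler_pM; rewrite ?invr_ge0 ?sqr_ge0 ?nrm2_ge0//.
  by rewrite lef_pV2 ?posrE ?exprn_gt0// lerXn2r ?nnegrE ?(ltW N1) ?(ltW s0).
rewrite sE E (_ : _ - _ = (Complex 0 (complex.Im w)) *: a + (e - (dot a e)%:C *: a)); last first.
  apply/rowP => i; rewrite !mxE.
  by apply: complex_inj; rewrite !(ReD, ImD, ReN, ImN, ReM, ImM) /=; ring.
apply: (le_trans (nrm2D_young _ _ e0)); rewrite nrm2Z a1 mulr1.
rewrite {1}/sqn /= expr0n add0r lerD2l ler_wpM2l ?addr_ge0 ?invr_ge0 ?(ltW e0)//.
by rewrite nrm2_proj// gerBl sqr_ge0.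
Qed.

End OneStep.

Section StepSum.
Context {R : realType} {m n : nat}.
Local Open Scope complex_scope.
Variables (a : 'rV[R[i]]_m) (f e : 'I_n -> 'rV[R[i]]_m) (w : 'I_n -> R[i]).
Variables (c lam : 'I_n -> R) (N eps om L : R).
Hypotheses (N0 : 0 < N) (om0 : 0 < om) (L0 : 0 <= L) (eps1 : 0 < eps <= 1 / 100).
Hypotheses (a1 : nrm2 a = 1) (f1 : forall j, nrm2 (f j) = 1).
Hypotheses (lam0 : forall j, 0 <= lam j) (cN : forall j, (1 - 2 * eps) * N <= c j).
Hypothesis fixed : forall j, (lam j)%:C *: f j = ((c j)%:C + w j) *: a + e j.
Hypothesis e_small : \sum_j nrm2 (e j) <= 2 * eps ^+ 4 * (n%:R * N ^+ 2) * (L + om^-1).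
Hypothesis im_w : \sum_j complex.Im (w j) ^+ 2 <=
  (1 + 4 * eps) * (n%:R * N ^+ 2 / (2 * om)).
Hypothesis few_large : \sum_j (~~ (`|complex.Re (w j)| <= eps * N))%:R <= eps * n%:R / om.

(** For most j the one-step bound applies. The exceptions are the few j with a
    large real part of the noise, and those with a large remainder, of which there
    are few by Markov; on these the trivial bound 4 is used. *)
Lemma step_sum_bound : \sum_j nrm2 (f j - a) <=
  (1 + 30 * eps) * (n%:R / (2 * om)) + eps * (n%:R * L).
Proof.
have /andP[e0 e1] := eps1.
have dist4 j : nrm2 (f j - a) <= 4.
  by have := nrm2D_le (f j) (- a); rewrite -scaleN1r nrm2Z f1 a1 /sqn /= oppr0 sqrrN; lra.
pose K := ((1 - 4 * eps) * N) ^- 2.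
have K0 : 0 <= K by rewrite invr_ge0 sqr_ge0.
have per j : nrm2 (f j - a) <= K * ((1 + eps) * complex.Im (w j) ^+ 2 + (1 + eps^-1) * nrm2 (e j)) +
   (4 * (~~ (`|complex.Re (w j)| <= eps * N))%:R + 4 / (eps ^+ 2 * N ^+ 2) * nrm2 (e j)).
  have t1 : 0 <= K * ((1 + eps) * complex.Im (w j) ^+ 2 + (1 + eps^-1) * nrm2 (e j)).
    rewrite mulr_ge0// addr_ge0// mulr_ge0 ?sqr_ge0 ?nrm2_ge0 ?addr_ge0 ?invr_ge0//; exact: ltW.
  have t2 : 0 <= 4 / (eps ^+ 2 * N ^+ 2) * nrm2 (e j).
    by rewrite mulr_ge0 ?nrm2_ge0// divr_ge0// mulr_ge0 ?sqr_ge0.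
  have [wN|wN] := boolP (`|complex.Re (w j)| <= eps * N); last first.
    by have := dist4 j; rewrite /=; lra.
  rewrite /= mulr0 add0r; have [eN|eN] := leP (nrm2 (e j)) (eps ^+ 2 * N ^+ 2).
    have := one_step_bound N0 eps1 a1 (f1 j) (lam0 j) (cN j) wN eN (fixed j).
    rewrite -/K; lra.
  have : 4 <= 4 / (eps ^+ 2 * N ^+ 2) * nrm2 (e j).
    rewrite -mulrA ler_peMr// mulrC ler_pdivlMr ?mul1r ?ltW//.
    by rewrite mulr_gt0 ?exprn_gt0.
  have := dist4 j; lra.
apply: (le_trans (ler_sum _ (fun j _ => per j))).
rewrite !big_split /= -!mulr_sumr big_split /= -!mulr_sumr.
have imw := im_w; have esm := e_small; have few := few_large.
set SI := \sum_j _ in imw *; set SE := \sum_j nrm2 (e j) in esm *.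
set SB := \sum_j _ in few *.
have SE0 : 0 <= SE by apply: sumr_ge0 => j _; exact: nrm2_ge0.
have SI0 : 0 <= SI by apply: sumr_ge0 => j _; exact: sqr_ge0.
have KN : K * N ^+ 2 <= 1 + 10 * eps.
  rewrite /K exprMn invfM mulfVK ?gt_eqF ?exprn_gt0//.
  rewrite -[leLHS]mul1r ler_pdivrMr ?exprn_gt0//; last by lra.
  nra.
have [q qE] : exists q, q = n%:R / om by exists (n%:R / om).
have q0 : 0 <= q by rewrite qE divr_ge0// ltW.
have [l lE] : exists l, l = n%:R * L by exists (n%:R * L).
have l0 : 0 <= l by rewrite lE mulr_ge0.
have bI : K * SI <= (1 + 10 * eps) * ((1 + 4 * eps) * (q / 2)).
  apply: (@le_trans _ _ (K * N ^+ 2 * ((1 + 4 * eps) * (q / 2)))); last first.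
    rewrite ler_wpM2r// mulr_ge0//; lra.
  rewrite -mulrA ler_wpM2l//; apply: (le_trans imw); apply: eq_le_imp.
  rewrite qE; field; exact: lt0r_neq0.
have bE : SE / N ^+ 2 <= 2 * eps ^+ 4 * (l + q).
  rewrite ler_pdivrMr ?exprn_gt0//; apply: (le_trans esm); apply: eq_le_imp.
  by rewrite qE lE; field; exact: lt0r_neq0.
have bKE : K * SE <= (1 + 10 * eps) * (2 * eps ^+ 4 * (l + q)).
  have -> : K * SE = (K * N ^+ 2) * (SE / N ^+ 2).
    have scale (x y t : R) : t != 0 -> x * y = (x * t) * (y / t) by move=> t0; field.
    by apply: scale; rewrite gt_eqF// exprn_gt0.
  apply: ler_pM => //; first by rewrite mulr_ge0 ?sqr_ge0.
  by rewrite divr_ge0 ?sqr_ge0.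
have bB : SB <= eps * q by rewrite qE mulrA.
have T1 : K * ((1 + eps) * SI) <= (1 + eps) * ((1 + 10 * eps) * ((1 + 4 * eps) * (q / 2))).
  by rewrite mulrCA ler_wpM2l//; lra.
have T2 : K * ((1 + eps^-1) * SE) <=
    (1 + 10 * eps) * ((2 * eps ^+ 4 + 2 * eps ^+ 3) * (l + q)).
  rewrite mulrCA; apply: (le_trans (ler_wpM2l _ bKE)); first by rewrite addr_ge0// invr_ge0 ltW.
  by apply: eq_le_imp; field; exact: lt0r_neq0.
have T3 : 4 / (eps ^+ 2 * N ^+ 2) * SE <= 8 * eps ^+ 2 * (l + q).
  have -> : 4 / (eps ^+ 2 * N ^+ 2) * SE = 4 / eps ^+ 2 * (SE / N ^+ 2).
    by field; rewrite !gt_eqF.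
  apply: (le_trans (ler_wpM2l _ bE)); first by rewrite divr_ge0 ?sqr_ge0.
  by apply: eq_le_imp; field; exact: lt0r_neq0.
rewrite mulrDr.
have E2 : eps ^+ 2 <= eps / 100 by rewrite expr2 ler_wpM2l ?(ltW e0)//; lra.
have E20 := sqr_ge0 eps.
have E3 : eps ^+ 3 <= eps ^+ 2 / 100 by rewrite exprSr ler_wpM2l//; lra.
have P1 : (1 + eps) * ((1 + 10 * eps) * ((1 + 4 * eps) * (q / 2))) <= (1 + 17 * eps) * (q / 2).
    rewrite !mulrA ler_wpM2r ?invr_ge0// ler_wpM2r//.
  rewrite [leLHS](_ : _ = 1 + 15 * eps + 54 * eps ^+ 2 + 40 * eps ^+ 3); last by ring.
  lra.
have P2 : (1 + 10 * eps) * ((2 * eps ^+ 4 + 2 * eps ^+ 3) * (l + q)) <= eps / 10 * (l + q).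
  rewrite mulrA ler_wpM2r ?addr_ge0//.
  have E4 : eps ^+ 4 <= eps ^+ 3 / 100 by rewrite exprSr ler_wpM2l ?exprn_ge0 ?(ltW e0)//; lra.
  have E5 : eps ^+ 5 <= eps ^+ 4 / 100 by rewrite exprSr ler_wpM2l ?exprn_ge0 ?(ltW e0)//; lra.
  rewrite [leLHS](_ : _ = 2 * eps ^+ 3 + 22 * eps ^+ 4 + 20 * eps ^+ 5); [lra|by ring].
have P3 : 8 * eps ^+ 2 * (l + q) <= 8 / 100 * eps * (l + q).
  by rewrite ler_wpM2r ?addr_ge0//; lra.
have -> : (1 + 30 * eps) * (n%:R / (2 * om)) + eps * (n%:R * L) = (1 + 30 * eps) * (q / 2) + eps * l.
  by rewrite qE lE; field; exact: lt0r_neq0.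
have : 0 <= eps * q by rewrite mulr_ge0// ltW.
have : 0 <= eps * l by rewrite mulr_ge0// ltW.
have : 4 * SB <= 4 * (eps * q) by rewrite ler_wpM2l.
lra.
Qed.

End StepSum.

(** * Hermitian matrices *)

Section Spectral.
Context {R : realType} {n : nat}.
Implicit Types (Z : 'M[R[i]]_n) (x : 'cV[R[i]]_n).
Local Open Scope complex_scope.

Lemma hermsymmxP Z : (Z \is hermsymmx) <-> (Z = Z ^t*).
Proof.
rewrite is_hermitianmxE expr0 scale1r.
by split => [/eqP//|/eqP].
Qed.

Lemma trmxC_mul (m k l : nat) (X : 'M[R[i]]_(m, k)) (Y : 'M[R[i]]_(k, l)) :
  (X *m Y) ^t* = Y ^t* *m X ^t*.
Proof. by rewrite trmx_mul map_mxM. Qed.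

Lemma hermitian_diag Z : Z \is hermsymmx ->
  exists (U : 'M[R[i]]_n) (d : 'rV[R]_n),
    [/\ U *m U ^t* = 1%:M, U ^t* *m U = 1%:M &
        Z = U ^t* *m diag_mx (map_mx (real_complex R) d) *m U].
Proof.
move=> Zh; have Uu := spectral_unitarymx Z.
have dreal := hermitian_spectral_diag_real Zh.
exists (spectralmx Z), (map_mx (@complex.Re R) (spectral_diag Z)).
have UU : spectralmx Z *m (spectralmx Z) ^t* = 1%:M by apply/unitarymxP.
split => //; first exact: mulmx1C.
have /hermitian_normalmx/orthomx_spectralP {1}-> := Zh.
rewrite (invmx_unitary Uu) (_ : map_mx _ _ = spectral_diag Z)//.
apply/rowP => i; rewrite !mxE.
by move/mxOverP: dreal => /(_ 0 i) /RRe_real ->.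
Qed.

Lemma qf_diagE (U : 'M[R[i]]_n) (d : 'rV[R[i]]_n) x :
  (x ^t* *m (U ^t* *m diag_mx d *m U) *m x) 0 0 =
  \sum_i d 0 i * (sqn ((U *m x) i 0))%:C.
Proof.
rewrite !mulmxA -trmxC_mul -!mulmxA mxE; apply: eq_bigr => i _.
by rewrite mul_diag_mx !mxE conjC_conjc -mulJ_sqn mulrCA [_ * _^*]mulrC.
Qed.

(** A square root of the eigenvalues gives the Gram vectors. *)
Lemma psd_factor Z : Z \is hermsymmx -> psd Z ->
  exists V : 'M[R[i]]_n, Z = V *m V ^t*.
Proof.
move=> Zh Zp; have [U [d [UU UU' ZE]]] := hermitian_diag Zh.
have d0 i : 0 <= d 0 i.
  have := Zp (U ^t* *m delta_mx i 0); rewrite ZE qf_diagE (bigD1 i)//= big1 => [|k ki].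
    by rewrite mulmxA UU mul1mx !mxE !eqxx sqn1 mulr1 addr0 ler0c.
  by rewrite mulmxA UU mul1mx !mxE (negPf ki) sqn0 mulr0.
pose D := diag_mx (map_mx (real_complex R) (map_mx Num.sqrt d)).
exists (U ^t* *m D); rewrite trmxC_mul trmxCK.
have -> : D ^t* = D.
  rewrite /D tr_diag_mx map_diag_mx; congr diag_mx; apply/rowP => i.
  by rewrite !mxE; exact: conjc_real.
have DD : D *m D = diag_mx (map_mx (real_complex R) d).
  rewrite /D mulmx_diag; congr diag_mx; apply/rowP => i; rewrite !mxE.
  by rewrite -rmorphM/= -expr2 sqr_sqrtr.
by rewrite mulmxA -(mulmxA _ D D) DD -ZE.
Qed.

Lemma sum_sqn_unitary (U : 'M[R[i]]_n) x : U ^t* *m U = 1%:M ->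
  \sum_i sqn ((U *m x) i 0) = \sum_i sqn (x i 0).
Proof.
move=> UU; have E (y : 'cV[R[i]]_n) : (y ^t* *m y) 0 0 = (\sum_i sqn (y i 0))%:C.
  rewrite mxE rmorph_sum; apply: eq_bigr => i _.
  by rewrite !mxE conjC_conjc mulrC mulJ_sqn.
apply: complexI; rewrite -!E trmxC_mul -mulmxA (mulmxA _ U) UU mul1mx.
by [].
Qed.

(** As Z is Hermitian its eigenvalues are real, so that lam, which dominates one of
    them in the partial order of the complex numbers, is real as well. *)
Lemma rayleigh_le Z lam x : (0 < n)%N -> Z \is hermsymmx ->
  (forall mu, eigenvalue Z mu -> mu <= lam) ->
  exists2 l : R, lam = l%:C &
    complex.Re ((x ^t* *m Z *m x) 0 0) <= l * \sum_i sqn (x i 0).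
Proof.
move=> n0 Zh Zlam; have [U [d [UU UU' ZE]]] := hermitian_diag Zh.
have dlam i : (d 0 i)%:C <= lam.
  apply: Zlam; apply/eigenvalueP; exists (row i U).
    rewrite ZE -row_mul !mulmxA UU mul1mx mul_diag_mx; apply/rowP => j.
    by rewrite !mxE.
  apply/eqP => U0; have := congr1 (fun X : 'M[R[i]]_n => X i i) UU.
  rewrite !mxE eqxx big1 => [/eqP|k _]; first by rewrite eq_sym oner_eq0.
  by move/rowP: U0 => /(_ k); rewrite !mxE => ->; rewrite mul0r.
have lamE : lam = (complex.Re lam)%:C.
  have := dlam (Ordinal n0); rewrite lecE /= => /andP[/eqP im0 _].
  by apply: complex_inj.
exists (complex.Re lam) => //.
rewrite ZE qf_diagE Re_sum -(sum_sqn_unitary x UU') mulr_sumr; apply: ler_sum => i _.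
rewrite ReM !mxE /= mulr0 subr0 ler_wpM2r ?sqn_ge0//.
by have := dlam i; rewrite lecE /= => /andP[].
Qed.

End Spectral.

(** * From sign vectors to complex vectors *)

Section ComplexBounds.
Context {R : realType} {n m : nat}.
Implicit Types (h : 'I_n -> 'rV[R[i]]_m).
Local Open Scope complex_scope.

(** A real matrix acts on the real and imaginary parts of each coordinate
    separately. *)
Lemma sum_nrm2_real_mx (X : 'I_n -> 'I_n -> R) (C : R) h :
  (forall x : 'I_n -> R, \sum_j (\sum_k X j k * x k) ^+ 2 <= C * \sum_k x k ^+ 2) ->
  \sum_j nrm2 (\sum_k (X j k)%:C *: h k) <= C * \sum_k nrm2 (h k).
Proof.
move=> HX.
have E : \sum_j nrm2 (\sum_k (X j k)%:C *: h k) =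
   \sum_i (\sum_j (\sum_k X j k * complex.Re (h k 0 i)) ^+ 2 +
           \sum_j (\sum_k X j k * complex.Im (h k 0 i)) ^+ 2).
  under eq_bigr do rewrite nrm2E; rewrite exchange_big /=; apply: eq_bigr => i _.
  rewrite -big_split /=; apply: eq_bigr => j _; rewrite summxE /sqn Re_sum Im_sum.
  by congr (_ ^+ 2 + _ ^+ 2); apply: eq_bigr => k _; rewrite mxE ?ReM ?ImM /=; ring.
rewrite E; under [in leRHS]eq_bigr do rewrite nrm2E.
rewrite exchange_big /= mulr_sumr; apply: ler_sum => i _.
by rewrite /sqn big_split mulrDr lerD.
Qed.

(** Real and imaginary parts of T double the rows, and those of h double the
    coordinates. A complex product mixes two real forms, which costs the factor 2. *)
Lemma grothendieck_complex (T : 'I_n -> 'I_n -> R[i]) (S : pred 'I_n) (s b : R) h :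
  0 < b ->
  (forall a : {ffun 'I_n -> bool},
    \sum_j sqn (\sum_(k | S k) T j k * (sgnb (a k))%:C) <= s) ->
  (forall k, nrm2 (h k) <= b) ->
  \sum_j nrm2 (\sum_(k | S k) T j k *: h k) <= 2 * 8 ^+ 6 * b * s.
Proof.
move=> b0 Hs hb; pose r := Num.sqrt b; have r0 : 0 < r by rewrite sqrtr_gt0.
have r2 : r ^+ 2 = b by rewrite sqr_sqrtr// ltW.
pose T' (j : 'I_n * bool) k := if j.2 then complex.Re (T j.1 k) else complex.Im (T j.1 k).
pose h' k (i : 'I_m * bool) :=
  (if i.2 then complex.Re (h k 0 i.1) else complex.Im (h k 0 i.1)) / r.
have Hs' (a : {ffun 'I_n -> bool}) : \sum_j (\sum_(k | S k) T' j k * sgnb (a k)) ^+ 2 <= s.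
  apply: le_trans (Hs a); apply: eq_le_imp.
  rewrite -(pair_bigA _ (fun j c => (\sum_(k | S k) T' (j, c) k * sgnb (a k)) ^+ 2)) /=.
  apply: eq_bigr => j _; rewrite big_bool /sqn Re_sum Im_sum.
  by congr (_ ^+ 2 + _ ^+ 2); apply: eq_bigr => k _; rewrite ?ReM ?ImM /T' /=; ring.
have fh' k : \sum_i h' k i ^+ 2 <= 1.
  rewrite -(pair_bigA _ (fun i c => h' k (i, c) ^+ 2)) /=.
  rewrite (_ : \sum_i _ = nrm2 (h k) / b) ?ler_pdivrMr ?mul1r//.
  rewrite nrm2E mulr_suml; apply: eq_bigr => i _; rewrite big_bool /h' /= !expr_div_n r2.
  by rewrite -mulrDl.
have := little_grothendieck Hs' fh'.
set F := \sum_i _ => HF.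
suff : \sum_j nrm2 (\sum_(k | S k) T j k *: h k) <= 2 * b * F.
  move=> H; apply: (le_trans H); rewrite [leRHS](_ : _ = 2 * b * (8 ^+ 6 * s)); last by ring.
  by rewrite ler_wpM2l// mulr_ge0// ltW.
under eq_bigr do rewrite nrm2E; rewrite exchange_big /=.
rewrite /F -(pair_bigA _ (fun i c => \sum_j (\sum_(k | S k) T' j k * h' k (i, c)) ^+ 2)) /=.
rewrite mulr_sumr; apply: ler_sum => i _; rewrite big_bool.
rewrite -!(pair_bigA _ (fun j c' => (\sum_(k | S k) T' (j, c') k * h' k (i, _)) ^+ 2)) /=.
rewrite -big_split mulr_sumr; apply: ler_sum => j _ /=; rewrite !big_bool /=.
rewrite summxE /sqn Re_sum Im_sum.
pose a c c' := \sum_(k | S k) T' (j, c) k * h' k (i, c').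
have -> : \sum_(k | S k) complex.Re ((T j k *: h k) 0 i) = r * (a true true - a false false).
  rewrite /a -sumrB mulr_sumr; apply: eq_bigr => k _; rewrite mxE ReM /T' /h' /=.
  by field; exact: lt0r_neq0.
have -> : \sum_(k | S k) complex.Im ((T j k *: h k) 0 i) = r * (a true false + a false true).
  rewrite /a -big_split mulr_sumr; apply: eq_bigr => k _; rewrite mxE ImM /T' /h' /=.
  by field; exact: lt0r_neq0.
rewrite -!/(a _ _) !exprMn r2 -mulrDr mulrAC [2 * _ * b]mulrC ler_wpM2l ?(ltW b0)//.
have := sqr_ge0 (a true true + a false false); have := sqr_ge0 (a true false - a false true).
nra.
Qed.

(** Sign vectors with zeros are encoded by functions to option bool: they form a finite
    type, over which the union bounds for the noise are taken. *)
Definition tval (o : option bool) : R := if o is Some c then sgnb c else 0.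

Definition supp_size (y : {ffun 'I_n -> option bool}) : nat := #|[pred k | y k != None]|.

(** Vectors h k longer than the square root of tau sit on at most theta n indices,
    by Markov, and the bound for sparse sign vectors applies to them. The other
    ones are short, and the global bound applies. The factor 73 is 9 + 64. *)
Lemma local_noise_bound (T : 'I_n -> 'I_n -> R[i]) (N tau theta L : R) h :
  0 < N -> 0 < tau -> L <= theta * tau ->
  (forall y : {ffun 'I_n -> option bool},
    \sum_j sqn (\sum_k T j k * (tval (y k))%:C) <= 64 * (n%:R * N)) ->
  (forall y : {ffun 'I_n -> option bool}, (supp_size y)%:R <= theta * n%:R ->
    \sum_j sqn (\sum_k T j k * (tval (y k))%:C) <= tau * (n%:R * N)) ->
  (forall k, nrm2 (h k) <= 9) -> \sum_k nrm2 (h k) <= n%:R * L ->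
  \sum_j nrm2 (\sum_k T j k *: h k) <= 2 * (2 * 8 ^+ 6 * (73 * tau)) * (n%:R * N).
Proof.
move=> N0 tau0 Lt H1 H2 h9 hL.
pose S k := nrm2 (h k) > tau.
pose ys (D : pred 'I_n) (a : {ffun 'I_n -> bool}) : {ffun 'I_n -> option bool} :=
  [ffun k => if D k then Some (a k) else None].
have ysE (D : pred 'I_n) (a : {ffun 'I_n -> bool}) j : \sum_(k | D k) T j k * (sgnb (a k))%:C = \sum_k T j k * (tval (ys D a k))%:C.
  by rewrite big_mkcond; apply: eq_bigr => k _; rewrite ffunE; case: (D k) => //=; rewrite mulr0.
have Sn : (#|[pred k | S k]|)%:R <= theta * n%:R.
  have : tau * (#|[pred k | S k]|)%:R <= n%:R * L.
    apply: le_trans hL; rewrite -sum1_card natr_sum mulr_sumr.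
    rewrite [leRHS](bigID (mem [pred k | S k])) /= -[leLHS]addr0 lerD//; last first.
      by apply: sumr_ge0 => k _; exact: nrm2_ge0.
    by apply: ler_sum => k; rewrite inE /S => /ltW; rewrite mulr1.
  move=> H; rewrite -(ler_pM2l tau0); apply: (le_trans H).
  rewrite [leRHS](_ : _ = n%:R * (theta * tau)); last by ring.
  by rewrite ler_wpM2l.
have bigS : \sum_j nrm2 (\sum_(k | S k) T j k *: h k) <= 2 * 8 ^+ 6 * 9 * (tau * (n%:R * N)).
  apply: grothendieck_complex => // a; under eq_bigr do rewrite ysE.
  apply: H2; apply: le_trans Sn; rewrite ler_nat /supp_size subset_leq_card//.
  by apply/fintype.subsetP => k; rewrite !inE /ys ffunE; case: (S k).
pose h0 k := if S k then 0 else h k.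
have smallS : \sum_j nrm2 (\sum_k T j k *: h0 k) <= 2 * 8 ^+ 6 * tau * (64 * (n%:R * N)).
  apply: (@grothendieck_complex T predT) => // [a|k].
    by under eq_bigr do rewrite (ysE predT); exact: H1.
  rewrite /h0 /S; case: ltP => // _; rewrite nrm2E big1 ?(ltW tau0)// => i _.
  by rewrite mxE sqn0.
apply: (@le_trans _ _ (\sum_j (2 * nrm2 (\sum_(k | S k) T j k *: h k) + 2 * nrm2 (\sum_k T j k *: h0 k)))).
  apply: ler_sum => j _; rewrite (bigID S)/=; apply: (le_trans (nrm2D_le _ _)).
  rewrite lerD2l; apply: eq_le_imp; congr (2 * nrm2 _); rewrite big_mkcond.
  by apply: eq_bigr => k _; rewrite /h0; case: (S k) => //=; rewrite scaler0.
rewrite big_split -!mulr_sumr /=; set q := 8 ^+ 6 in bigS smallS *.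
rewrite [leRHS](_ : _ = 2 * (2 * q * 9 * (tau * (n%:R * N))) + 2 * (2 * q * tau * (64 * (n%:R * N)))); last by ring.
by rewrite lerD// ler_wpM2l.
Qed.

End ComplexBounds.

(** * Optimality of the semidefinite program *)

Section Stationarity.
Context {R : realType} {n m : nat}.
Implicit Types (V : 'M[R[i]]_(n, m)).
Local Open Scope complex_scope.

Lemma dot_conjl (v w : 'rV[R[i]]_m) (c : R[i]) : dot v (c *: w) = dot (c^* *: v) w.
Proof.
apply: eq_bigr => i _; rewrite !mxE !ReM !ImM.
by case: c => a b /=; ring.
Qed.

Lemma row_mulE (M : 'M[R[i]]_n) V j : row j (M *m V) = \sum_k M j k *: row k V.
Proof. by rewrite row_mul mulmx_sum_row; apply: eq_bigr => k _; rewrite mxE. Qed.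

Definition sync_energy (M : 'M[R[i]]_n) V : R := \sum_j dot (row j V) (row j (M *m V)).

Variables (M : 'M[R[i]]_n) (V : 'M[R[i]]_(n, m)).
Hypotheses (M_herm : forall j k, M j k = (M k j)^*) (M_diag : forall j, M j j = 0).
Hypothesis V_unit : forall j, nrm2 (row j V) = 1.
Hypothesis V_max : forall V' : 'M[R[i]]_(n, m), (forall j, nrm2 (row j V') = 1) ->
  sync_energy M V' <= sync_energy M V.

(** Since M has zero diagonal, the energy is affine in each row separately. *)
Lemma block_optimality j (f : 'rV[R[i]]_m) : nrm2 f = 1 ->
  dot f (row j (M *m V)) <= dot (row j V) (row j (M *m V)).
Proof.
move=> f1; set g := row j (M *m V); pose e := f - row j V.
pose V' : 'M[R[i]]_(n, m) := V + delta_mx j (0 : 'I_1) *m e.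
have row_delta (X : 'M[R[i]]_(n, 1)) i : row i (X *m e) = X i 0 *: e.
  by rewrite row_mul mulmx_sum_row big_ord1 mxE (rowE 0) ; congr (_ *: _); rewrite -rowE; apply/rowP => ?; rewrite mxE.
have rowV' i : row i V' = row i V + (i == j)%:R *: e.
  by rewrite /V' raddfD /= row_delta !mxE eqxx andbT.
have V'1 i : nrm2 (row i V') = 1.
  rewrite rowV'; case: eqP => [->|_]; last by rewrite scale0r addr0.
  by rewrite scale1r addrC subrK.
have rowMV' i : row i (M *m V') = row i (M *m V) + M i j *: e.
  rewrite /V' mulmxDr raddfD /= mulmxA row_delta; congr (_ + _ *: _).
  rewrite mxE (bigD1 j)//= big1 => [|k kj]; rewrite !mxE ?eqxx ?mulr1 ?addr0//.
  by rewrite (negPf kj) mulr0.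
have := V_max V'1; rewrite /sync_energy.
rewrite (eq_bigr (fun i => dot (row i V) (row i (M *m V)) + (dot ((M i j)^* *: row i V) e +
    dot ((i == j)%:R *: e) (row i (M *m V) + M i j *: e)))); last first.
  by move=> i _; rewrite rowV' rowMV' dotDl dotDr -dot_conjl addrA.
rewrite !big_split /= -dot_suml.
have -> : \sum_i (M i j)^* *: row i V = g.
  rewrite /g row_mulE; apply: eq_bigr => i _; congr (_ *: _). exact: (esym (M_herm j i)).
rewrite [X in _ + (_ + X)](bigD1 j)//= [X in _ + (_ + (_ + X))]big1 => [|i ij]; last first.
  by rewrite (negPf ij) scale0r -(scale0r e) (dotZl 0) mul0r.
rewrite eqxx scale1r M_diag scale0r !addr0 -/g (dotC g) /e dotDl dotNl.
lra.
Qed.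

(** A unit vector V_j that maximizes the product with g is g / |g|. *)
Lemma stationarity j : exists2 lam : R, 0 <= lam & row j (M *m V) = lam%:C *: row j V.
Proof.
set g := row j (M *m V); have [g0|g0] := eqVneq (nrm2 g) 0.
  by exists 0 => //; rewrite scale0r; exact: nrm2_eq0.
pose nu := Num.sqrt (nrm2 g).
have nu0 : 0 < nu by rewrite sqrtr_gt0 lt_neqAle eq_sym g0 nrm2_ge0.
have nu2 : nu ^+ 2 = nrm2 g by rewrite sqr_sqrtr ?nrm2_ge0.
exists nu; first exact: ltW.
have f1 : nrm2 (nu^-1%:C *: g) = 1 by rewrite nrm2Z sqn_real exprVn nu2 mulVf.
have := block_optimality j f1; rewrite -/g dotZl -/(nrm2 g) -nu2 expr2 mulKf ?gt_eqF// => H.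
apply/eqP; rewrite -subr_eq0; apply/eqP/nrm2_eq0.
apply/eqP; rewrite eq_le nrm2_ge0 andbT nrm2B dotZr nrm2Z sqn_real V_unit dotC -nu2.
have := ler_wpM2l (ltW nu0) H; nra.
Qed.

End Stationarity.

Section InitialBound.
Context {R : realType} {n m : nat}.
Local Open Scope complex_scope.
Variables (A : 'I_n -> 'I_n -> R) (T : 'M[R[i]]_n) (V : 'M[R[i]]_(n, m)).
Variables (sig p epsA xi B : R).
Let N := n%:R * p.
Let M : 'M[R[i]]_n := \matrix_(j, k) ((A j k)%:C + sig%:C * T j k).
Hypotheses (n0 : (0 < n)%N) (p0 : 0 < p) (sig0 : 0 <= sig) (epsA0 : 0 <= epsA) (xi0 : 0 <= xi).
Hypothesis V_unit : forall j, nrm2 (row j V) = 1.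
Hypothesis V_better : \sum_j \sum_k complex.Re (M j k) <= sync_energy M V.
Hypothesis A_close : forall x : 'I_n -> R,
  \sum_j (\sum_k (A j k - p) * x k) ^+ 2 <= (epsA * N) ^+ 2 * \sum_k x k ^+ 2.
Hypothesis T_V : \sum_j nrm2 (\sum_k T j k *: row k V) <= B.
Hypothesis T_1 : \sum_j sqn (\sum_k T j k) <= B.
Hypothesis sigB : sig ^+ 2 * (n%:R * B) <= (xi * (n%:R * N)) ^+ 2.

(** V has at least the energy of the all-ones solution. In both energies, replace
    A by p J and drop the noise: the difference p (n^2 - |sum_k V_k|^2) of the main
    terms is bounded by the four errors made. *)
Lemma initial_bound :
  n%:R ^+ 2 - nrm2 (\sum_k row k V) <= (2 * epsA + 2 * xi) * n%:R ^+ 2.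
Proof.
have n0R : 0 < n%:R :> R by rewrite ltr0n.
have N0 : 0 < N by rewrite mulr_gt0.
pose v k := row k V.
have sum1 : \sum_(k < n) (1 : R) = n%:R by rewrite sumr_const card_ord.
have sum_unit : \sum_k nrm2 (v k) = n%:R by rewrite -sum1; apply: eq_bigr => k _; exact: V_unit.
have EV : sync_energy M V = \sum_j \sum_k (A j k - p) * dot (v j) (v k) +
    p * nrm2 (\sum_k v k) + sig * \sum_j dot (v j) (\sum_k T j k *: v k).
  rewrite /nrm2 dot_suml !mulr_sumr -!big_split /=; apply: eq_bigr => j _.
  rewrite row_mulE -/(v j) !dot_sumr !mulr_sumr -!big_split /=.
  apply: eq_bigr => k _ /=; rewrite mxE scalerDl dotDr dotZr.
  by rewrite -scalerA dotZr -/(v k); ring.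
have E1 : \sum_j \sum_k complex.Re (M j k) = \sum_j \sum_k (A j k - p) +
    p * n%:R ^+ 2 + sig * \sum_j complex.Re (\sum_k T j k).
  rewrite expr2 -{1}sum1 mulr_suml !mulr_sumr -!big_split /=; apply: eq_bigr => j _.
  rewrite Re_sum mul1r -sum1 !mulr_sumr -!big_split /=; apply: eq_bigr => k _.
  by rewrite mxE ReD ReM /=; ring.
have abs_le (x y : R) : 0 <= y -> x ^+ 2 <= y ^+ 2 -> -y <= x <= y.
  by move=> y0; rewrite -ler_norml -[x ^+ 2]real_normK ?num_real// ler_pXn2r// nnegrE.
have CSsum (x y : 'I_n -> 'rV[R[i]]_m) :
    (\sum_j dot (x j) (y j)) ^+ 2 <= (\sum_j nrm2 (x j)) * \sum_j nrm2 (y j).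
  pose f (z : 'I_n -> 'rV[R[i]]_m) : 'rV[R[i]]_(n * m) := mxvec (\matrix_j z j).
  have fE z z' : dot (f z) (f z') = \sum_j dot (z j) (z' j).
    rewrite /dot /f (reindex _ (curry_mxvec_bij _ _))/=.
    rewrite [RHS](pair_bigA _ (fun j k => complex.Re (z j 0 k) * complex.Re (z' j 0 k) + complex.Im (z j 0 k) * complex.Im (z' j 0 k))) /=.
    by apply: eq_bigr => -[j k] _ /=; rewrite !mxvecE !mxE.
  have := CauchySchwarz_dot (f x) (f y); rewrite /nrm2 !fE.
  by [].
(* The errors of the graph are [a1] and [a2], those of the noise [t1] and [t2]. *)
have a1 : - (epsA * N * n%:R) <= \sum_j \sum_k (A j k - p) <= epsA * N * n%:R.
  apply: abs_le; first by rewrite mulr_ge0// mulr_ge0// ltW.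
  have := CauchySchwarz_sum predT (fun _ : 'I_n => 1) (fun j => \sum_k (A j k - p)).
  rewrite (eq_bigr (fun j => \sum_k (A j k - p))) => [|j _]; last by rewrite mul1r.
  move=> H; apply: (le_trans H).
  rewrite (eq_bigr (fun=> 1)) => [|j _]; last by rewrite expr1n.
  rewrite sum1; have := A_close (fun=> 1).
  rewrite [X in _ <= _ * X -> _](eq_bigr (fun=> 1)) => [|j _]; last by rewrite expr1n.
  rewrite sum1 => H1; rewrite exprMn mulrC expr2 mulrA ler_wpM2r// ?(ltW n0R)//.
  apply: le_trans H1; apply: eq_le_imp; apply: eq_bigr => j _; congr (_ ^+ 2).
  by apply: eq_bigr => k _; rewrite mulr1.
have a2 : - (epsA * N * n%:R) <= \sum_j \sum_k (A j k - p) * dot (v j) (v k) <= epsA * N * n%:R.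
  apply: abs_le; first by rewrite mulr_ge0// mulr_ge0// ltW.
  have -> : \sum_j \sum_k (A j k - p) * dot (v j) (v k) =
     \sum_j dot (v j) (\sum_k (A j k - p)%:C *: v k).
    by apply: eq_bigr => j _; rewrite dot_sumr; apply: eq_bigr => k _; rewrite dotZr.
  apply: (le_trans (CSsum _ _)); rewrite sum_unit.
  have := @sum_nrm2_real_mx R n m (fun j k => A j k - p) _ v A_close.
  rewrite sum_unit => H; rewrite exprMn mulrC expr2 mulrA ler_wpM2r// ltW//.
have t1 : - (xi * (n%:R * N)) <= sig * \sum_j complex.Re (\sum_k T j k) <= xi * (n%:R * N).
  apply: abs_le; first by rewrite mulr_ge0// mulr_ge0// ltW.
  rewrite exprMn; apply: le_trans sigB; rewrite ler_wpM2l ?sqr_ge0//.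
  have := CauchySchwarz_sum predT (fun _ : 'I_n => 1) (fun j => complex.Re (\sum_k T j k)).
  rewrite (eq_bigr (fun j => complex.Re (\sum_k T j k))) => [|j _]; last by rewrite mul1r.
  move=> H; apply: (le_trans H).
  rewrite (eq_bigr (fun=> 1)) => [|j _]; last by rewrite expr1n.
  rewrite sum1 ler_wpM2l ?(ltW n0R)//; apply: le_trans T_1; apply: ler_sum => j _.
  by rewrite /sqn lerDl sqr_ge0.
have t2 : - (xi * (n%:R * N)) <= sig * \sum_j dot (v j) (\sum_k T j k *: v k) <= xi * (n%:R * N).
  apply: abs_le; first by rewrite mulr_ge0// mulr_ge0// ltW.
  rewrite exprMn; apply: le_trans sigB; rewrite ler_wpM2l ?sqr_ge0//.
  by apply: (le_trans (CSsum _ _)); rewrite sum_unit ler_wpM2l ?(ltW n0R).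
have H := V_better; rewrite EV E1 in H.
have : p * (n%:R ^+ 2 - nrm2 (\sum_k v k)) <= p * ((2 * epsA + 2 * xi) * n%:R ^+ 2).
  have -> : p * ((2 * epsA + 2 * xi) * n%:R ^+ 2) = 2 * (epsA * N * n%:R) + 2 * (xi * (n%:R * N)).
    by rewrite /N; ring.
  move: a1 a2 t1 t2 => /andP[? ?] /andP[? ?] /andP[? ?] /andP[? ?]; lra.
by rewrite ler_pM2l.
Qed.

End InitialBound.

(** * Solutions of the fixed-point equation *)

Section FixedPoint.
Context {R : realType} {n : nat}.
Local Open Scope complex_scope.
Variables (A : 'I_n -> 'I_n -> R) (T : 'M[R[i]]_n).
Variables (sig p eps tau theta epsA : R).
Let N := n%:R * p.
Let om := N / sig ^+ 2.
Let M : 'M[R[i]]_n := \matrix_(j, k) ((A j k)%:C + sig%:C * T j k).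
Hypotheses (n0 : (0 < n)%N) (p0 : 0 < p) (sig0 : 0 < sig) (eps1 : 0 < eps <= 1 / 100).
Hypotheses (tau0 : 0 < tau) (epsA0 : 0 <= epsA) (epsA1 : epsA <= eps ^+ 2).
Hypothesis tau_eps : 292 * 8 ^+ 6 * tau <= eps ^+ 4.
Hypothesis A_close : forall x : 'I_n -> R,
  \sum_j (\sum_k (A j k - p) * x k) ^+ 2 <= (epsA * N) ^+ 2 * \sum_k x k ^+ 2.
Hypothesis A_degree : forall j, `|\sum_k A j k - N| <= eps * N.
Hypothesis T_all : forall y : {ffun 'I_n -> option bool},
  \sum_j sqn (\sum_k T j k * (tval (y k))%:C) <= 64 * (n%:R * N).
Hypothesis T_sparse : forall y : {ffun 'I_n -> option bool}, (supp_size y)%:R <= theta * n%:R ->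
  \sum_j sqn (\sum_k T j k * (tval (y k))%:C) <= tau * (n%:R * N).
Hypothesis T_im : \sum_j complex.Im (\sum_k T j k) ^+ 2 <= (1 + 4 * eps) * (n%:R * N / 2).
Hypothesis T_re : \sum_j (~~ (`|sig * complex.Re (\sum_k T j k)| <= eps * N))%:R <= eps * n%:R / om.

(** Stated for an equation lam_j f_j = (M V)_j in which f need not be V, since for
    the eigenvector the rows of V are not normalized whereas its phases f are. With
    h_k = V_k - a the mean of h is - L a / 2, so that replacing A by p J only
    modifies the coefficient of a. *)
Lemma fixed_point_bound m (V : 'M[R[i]]_(n, m)) (a : 'rV[R[i]]_m)
    (f : 'I_n -> 'rV[R[i]]_m) (lam : 'I_n -> R) (L : R) :
  0 <= L -> L <= theta * tau -> L <= 2 * eps -> nrm2 a = 1 ->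
  \sum_k row k V = (n%:R * (1 - L / 2))%:C *: a ->
  \sum_k nrm2 (row k V) = n%:R -> (forall k, nrm2 (row k V) <= 4) ->
  (forall j, nrm2 (f j) = 1) -> (forall j, 0 <= lam j) ->
  (forall j, (lam j)%:C *: f j = row j (M *m V)) ->
  \sum_j nrm2 (f j - a) <= (1 + 30 * eps) * (n%:R / (2 * om)) + eps * (n%:R * L).
Proof.
move=> L0 L1 L2 a1 meanV sumV V4 f1 lam0 fixf.
have n0R : 0 < n%:R :> R by rewrite ltr0n.
have N0 : 0 < N by rewrite mulr_gt0.
have om0 : 0 < om by rewrite divr_gt0 ?exprn_gt0.
have /andP[e0 e1] := eps1.
pose h k := row k V - a.
have sumh : \sum_k h k = (- (n%:R * (L / 2)))%:C *: a.
  rewrite /h sumrB meanV sumr_const card_ord -[a *+ n]scaler_nat -scalerBl; congr (_ *: _).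
  by rewrite -(rmorph_nat (real_complex R) n) -rmorphB /=; congr _%:C; ring.
have nrmh : \sum_k nrm2 (h k) = n%:R * L.
  under eq_bigr do rewrite nrm2B.
  rewrite big_split sumrB /= sumV -mulr_sumr -dot_suml meanV dotZl -/(nrm2 a) a1.
  by rewrite sumr_const card_ord; field.
have h9 k : nrm2 (h k) <= 9.
  rewrite (_ : 9 = (2 + 1) ^+ 2); last by ring.
  apply: nrm2_norm_ge => //; first by rewrite (_ : 2 ^+ 2 = 4) //; ring.
  by rewrite -scaleN1r nrm2Z a1 /sqn /= oppr0; lra.
pose e j := \sum_k (A j k - p)%:C *: h k + sig%:C *: \sum_k T j k *: h k.
pose c j := \sum_k A j k - N * (L / 2).
pose w j := sig%:C * \sum_k T j k.
apply: (@step_sum_bound R m n a f e w c lam N eps om L) => //.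
- move=> j; have := A_degree j; rewrite ler_norml => /andP[d1 _].
  have : N * (L / 2) <= N * eps by rewrite ler_wpM2l ?(ltW N0)//; lra.
  rewrite /c; lra.
- move=> j; rewrite fixf row_mulE /e /c /w.
  have -> : \sum_k M j k *: row k V = \sum_k (A j k - p)%:C *: h k + p%:C *: \sum_k h k +
      (\sum_k A j k)%:C *: a + sig%:C *: \sum_k T j k *: h k + (sig%:C * \sum_k T j k) *: a.
    rewrite rmorph_sum /= mulr_sumr !scaler_sumr !scaler_suml -!big_split /=.
    apply: eq_bigr => k _; rewrite mxE /h rmorphB /=; apply/rowP => i; rewrite !mxE; ring.
  have -> : (\sum_k A j k - N * (L / 2))%:C = (\sum_k A j k)%:C + p%:C * (- (n%:R * (L / 2)))%:C.
    by rewrite -rmorphM -rmorphD /=; congr _%:C; rewrite /N; ring.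
  rewrite sumh scalerA.
  set E1 := \sum_k (A j k - p)%:C *: h k; set E2 := sig%:C *: \sum_k T j k *: h k.
  by apply/rowP => i; rewrite !mxE; ring.
- have B1 := @sum_nrm2_real_mx R n m (fun j k => A j k - p) _ h A_close.
  have hL : \sum_k nrm2 (h k) <= n%:R * L by rewrite nrmh.
  have B2 := local_noise_bound N0 tau0 L1 T_all T_sparse h9 hL.
  apply: (@le_trans _ _ (2 * ((epsA * N) ^+ 2 * (n%:R * L)) +
     2 * (sig ^+ 2 * (2 * (2 * 8 ^+ 6 * (73 * tau)) * (n%:R * N))))).
    apply: (@le_trans _ _ (\sum_j (2 * nrm2 (\sum_k (A j k - p)%:C *: h k) +
       2 * (sig ^+ 2 * nrm2 (\sum_k T j k *: h k))))).
      by apply: ler_sum => j _; apply: (le_trans (nrm2D_le _ _)); rewrite nrm2Z sqn_real.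
    rewrite big_split -!mulr_sumr /= -nrmh lerD// ler_wpM2l//.
    by rewrite ler_wpM2l ?sqr_ge0.
  rewrite mulrDr lerD//.
    rewrite exprMn [leRHS](_ : _ = 2 * (eps ^+ 4 * N ^+ 2 * (n%:R * L))); last by ring.
    rewrite ler_wpM2l// ler_wpM2r ?mulr_ge0 ?(ltW n0R)// ler_wpM2r ?sqr_ge0//.
    by rewrite (exprM eps 2 2) lerXn2r ?nnegrE ?sqr_ge0.
  have sN : sig ^+ 2 = N * om^-1 by rewrite /om invf_div mulrC divfK ?gt_eqF.
  rewrite sN [leLHS](_ : _ = 2 * (292 * 8 ^+ 6 * tau) * (n%:R * N ^+ 2 * om^-1)); last by ring.
  rewrite [leRHS](_ : _ = 2 * eps ^+ 4 * (n%:R * N ^+ 2 * om^-1)); last by ring.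
  rewrite ler_wpM2r// ?ler_wpM2l// !mulr_ge0 ?invr_ge0 ?sqr_ge0 ?(ltW om0)// ltW//.
- have -> : \sum_j complex.Im (w j) ^+ 2 = sig ^+ 2 * \sum_j complex.Im (\sum_k T j k) ^+ 2.
    rewrite mulr_sumr; apply: eq_bigr => j _; rewrite /w ImM /=; ring.
  rewrite [leRHS](_ : _ = sig ^+ 2 * ((1 + 4 * eps) * (n%:R * N / 2))).
    by rewrite ler_wpM2l ?sqr_ge0.
  by rewrite /om; field; rewrite !gt_eqF.
- apply: le_trans T_re; apply: eq_le_imp; apply: eq_bigr => j _.
  by rewrite /w ReM /= mul0r subr0.
Qed.

End FixedPoint.

(** * Eigenvectors of a Gram matrix *)

Section Eigenvector.
Context {R : realType} {n : nat}.
Local Open Scope complex_scope.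

Lemma conjcM (x y : R[i]) : conjc (x * y) = conjc x * conjc y.
Proof. by case: x => a b; case: y => c d; apply: complex_inj => /=; ring. Qed.

Lemma conjc_sum (I : Type) (s : seq I) (D : pred I) (F : I -> R[i]) :
  conjc (\sum_(i <- s | D i) F i) = \sum_(i <- s | D i) conjc (F i).
Proof.
elim/big_ind2: _ => [|x1 x2 y1 y2 <- <-|//]; first by apply: complex_inj; rewrite //= oppr0.
by case: x1 => a b; case: y1 => c d; apply: complex_inj => //=; ring.
Qed.

Lemma conjcKK (x : R[i]) : conjc (conjc x) = x.
Proof. by case: x => a b /=; rewrite opprK. Qed.

Definition hdot m (v w : 'rV[R[i]]_m) : R[i] := \sum_i v 0 i * conjc (w 0 i).

Lemma Re_hdot m (v w : 'rV[R[i]]_m) : complex.Re (hdot v w) = dot v w.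
Proof.
rewrite Re_sum; apply: eq_bigr => i _; rewrite ReM.
by case: (w 0 i) => a b /=; ring.
Qed.

Lemma hdotZl m (v w : 'rV[R[i]]_m) c : hdot (c *: v) w = c * hdot v w.
Proof. by rewrite mulr_sumr; apply: eq_bigr => i _; rewrite mxE mulrA. Qed.

Lemma hdotBl m (u v w : 'rV[R[i]]_m) : hdot (u - v) w = hdot u w - hdot v w.
Proof. by rewrite -sumrB; apply: eq_bigr => i _; rewrite !mxE mulrBl. Qed.

Lemma sqn_hdot_le m (v w : 'rV[R[i]]_m) : sqn (hdot v w) <= nrm2 v * nrm2 w.
Proof.
set c := hdot v w; have [->|c0] := eqVneq (sqn c) 0.
  by rewrite mulr_ge0 ?nrm2_ge0.
have sc : 0 < sqn c by rewrite lt_neqAle eq_sym c0 sqn_ge0.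
have d : dot ((conjc c) *: v) w = sqn c.
  by rewrite -Re_hdot hdotZl -/c mulrC mulJ_sqn.
have := CauchySchwarz_dot ((conjc c) *: v) w; rewrite d nrm2Z sqn_conj expr2 -mulrA.
by rewrite ler_pM2l.
Qed.

Variables (V : 'M[R[i]]_n) (u : 'I_n -> R[i]) (l m : R).
Hypotheses (n0 : (0 < n)%N) (V_unit : forall j, nrm2 (row j V) = 1).
Hypothesis m2 : n%:R ^+ 2 * m <= nrm2 (\sum_k row k V).
Hypotheses (m_half : 1 / 2 <= m) (u_norm : \sum_j sqn (u j) = n%:R).
Hypothesis lm : n%:R * m <= l.
Hypothesis u_eigen : forall j, l%:C * u j = \sum_k hdot (row j V) (row k V) * u k.

Let b : 'rV[R[i]]_n := \sum_k conjc (u k) *: row k V.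

Let hdot_b v : hdot v b = \sum_k hdot v (row k V) * u k.
Proof.
rewrite /hdot /b; under eq_bigr do rewrite summxE conjc_sum mulr_sumr.
rewrite exchange_big /=; apply: eq_bigr => k _; rewrite mulr_suml.
by apply: eq_bigr => i _; rewrite mxE conjcM conjcKK mulrCA mulrC.
Qed.

Let l_gt0 : 0 < l.
Proof.
have m0 : 0 < m by have := m_half; lra.
by apply: lt_le_trans lm; rewrite mulr_gt0 ?ltr0n.
Qed.

Let nrm2_b : nrm2 b = l * n%:R.
Proof.
rewrite /nrm2 -Re_hdot {1}/b.
have -> : hdot (\sum_k conjc (u k) *: row k V) b = \sum_k conjc (u k) * hdot (row k V) b.
  rewrite {1}/hdot; under eq_bigr do rewrite summxE mulr_suml.
  rewrite exchange_big /=; apply: eq_bigr => k _; rewrite -hdotZl.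
  by apply: eq_bigr => i _; rewrite /b summxE.
rewrite (eq_bigr (fun k => l%:C * (sqn (u k))%:C)) => [|k _]; last first.
  by rewrite hdot_b -u_eigen -mulJ_sqn mulrCA [conjc _ * _]mulrC.
by rewrite -mulr_sumr -rmorph_sum u_norm -rmorphM.
Qed.

(** With b = sum_k conj(u_k) V_k, the eigenvalue equation reads
    l u_j = <V_j, b>. Applying M to the rows V_j multiplies row j by lam_j. *)
Lemma eigenvector_stationary (M : 'M[R[i]]_n) (lam : 'I_n -> R) :
  (forall j, row j (M *m V) = (lam j)%:C *: row j V) ->
  forall j, \sum_k M j k * u k = (lam j)%:C * u j.
Proof.
move=> MV j; have lC : l%:C != 0 by rewrite (inj_eq (@complexI R)) gt_eqF.
apply: (mulfI lC); rewrite mulrCA u_eigen -hdot_b -hdotZl -MV row_mulE.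
rewrite mulr_sumr (eq_bigr (fun k => M j k * hdot (row k V) b)) => [|k _].
  rewrite /hdot; under [RHS]eq_bigr do rewrite summxE mulr_suml.
  rewrite [RHS]exchange_big /=; apply: eq_bigr => k _; rewrite mulr_sumr.
  by apply: eq_bigr => i _; rewrite !mxE mulrA.
by rewrite mulrCA u_eigen -hdot_b.
Qed.

(** By Cauchy and Schwarz, l^2 |u_j|^2 <= |b|^2 = l n. *)
Lemma eigenvector_entry_le j : sqn (u j) <= 4.
Proof.
have := sqn_hdot_le (row j V) b; rewrite hdot_b -u_eigen sqnM sqn_real V_unit nrm2_b mul1r.
rewrite expr2 -mulrA ler_pM2l// => H.
have : n%:R * m * sqn (u j) <= n%:R by apply: le_trans H; rewrite ler_wpM2r ?sqn_ge0.
rewrite -mulrA -[leRHS]mulr1 ler_pM2l ?ltr0n//; have s0 := sqn_ge0 (u j).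
move=> ms; have := ler_wpM2r s0 m_half; lra.
Qed.

(** As l u_j = <V_j, b>, the differences u_j - u_k are controlled by V_j - V_k, and
    the sum of all their squares measures the distance of the mean to maximal
    length, on both sides. *)
Lemma eigenvector_mean_ge : m <= 1 ->
  n%:R ^+ 2 * (1 - 2 * (1 - m)) <= sqn (\sum_k u k).
Proof.
move=> m1; have mh := m_half.
have n0R : 0 < n%:R :> R by rewrite ltr0n.
have diff j k : l * sqn (u j - u k) <= n%:R * nrm2 (row j V - row k V).
  have := sqn_hdot_le (row j V - row k V) b.
  rewrite hdotBl !hdot_b -!u_eigen -mulrBr sqnM sqn_real nrm2_b expr2 -mulrA.
  rewrite [leRHS](_ : _ = l * (n%:R * nrm2 (row j V - row k V))); last by ring.
  by rewrite ler_pM2l.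
have sqnB (x y : R[i]) : sqn (x - y) = sqn x + sqn y - 2 * complex.Re (x * conjc y).
  by case: x => a c; case: y => a' c'; rewrite /sqn /=; ring.
have S1 : \sum_j \sum_k sqn (u j - u k) = 2 * n%:R ^+ 2 - 2 * sqn (\sum_k u k).
  have -> : sqn (\sum_k u k) = \sum_j \sum_k complex.Re (u j * conjc (u k)).
    have -> : sqn (\sum_k u k) = complex.Re ((\sum_k u k) * conjc (\sum_k u k)).
      by rewrite mulJ_sqn.
    rewrite mulr_suml Re_sum; apply: eq_bigr => j _.
    by rewrite conjc_sum mulr_sumr Re_sum.
  under eq_bigr do under eq_bigr do rewrite sqnB.
  under eq_bigr do rewrite sumrB big_split /= u_norm sumr_const card_ord -mulr_sumr.
  rewrite sumrB big_split /= -mulr_sumr sumr_const card_ord sumrMnl u_norm.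
  by rewrite -[n%:R *+ n]mulr_natl; ring.
have S2 : \sum_j \sum_k nrm2 (row j V - row k V) = 2 * n%:R ^+ 2 - 2 * nrm2 (\sum_k row k V).
  under eq_bigr do under eq_bigr do rewrite nrm2B !V_unit.
  under eq_bigr do rewrite big_split sumrB /= sumr_const card_ord -mulr_sumr -dot_sumr.
  rewrite big_split sumrB /= -mulr_sumr -dot_suml sumr_const card_ord -/(nrm2 _).
  by rewrite -[n%:R *+ n]mulr_natl; ring.
have : l * (2 * n%:R ^+ 2 - 2 * sqn (\sum_k u k)) <= n%:R * (2 * n%:R ^+ 2 - 2 * nrm2 (\sum_k row k V)).
  rewrite -S1 -S2 !mulr_sumr; apply: ler_sum => j _; rewrite !mulr_sumr.
  by apply: ler_sum => k _; exact: diff.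
move=> H.
have [Hle|Hlt] := leP (n%:R ^+ 2) (sqn (\sum_k u k)).
  by apply: le_trans Hle; rewrite ler_piMr ?sqr_ge0//; lra.
have : n%:R * m * (2 * n%:R ^+ 2 - 2 * sqn (\sum_k u k)) <= n%:R * (2 * n%:R ^+ 2 - 2 * (n%:R ^+ 2 * m)).
  apply: (@le_trans _ _ (n%:R * (2 * n%:R ^+ 2 - 2 * nrm2 (\sum_k row k V)))).
    by apply: le_trans H; rewrite ler_wpM2r//; lra.
  by rewrite ler_wpM2l ?(ltW n0R)//; have := m2; lra.
rewrite -mulrA ler_pM2l//; set s := sqn _; set q := n%:R ^+ 2 => H1.
have : (1/2) * (q - s) <= m * (q - s) by apply: ler_wpM2r => //; rewrite subr_ge0 ltW.
move: H1; rewrite -/s in Hlt *; rewrite -/q in Hlt *; lra.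
Qed.

End Eigenvector.

(** * Gram matrices and changes of phases *)

Section GramMatrices.
Context {R : realType} {n : nat}.
Local Open Scope complex_scope.
Implicit Types (V M : 'M[R[i]]_n).

Lemma gramE m (V : 'M[R[i]]_(n, m)) j k : (V *m V ^t*) j k = hdot (row j V) (row k V).
Proof. by rewrite mxE; apply: eq_bigr => i _; rewrite !mxE. Qed.

Lemma gram_feasible V : (forall j, nrm2 (row j V) = 1) -> sdp_feasible (V *m V ^t*).
Proof.
move=> V1; split.
- by apply/hermsymmxP; rewrite trmxC_mul trmxCK.
- move=> j; rewrite gramE; apply: complex_inj; first by rewrite Re_hdot -/(nrm2 _) V1.
  by rewrite Im_sum big1 // => i _; rewrite mulJ_sqn.
- move=> x; have -> : x ^t* *m (V *m V ^t*) *m x = (V ^t* *m x) ^t* *m (V ^t* *m x).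
    by rewrite trmxC_mul trmxCK !mulmxA.
  rewrite mxE; apply: sumr_ge0 => i _; rewrite !mxE mulrC.
  by rewrite -/(conjc _) mulJ_sqn ler0c sqn_ge0.
Qed.

Lemma Re_trace_gram M V : complex.Re (\tr (M *m (V *m V ^t*))) = sync_energy M V.
Proof.
rewrite mulmxA /mxtrace Re_sum; apply: eq_bigr => j _.
rewrite mxE dotC -Re_hdot; congr complex.Re; apply: eq_bigr => i _.
by rewrite !mxE.
Qed.

Definition phase_conj m (z : 'I_n -> R[i]) (V : 'M[R[i]]_(n, m)) : 'M[R[i]]_(n, m) :=
  \matrix_(j, k) (z j * V j k).

Lemma row_phase_conj m z (V : 'M[R[i]]_(n, m)) j : row j (phase_conj z V) = z j *: row j V.
Proof. by apply/rowP => i; rewrite !mxE. Qed.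

Lemma sync_energy_conj m (z : 'I_n -> R[i]) M M' (V : 'M[R[i]]_(n, m)) :
  (forall j k, M' j k = conjc (z j) * M j k * z k) ->
  sync_energy M (phase_conj z V) = sync_energy M' V.
Proof.
move=> M'E; apply: eq_bigr => j _; rewrite !row_mulE row_phase_conj dotC.
rewrite dot_conjl dotC; congr (dot _ _); rewrite scaler_sumr; apply: eq_bigr => k _.
by rewrite row_phase_conj !scalerA M'E mulrA.
Qed.

End GramMatrices.

(** * Bounds that hold for all estimates *)

Section TrivialBounds.
Context {R : realType} {n : nat}.
Implicit Types (Z : 'M[R[i]]_n) (z u : 'cV[R[i]]_n).

Lemma sqn_sub_le4 (x y : R[i]) : sqn x <= 1 -> sqn y <= 1 -> sqn (x - y) <= 4.
Proof.
case: x => a b; case: y => c e; rewrite /sqn /= => h1 h2.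
have := sqr_ge0 (a + c); have := sqr_ge0 (b + e); nra.
Qed.

(** The entries are inner products of unit vectors. *)
Lemma feasible_entry_le Z j k : sdp_feasible Z -> sqn (Z j k) <= 1.
Proof.
move=> [Zh Z1 Zp]; have [V ZE] := psd_factor Zh Zp.
have V1 i : nrm2 (row i V) = 1 by rewrite /nrm2 -Re_hdot -gramE -ZE Z1.
by rewrite ZE gramE; apply: le_trans (sqn_hdot_le _ _) _; rewrite !V1 mulr1.
Qed.

Lemma frobenius_le4 Z z : (0 < n)%N -> sdp_feasible Z -> (forall j, `|z j 0| = 1) ->
  (n%:R ^+ 2)^-1 * frobenius_norm (Z - z *m z ^t*) ^+ 2 <= 4.
Proof.
move=> n0 Zf z1; have n0R : 0 < n%:R :> R by rewrite ltr0n.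
rewrite mulrC ler_pdivrMr ?exprn_gt0//.
have -> : frobenius_norm (Z - z *m z ^t*) ^+ 2 = \sum_j \sum_k sqn ((Z - z *m z ^t*) j k).
  rewrite sqr_sqrtr; last by do 2 apply: sumr_ge0 => ? _; exact: sqr_ge0.
  by apply: eq_bigr => j _; apply: eq_bigr => k _; rewrite sqr_normc.
apply: (@le_trans _ _ (\sum_(j < n) \sum_(k < n) 4)); last first.
  by rewrite !sumr_const !card_ord -mulrnA -[leLHS]mulr_natr natrM expr2.
apply: ler_sum => j _; apply: ler_sum => k _; rewrite mxE [X in sqn (_ + X)]mxE.
apply: sqn_sub_le4; first exact: feasible_entry_le.
by rewrite mxE big_ord1 !mxE sqnM sqn_conj !sqn_unit// mulr1.
Qed.

Lemma sqn_phases u j : sqn (phases u j 0) = 1.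
Proof.
rewrite mxE; case: eqVneq => [_|uj0]; first exact: sqn1.
by apply: sqn_unit; rewrite normrM normfV normr_id divff// normr_eq0.
Qed.

Lemma phase_loss_le z u (al : R[i]) : `|al| = 1 ->
  phase_loss (phases u) z <= n%:R^-1 * \sum_j sqn (phases u j 0 - z j 0 * al).
Proof.
move=> al1; under eq_bigr do rewrite -sqr_normc.
apply: ge_inf; last by exists al.
exists 0 => _ [a _ <-]; rewrite mulr_ge0 ?invr_ge0// sumr_ge0// => j _; exact: sqr_ge0.
Qed.

Lemma phase_loss_le4 z u : (0 < n)%N -> (forall j, `|z j 0| = 1) ->
  phase_loss (phases u) z <= 4.
Proof.
move=> n0 z1; apply: le_trans (phase_loss_le z u (normr1 _)) _.
rewrite mulrC ler_pdivrMr ?ltr0n//.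
apply: (@le_trans _ _ (\sum_(j < n) 4)); last by rewrite sumr_const card_ord mulr_natr.
apply: ler_sum => j _; apply: sqn_sub_le4; first by rewrite sqn_phases.
by rewrite mulr1 sqn_unit.
Qed.

End TrivialBounds.

(** * The error bounds on a deterministic event *)

Section Deterministic.
Context {R : realType} {n : nat}.
Local Open Scope complex_scope.
Variables (A : 'I_n -> 'I_n -> R) (W : 'M[R[i]]_n) (z u : 'cV[R[i]]_n) (Z : 'M[R[i]]_n).
Variables (sig p eps tau theta epsA : R).
Let N := n%:R * p.
Let om := N / sig ^+ 2.
Let T : 'M[R[i]]_n := \matrix_(j, k) ((A j k)%:C * (conjc (z j 0) * W j k * z k 0)).
Let M0 : 'M[R[i]]_n := \matrix_(j, k) ((A j k)%:C * (z j 0 * conjc (z k 0) + sig%:C * W j k)).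
Let M : 'M[R[i]]_n := \matrix_(j, k) ((A j k)%:C + sig%:C * T j k).
Hypotheses (n0 : (0 < n)%N) (p0 : 0 < p) (sig0 : 0 < sig) (eps1 : 0 < eps <= 1 / 100).
Hypotheses (tau0 : 0 < tau) (theta0 : 0 < theta) (theta1 : theta <= 1) (epsA0 : 0 <= epsA).
Hypotheses (epsA1 : epsA <= eps ^+ 2) (epsA_theta : epsA <= theta * tau / 16).
Hypothesis tau_eps : 292 * 8 ^+ 6 * tau <= eps ^+ 4.
Hypothesis om_large : 128 * 8 ^+ 6 <= (theta * tau / 16) ^+ 2 * om.
Hypothesis A_sym : forall j k, A j k = A k j.
Hypothesis A_diag : forall j, A j j = 0.
Hypothesis W_herm : forall j k, j != k -> W j k = conjc (W k j).
Hypothesis z_unit : forall j, sqn (z j 0) = 1.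
Hypothesis A_close : forall x : 'I_n -> R,
  \sum_j (\sum_k (A j k - p) * x k) ^+ 2 <= (epsA * N) ^+ 2 * \sum_k x k ^+ 2.
Hypothesis A_degree : forall j, `|\sum_k A j k - N| <= eps * N.
Hypothesis T_all : forall y : {ffun 'I_n -> option bool},
  \sum_j sqn (\sum_k T j k * (tval (y k))%:C) <= 64 * (n%:R * N).
Hypothesis T_sparse : forall y : {ffun 'I_n -> option bool}, (supp_size y)%:R <= theta * n%:R ->
  \sum_j sqn (\sum_k T j k * (tval (y k))%:C) <= tau * (n%:R * N).
Hypothesis T_im : \sum_j complex.Im (\sum_k T j k) ^+ 2 <= (1 + 4 * eps) * (n%:R * N / 2).
Hypothesis T_re : \sum_j (~~ (`|sig * complex.Re (\sum_k T j k)| <= eps * N))%:R <= eps * n%:R / om.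
Hypothesis Z_max : sdp_maximizer M0 Z.
Hypothesis u_lead : leading_eigenvector Z u.

Let zz j : conjc (z j 0) * z j 0 = 1.
Proof. by rewrite mulrC mulJ_sqn z_unit. Qed.

Let ME j k : M j k = conjc (z j 0) * M0 j k * z k 0.
Proof.
rewrite !mxE [LHS](_ : _ = (A j k)%:C * (1 * 1) + sig%:C * ((A j k)%:C * (conjc (z j 0) * W j k * z k 0))); last by ring.
by rewrite -{1}(zz j) -{1}(zz k); ring.
Qed.

Let M_herm j k : M j k = conjc (M k j).
Proof.
rewrite !mxE; have [->|jk] := eqVneq j k.
  by rewrite A_diag !mul0r mulr0 addr0; apply: complex_inj; rewrite //= oppr0.
rewrite (A_sym k j) (W_herm jk); case: (W k j) => a b; case: (z j 0) => c d.
by case: (z k 0) => e f; apply: complex_inj => /=; ring.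
Qed.

Let M_diag j : M j j = 0.
Proof. by rewrite !mxE A_diag !mul0r mulr0 addr0. Qed.

Let exists_factor : exists V : 'M[R[i]]_n,
  [/\ forall j, nrm2 (row j V) = 1,
      forall j k, Z j k = z j 0 * hdot (row j V) (row k V) * conjc (z k 0) &
      forall V' : 'M[R[i]]_n, (forall j, nrm2 (row j V') = 1) ->
        sync_energy M V' <= sync_energy M V].
Proof.
have [[Zh Z1 Zp] Zm] := Z_max.
have [V0 ZE] := psd_factor Zh Zp.
have V01 j : nrm2 (row j V0) = 1 by rewrite /nrm2 -Re_hdot -gramE -ZE Z1.
pose zb j := conjc (z j 0).
have zz' j : z j 0 * zb j = 1 by rewrite mulrC zz.
exists (phase_conj zb V0).
have phaseK : phase_conj (fun j => z j 0) (phase_conj zb V0) = V0.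
  by apply/matrixP => j k; rewrite !mxE mulrA zz' mul1r.
split.
- by move=> j; rewrite row_phase_conj nrm2Z V01 sqn_conj z_unit mulr1.
- move=> j k; rewrite {1}ZE gramE !row_phase_conj hdotZl.
  have -> : hdot (row j V0) (zb k *: row k V0) = z k 0 * hdot (row j V0) (row k V0).
    by rewrite mulr_sumr; apply: eq_bigr => i _; rewrite !mxE conjcM conjcKK mulrCA.
  rewrite [RHS](_ : _ = (z j 0 * zb j) * (z k 0 * zb k) * hdot (row j V0) (row k V0)); last by rewrite /zb; ring.
  by rewrite !zz' !mul1r.
- move=> V' V'1; rewrite -!(sync_energy_conj _ ME) phaseK.
  have V''1 j : nrm2 (row j (phase_conj (fun j => z j 0) V')) = 1.
    by rewrite row_phase_conj nrm2Z V'1 z_unit mulr1.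
  rewrite -!Re_trace_gram -ZE.
  by have := Zm _ (gram_feasible V''1); rewrite lecE => /andP[_].
Qed.

Let om_gt0 : 0 < om.
Proof. by rewrite divr_gt0 ?exprn_gt0// mulr_gt0 ?ltr0n. Qed.

Let N_gt0 : 0 < N.
Proof. by rewrite mulr_gt0 ?ltr0n. Qed.

Let C1 : R := 2 * 8 ^+ 6 * 1 * (64 * (n%:R * N)).

Let initial (V : 'M[R[i]]_n) : (forall j, nrm2 (row j V) = 1) ->
  (forall V' : 'M[R[i]]_n, (forall j, nrm2 (row j V') = 1) ->
        sync_energy M V' <= sync_energy M V) ->
  n%:R ^+ 2 - nrm2 (\sum_k row k V) <= theta * tau / 4 * n%:R ^+ 2.
Proof.
move=> V1 Vmax.
have better : \sum_j \sum_k complex.Re (M j k) <= sync_energy M V.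
  (* The truth, written as equal unit rows. *)
  pose e : 'M[R[i]]_n := \matrix_(j, k) (k == Ordinal n0)%:R.
  have re j : row j e = delta_mx 0 (Ordinal n0).
    by apply/rowP => k; rewrite !mxE eqxx.
  have e1 : nrm2 (delta_mx (0 : 'I_1) (Ordinal n0) : 'rV[R[i]]_n) = 1.
    rewrite nrm2E (bigD1 (Ordinal n0))//= big1 => [|k kn]; rewrite !mxE ?eqxx ?sqn1 ?addr0//.
    by rewrite (negPf kn) andbF sqn0.
  apply: le_trans (Vmax e _) => [|j]; last by rewrite re.
  apply: eq_le_imp; apply: eq_bigr => j _; rewrite row_mulE dot_sumr.
  by apply: eq_bigr => k _; rewrite !re dot_self_Z e1 mulr1.
have T1 : \sum_j sqn (\sum_k T j k) <= C1.
  apply: (@le_trans _ _ (64 * (n%:R * N))).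
    apply: le_trans (T_all [ffun=> Some true]); apply: eq_le_imp.
    by apply: eq_bigr => j _; congr sqn; apply: eq_bigr => k _; rewrite ffunE /= mulr1.
  have nN0 : 0 <= 64 * (n%:R * N) by rewrite mulr_ge0// mulr_ge0// ltW.
  rewrite /C1 mulr1 ler_peMl//.
  have : (1 : R) <= 8 ^+ 6 by rewrite exprn_ege1// ler1n.
  lra.
have TV : \sum_j nrm2 (\sum_k T j k *: row k V) <= C1.
  apply: (@grothendieck_complex R n n T predT) => // [a|k]; last by rewrite V1.
  apply: le_trans (T_all [ffun k => Some (a k)]); apply: eq_le_imp.
  by apply: eq_bigr => j _; congr sqn; apply: eq_bigr => k _; rewrite ffunE.
pose xi := theta * tau / 16.
have xi0 : 0 <= xi by rewrite divr_ge0// mulr_ge0// ltW.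
have := @initial_bound R n n A T V sig p epsA xi C1 n0 p0 epsA0 xi0 V1 better A_close TV T1.
move=> H; apply: (le_trans (H _)).
  rewrite exprMn; have -> : (n%:R * (n%:R * p)) ^+ 2 = (n%:R * N) * (n%:R * N) by rewrite -expr2.
  have -> : xi ^+ 2 * (n%:R * N * (n%:R * N)) = sig ^+ 2 * (n%:R * (n%:R * N)) * (xi ^+ 2 * om).
    by rewrite /om; field; rewrite gt_eqF.
  rewrite /C1 mulr1 [leLHS](_ : _ = sig ^+ 2 * (n%:R * (n%:R * N)) * (128 * 8 ^+ 6)); last by ring.
  by rewrite ler_wpM2l// !mulr_ge0 ?sqr_ge0// ltW.
rewrite ler_wpM2r ?sqr_ge0// /xi; move: epsA_theta; lra.
Qed.

Let theta_tau_le : theta * tau <= eps.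
Proof.
have /andP[e0 e1] := eps1.
have t1 : tau <= eps ^+ 4.
  apply: le_trans tau_eps; rewrite ler_peMl ?(ltW tau0)//.
  have : (1 : R) <= 8 ^+ 6 by rewrite exprn_ege1// ler1n.
  lra.
have t2 : eps ^+ 4 <= eps.
  by rewrite exprS ler_piMr ?(ltW e0)// exprn_ile1 ?(ltW e0)//; lra.
by apply: (le_trans _ (le_trans t1 t2)); rewrite ler_piMl ?(ltW tau0).
Qed.

Let solve_fixed_point : exists (V : 'M[R[i]]_n) (m : R) (lam : 'I_n -> R),
  [/\ forall j, nrm2 (row j V) = 1,
      forall j k, Z j k = z j 0 * hdot (row j V) (row k V) * conjc (z k 0),
      [/\ nrm2 (\sum_k row k V) = n%:R ^+ 2 * m ^+ 2, 0 < m <= 1,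
          4 * (1 - m ^+ 2) <= theta * tau & 2 - 2 * m <= (1 + 40 * eps) / (2 * om)],
      forall j, 0 <= lam j &
      forall j, row j (M *m V) = (lam j)%:C *: row j V].
Proof.
have /andP[e0 e1] := eps1.
have n0R : 0 < n%:R :> R by rewrite ltr0n.
have [V [V1 ZV Vmax]] := exists_factor.
have statV := stationarity M_herm M_diag V1 Vmax.
have /choice[lam lamP] : forall j, exists l : R, 0 <= l /\ row j (M *m V) = l%:C *: row j V.
  by move=> j; have [l l0 lE] := statV j; exists l.
set S := \sum_k row k V.
pose m := Num.sqrt (nrm2 S) / n%:R.
have m2 : nrm2 S = n%:R ^+ 2 * m ^+ 2.
  by rewrite /m expr_div_n sqr_sqrtr ?nrm2_ge0// mulrC divfK// gt_eqF// exprn_gt0.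
have m0 : 0 <= m by rewrite divr_ge0 ?sqrtr_ge0.
have Sn : nrm2 S <= n%:R ^+ 2.
  have : 0 <= \sum_j \sum_k nrm2 (row j V - row k V).
    by apply: sumr_ge0 => j _; apply: sumr_ge0 => k _; exact: nrm2_ge0.
  under eq_bigr do under eq_bigr do rewrite nrm2B !V1.
  under eq_bigr do rewrite big_split sumrB /= sumr_const card_ord -mulr_sumr -dot_sumr.
  rewrite big_split sumrB /= -mulr_sumr -dot_suml sumr_const card_ord -/(nrm2 _) -/S.
  by rewrite -[n%:R *+ n]mulr_natl -expr2; lra.
have m1 : m <= 1.
  by move: Sn; rewrite m2 ger_pMr ?exprn_gt0// expr_le1.
have init := initial V1 Vmax; rewrite -/S m2 in init.
have m2_ge : 1 - m ^+ 2 <= theta * tau / 4.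
  rewrite -(ler_pM2r (exprn_gt0 2 n0R)); lra.
have Lt : 2 - 2 * m <= theta * tau by nra.
have m_gt0 : 0 < m by move: theta_tau_le; lra.
exists V, m, lam; split => //; last 2 first.
- by move=> j; case: (lamP j).
- by move=> j; case: (lamP j).
split => //; [by rewrite m_gt0|by move: m2_ge; lra|].
have nm : n%:R * m != 0 by rewrite mulf_neq0 ?gt_eqF.
pose a := ((n%:R * m)^-1)%:C *: S.
have a1 : nrm2 a = 1 by rewrite nrm2Z sqn_real m2 exprVn exprMn mulVf// -exprMn expf_neq0.
have Sa : S = (n%:R * (1 - (2 - 2 * m) / 2))%:C *: a.
  rewrite /a scalerA -rmorphM /= (_ : n%:R * _ = n%:R * m); last by field.
  by rewrite mulfV// scale1r.
have L0 : 0 <= 2 - 2 * m by lra.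
have Le : 2 - 2 * m <= 2 * eps by move: theta_tau_le; lra.
have sumV : \sum_k nrm2 (row k V) = n%:R.
  by under eq_bigr do rewrite V1; rewrite sumr_const card_ord.
have V4 k : nrm2 (row k V) <= 4 by rewrite V1 ler1n.
have := @fixed_point_bound R n A T sig p eps tau theta epsA n0 p0 sig0 eps1 tau0
  epsA0 epsA1 tau_eps A_close A_degree T_all T_sparse T_im T_re n V a (fun j => row j V) lam
  (2 - 2 * m) L0 Lt Le a1 Sa sumV V4 V1.
move=> /(_ (fun j => proj1 (lamP j)) (fun j => esym (proj2 (lamP j)))).
have -> : \sum_j nrm2 (row j V - a) = n%:R * (2 - 2 * m).
  under eq_bigr do rewrite nrm2B V1 a1.
  rewrite big_split sumrB /= -mulr_sumr -dot_suml -/S Sa dotZl -/(nrm2 a) a1.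
  by rewrite !sumr_const card_ord; field.
set L := 2 - 2 * m in L0 Lt Le *; rewrite -/N -/om.
set o := (2 * om)^-1; have o0 : 0 < o by rewrite invr_gt0 mulr_gt0.
rewrite mulrCA [eps * _]mulrCA -mulrDr ler_pM2l// => H.
(* The term eps L of the bound is absorbed by the left side. *)
have H2 : (1 - eps) * L <= (1 + 30 * eps) * o by lra.
have : (1 + 30 * eps) * o <= (1 - eps) * ((1 + 40 * eps) * o) by rewrite mulrA ler_wpM2r ?(ltW o0)//; nra.
move=> H3; have := le_trans H2 H3; rewrite ler_pM2l//; lra.
Qed.

Let frobenius_bound : (n%:R ^+ 2)^-1 * frobenius_norm (Z - z *m z ^t*) ^+ 2 <=
  (1 + 40 * eps) * (sig ^+ 2 / (n%:R * p)).
Proof.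
have n0R : 0 < n%:R :> R by rewrite ltr0n.
have [V [m [lam [V1 ZV [Sm /andP[m0 m1] _ Lo] _ _]]]] := solve_fixed_point.
rewrite /frobenius_norm sqr_sqrtr; last first.
  by apply: sumr_ge0 => j _; apply: sumr_ge0 => k _; exact: sqr_ge0.
have entry j k : Normc.normc ((Z - z *m z ^t*) j k) ^+ 2 <= 2 - 2 * dot (row j V) (row k V).
  rewrite sqr_normc; have -> : (Z - z *m z ^t*) j k = z j 0 * (hdot (row j V) (row k V) - 1) * conjc (z k 0).
    by rewrite !mxE big_ord1 !mxE ZV -/(conjc _); ring.
  rewrite !sqnM sqn_conj !z_unit mul1r mulr1.
  have := sqn_hdot_le (row j V) (row k V); rewrite !V1 mul1r -Re_hdot.
  by case: (hdot _ _) => x y; rewrite /sqn /= oppr0 addr0; lra.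
have -> : sig ^+ 2 / (n%:R * p) = om^-1 by rewrite /om invf_div.
apply: (@le_trans _ _ (2 * (2 - 2 * m))); last first.
  have -> : (1 + 40 * eps) / om = 2 * ((1 + 40 * eps) / (2 * om)).
    by field; rewrite gt_eqF.
  by rewrite ler_wpM2l.
rewrite mulrC ler_pdivrMr ?exprn_gt0//.
apply: (@le_trans _ _ (\sum_j \sum_k (2 - 2 * dot (row j V) (row k V)))).
  by apply: ler_sum => j _; apply: ler_sum => k _; exact: entry.
under eq_bigr do rewrite sumrB sumr_const card_ord -mulr_sumr -dot_sumr.
rewrite sumrB -mulr_sumr -dot_suml -/(nrm2 _) Sm sumr_const card_ord -!mulrnA -mulr_natr natrM.
set q := n%:R ^+ 2; rewrite [leLHS](_ : _ = q * (2 - 2 * m ^+ 2)); last by rewrite /q; ring.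
by rewrite mulrC ler_wpM2r ?sqr_ge0//; nra.
Qed.

Let phase_bound :
  phase_loss (phases u) z <= (1 + 40 * eps) * (sig ^+ 2 / (2 * n%:R * p)).
Proof.
have /andP[e0 e1] := eps1.
have n0R : 0 < n%:R :> R by rewrite ltr0n.
have [V [m [lam [V1 ZV [Sm /andP[m0 m1] Lt Lo] lam0 MV]]]] := solve_fixed_point.
have [[Zh _ _] _] := Z_max.
have [u0 [lam1 [Zu lam1_max]]] := u_lead.
have [l lam1E Rl] := rayleigh_le z n0 Zh lam1_max.
have tt := theta_tau_le.
have m2 : n%:R * m ^+ 2 <= l.
  rewrite -(ler_pM2r n0R); move: Rl; rewrite (eq_bigr (fun=> 1)) => [|j _]; last exact: z_unit.
  rewrite sumr_const card_ord; apply: le_trans; rewrite mulrAC -expr2 -Sm.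
  rewrite /nrm2 dot_suml -mulmxA mxE Re_sum; apply: ler_sum => j _.
  rewrite dot_sumr !mxE mulr_sumr Re_sum; apply: ler_sum => k _.
  rewrite ZV -/(conjc _) -Re_hdot; apply: eq_le_imp; congr complex.Re.
  rewrite [RHS](_ : _ = (conjc (z j 0) * z j 0) * (conjc (z k 0) * z k 0) * hdot (row j V) (row k V)); last by ring.
  by rewrite !zz !mul1r.
pose su := \sum_j sqn (u j 0).
have su0 : 0 < su.
  rewrite lt_neqAle eq_sym sumr_ge0 ?andbT => [|j _]; last exact: sqn_ge0.
  apply: contra u0; rewrite psumr_eq0 => [/allP H|j _]; last exact: sqn_ge0.
  apply/eqP/colP => j; rewrite mxE; have := H j (mem_index_enum j).
  by rewrite /sqn paddr_eq0 ?sqr_ge0// !sqrf_eq0 => /andP[/eqP ? /eqP ?]; apply: complex_inj.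
(* Rotate u and scale it to squared norm n. *)
pose r := Num.sqrt (n%:R / su).
have r2 : r ^+ 2 = n%:R / su by rewrite sqr_sqrtr// divr_ge0// ltW.
have r0 : 0 < r by rewrite sqrtr_gt0 divr_gt0.
pose ut j := r%:C * (conjc (z j 0) * u j 0).
have sqn_ut j : sqn (ut j) = r ^+ 2 * sqn (u j 0).
  by rewrite /ut !sqnM sqn_real sqn_conj z_unit mul1r.
have ut_norm : \sum_j sqn (ut j) = n%:R.
  by under eq_bigr do rewrite sqn_ut; rewrite -mulr_sumr -/su r2 divfK// gt_eqF.
have ut_eigen j : l%:C * ut j = \sum_k hdot (row j V) (row k V) * ut k.
  have : (Z *m u) j 0 = l%:C * u j 0 by rewrite Zu mxE lam1E.
  rewrite mxE => H.
  rewrite [LHS](_ : _ = r%:C * conjc (z j 0) * (l%:C * u j 0)); last by rewrite /ut; ring.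
  rewrite -H mulr_sumr; apply: eq_bigr => k _; rewrite ZV /ut.
  rewrite [LHS](_ : _ = (conjc (z j 0) * z j 0) * (hdot (row j V) (row k V) * (r%:C * (conjc (z k 0) * u k 0)))); last by ring.
  by rewrite zz mul1r.
have m2_half : 1 / 2 <= m ^+ 2 by lra.
have m2_le1 : m ^+ 2 <= 1 by rewrite expr_le1// ltW.
have Sm' : n%:R ^+ 2 * m ^+ 2 <= nrm2 (\sum_k row k V) by rewrite Sm.
have mean_ge := eigenvector_mean_ge n0 V1 Sm' m2_half ut_norm m2 ut_eigen m2_le1.
have entry_le := eigenvector_entry_le n0 V1 m2_half ut_norm m2 ut_eigen.
have stat := eigenvector_stationary n0 m2_half m2 ut_eigen MV.
set s0 := \sum_k ut k in mean_ge.
pose s := Num.sqrt (sqn s0) / n%:R.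
have s2 : sqn s0 = n%:R ^+ 2 * s ^+ 2.
  by rewrite /s expr_div_n sqr_sqrtr ?sqn_ge0// mulrC divfK// gt_eqF// exprn_gt0.
have s_ge0 : 0 <= s by rewrite divr_ge0 ?sqrtr_ge0.
have s2_ge : 1 - 2 * (1 - m ^+ 2) <= s ^+ 2.
  by move: mean_ge; rewrite s2 ler_pM2l// exprn_gt0.
have s1 : s <= 1.
  have : sqn s0 <= n%:R ^+ 2.
    have CS := CauchySchwarz_sum predT (fun _ : 'I_n => 1 : R).
    have := CS (fun k => complex.Re (ut k)); have := CS (fun k => complex.Im (ut k)).
    rewrite (eq_bigr (fun k => complex.Im (ut k))) => [|k _]; last by rewrite mul1r.
    rewrite [X in X * _](eq_bigr (fun=> 1)) => [HI|k _]; last by rewrite expr1n.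
    rewrite (eq_bigr (fun k => complex.Re (ut k))) => [|k _]; last by rewrite mul1r.
    rewrite [X in X * _](eq_bigr (fun=> 1)) => [HR|k _]; last by rewrite expr1n.
    move: HR HI; rewrite sumr_const card_ord => HR HI.
    rewrite /sqn /s0 Re_sum Im_sum [leRHS]expr2 -[X in _ <= _ * X]ut_norm.
    by rewrite [X in _ <= _ * X]big_split mulrDr lerD.
  by rewrite s2 ger_pMr ?exprn_gt0// expr_le1.
have s_gt0 : 0 < s.
  by rewrite lt_neqAle s_ge0 andbT; apply/eqP => s_0; move: s2_ge; rewrite -s_0 expr0n /=; lra.
have ns : n%:R * s != 0 by rewrite mulf_neq0 ?gt_eqF.
pose al := ((n%:R * s)^-1)%:C * s0.
have al1 : sqn al = 1 by rewrite sqnM sqn_real s2 exprVn exprMn mulVf// -exprMn expf_neq0.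
pose U : 'M[R[i]]_(n, 1) := \matrix_(j, k) ut j.
pose phi j := conjc (z j 0) * phases u j 0.
have rowU j : row j U = const_mx (ut j) by apply/rowP => k; rewrite !mxE.
have nrm2_const (x : R[i]) : nrm2 (const_mx x : 'rV[R[i]]_1) = sqn x.
  by rewrite nrm2E big_ord1 mxE.
have phase1 := sqn_phases u.
have utE j : ut j = (Num.sqrt (sqn (ut j)))%:C * phi j.
  rewrite sqn_ut sqrtrM ?sqr_ge0// sqrtr_sqr gtr0_norm// /ut /phi mxE.
  have [->|uj0] := eqVneq (u j 0) 0; first by rewrite sqn0 sqrtr0 !mulr0 mul0r.
  rewrite normE rmorphM /= [RHS](_ : _ = r%:C * (conjc (z j 0) * ((Num.sqrt (sqn (u j 0)))%:C * (u j 0 / (Num.sqrt (sqn (u j 0)))%:C)))); last by ring.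
  by congr (_ * (_ * _)); rewrite mulrCA divff ?mulr1// -normE normr_eq0.
have Lu0 : 0 <= 2 - 2 * s by lra.
have Lu_m : 2 - 2 * s <= 4 * (1 - m ^+ 2) by nra.
have Lu1 : 2 - 2 * s <= theta * tau by apply: le_trans Lt.
have Lu2 : 2 - 2 * s <= 2 * eps by lra.
have Ua : \sum_k row k U = (n%:R * (1 - (2 - 2 * s) / 2))%:C *: (const_mx al : 'rV[R[i]]_1).
  rewrite (_ : n%:R * _ = n%:R * s); last by field.
  apply/rowP => k; rewrite !mxE summxE /al mulrA -rmorphM /= mulfV// mul1r.
  by apply: eq_bigr => j _; rewrite !mxE.
have Unorm : \sum_k nrm2 (row k U) = n%:R.
  by rewrite -ut_norm; apply: eq_bigr => k _; rewrite rowU nrm2_const.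
have U4 k : nrm2 (row k U) <= 4 by rewrite rowU nrm2_const.
have f1 j : nrm2 (const_mx (phi j) : 'rV[R[i]]_1) = 1.
  by rewrite nrm2_const sqnM sqn_conj z_unit phase1 mulr1.
have lam'0 j : 0 <= lam j * Num.sqrt (sqn (ut j)) by rewrite mulr_ge0 ?sqrtr_ge0.
have fixf j : (lam j * Num.sqrt (sqn (ut j)))%:C *: (const_mx (phi j) : 'rV[R[i]]_1) = row j (M *m U).
  apply/rowP => k; rewrite !mxE rmorphM /= -mulrA -utE -stat.
  by apply: eq_bigr => i _; rewrite !mxE.
have a1 : nrm2 (const_mx al : 'rV[R[i]]_1) = 1 by rewrite nrm2_const.
have := @fixed_point_bound R n A T sig p eps tau theta epsA n0 p0 sig0 eps1 tau0
  epsA0 epsA1 tau_eps A_close A_degree T_all T_sparse T_im T_re 1 U (const_mx al)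
  (fun j => const_mx (phi j)) _ (2 - 2 * s) Lu0 Lu1 Lu2 a1 Ua Unorm U4 f1 lam'0 fixf.
have -> : \sum_j nrm2 ((const_mx (phi j) : 'rV[R[i]]_1) - const_mx al) =
    \sum_j sqn (phases u j 0 - z j 0 * al).
  apply: eq_bigr => j _; rewrite nrm2E big_ord1 /phi; set ph := phases u j 0.
  rewrite !mxE -[RHS]mul1r -(z_unit j) -(sqn_conj (z j 0)) -sqnM.
  by congr sqn; rewrite mulrBr mulrA zz mul1r.
rewrite -/N -/om => H.
apply: le_trans (phase_loss_le z u (unit_sqn al1)) _.
rewrite mulrC ler_pdivrMr//; apply: (le_trans H).
have -> : sig ^+ 2 / (2 * n%:R * p) = (2 * om)^-1.
  by rewrite /om /N; field; rewrite !gt_eqF.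
set o := (2 * om)^-1 in Lo *; have o0 : 0 < o by rewrite invr_gt0 mulr_gt0.
rewrite [leLHS](_ : _ = ((1 + 30 * eps) * o + eps * (2 - 2 * s)) * n%:R); last by rewrite /o; ring.
rewrite ler_pM2r//.
have Lu6 : 2 - 2 * s <= 6 * o.
  have : 4 * (1 - m ^+ 2) <= 4 * (2 - 2 * m) by nra.
  have : (1 + 40 * eps) * o <= (3 / 2) * o by rewrite ler_pM2r//; lra.
  lra.
have := ler_wpM2l (ltW e0) Lu6; have : 0 <= eps * o by rewrite mulr_ge0 ?ltW.
lra.
Qed.

(** Both bounds come from [fixed_point_bound]. For Z, the sum of |V_j - a|^2 is n L
    itself, where L = 2 - 2 m and m is the length of the mean of the V_j; this gives
    an inequality for L, and the Frobenius error is at most 2 L. For u, the deviation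
    L_u of its mean is at most a constant times L, so that the term eps L_u is
    absorbed. *)
Lemma deterministic_bounds :
  (n%:R ^+ 2)^-1 * frobenius_norm (Z - z *m z ^t*) ^+ 2 <=
    (1 + 40 * eps) * (sig ^+ 2 / (n%:R * p)) /\
  phase_loss (phases u) z <= (1 + 40 * eps) * (sig ^+ 2 / (2 * n%:R * p)).
Proof. by split. Qed.

End Deterministic.

(** * Powers of symmetric matrices and walks *)

Section SymmetricPowers.
Context {R : realType} {n : nat}.
Implicit Types (X Y : 'M[R]_n) (v : 'cV[R]_n).

Definition sqnorm v : R := \sum_i v i 0 ^+ 2.

Lemma sqnorm_ge0 v : 0 <= sqnorm v.
Proof. by apply: sumr_ge0 => i _; exact: sqr_ge0. Qed.

Lemma sqr_sqnorm_symm Y v : Y^T = Y ->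
  sqnorm (Y *m v) ^+ 2 <= sqnorm v * sqnorm (Y *m (Y *m v)).
Proof.
move=> YT; have -> : sqnorm (Y *m v) = \sum_i v i 0 * (Y *m (Y *m v)) i 0.
  transitivity (((Y *m v)^T *m (Y *m v)) 0 0).
    by rewrite !mxE; apply: eq_bigr => i _; rewrite [in RHS]mxE expr2.
  by rewrite trmx_mul YT -mulmxA mxE; apply: eq_bigr => i _; rewrite mxE.
exact: (CauchySchwarz_sum predT).
Qed.

Lemma sqnorm_mulmx_le Y v : sqnorm (Y *m v) <= (\sum_i \sum_j Y i j ^+ 2) * sqnorm v.
Proof.
rewrite /sqnorm mulr_suml; apply: ler_sum => i _; rewrite mxE.
exact: (CauchySchwarz_sum predT).
Qed.

End SymmetricPowers.

Section TracePower.
Context {R : realType} {n : nat}.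
Implicit Types (X : 'M[R]_n.+1) (v : 'cV[R]_n.+1).

Lemma trmx_exp X k : X^T = X -> (X ^+ k)^T = X ^+ k.
Proof.
move=> XT; elim: k => [|k IH]; first by rewrite expr0 trmx1.
by rewrite [in LHS]exprSr [in RHS]exprS trmx_mul IH XT.
Qed.

(** Repeated squaring of |Y v|^2 <= |v| |Y^2 v|; this is why only powers of two
    occur as exponents. *)
Lemma sqnorm_pow2_le X v m : X^T = X ->
  sqnorm (X *m v) ^+ (2 ^ m) <=
  sqnorm (X ^+ (2 ^ m) *m v) * sqnorm v ^+ (2 ^ m).-1.
Proof.
move=> XT; elim: m => [|m IH]; first by rewrite expn0 !expr1 mulr1.
set K := (2 ^ m)%N in IH *.
have K0 : (0 < K)%N by rewrite expn_gt0.
rewrite expnS -/K mulnC exprM.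
have IH2 : (sqnorm (X *m v) ^+ K) ^+ 2 <=
    (sqnorm (X ^+ K *m v) * sqnorm v ^+ K.-1) ^+ 2.
  by rewrite lerXn2r ?nnegrE ?mulr_ge0 ?exprn_ge0 ?sqnorm_ge0.
apply: (le_trans IH2); rewrite exprMn.
have := sqr_sqnorm_symm v (trmx_exp K XT).
rewrite mulmxA -[X ^+ K *m X ^+ K]/(X ^+ K * X ^+ K) -exprD addnn -muln2.
move=> H; apply: (le_trans (ler_wpM2r _ H)); first by rewrite exprn_ge0 ?exprn_ge0 ?sqnorm_ge0.
have -> : (K * 2).-1 = (K.-1 * 2).+1 by case: (K) K0.
by rewrite [sqnorm v ^+ _.+1]exprS [sqnorm v ^+ (_ * _)]exprM; apply: eq_le_imp; ring.
Qed.

Lemma sqnorm_trace_le X v m : X^T = X ->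
  sqnorm (X *m v) ^+ (2 ^ m) <= \tr (X ^+ (2 * 2 ^ m)) * sqnorm v ^+ (2 ^ m).
Proof.
move=> XT; apply: (le_trans (sqnorm_pow2_le v m XT)).
set K := (2 ^ m)%N; have K0 : (0 < K)%N by rewrite expn_gt0.
apply: (le_trans (ler_wpM2r _ (sqnorm_mulmx_le _ _))).
  by rewrite exprn_ge0 ?sqnorm_ge0.
rewrite -mulrA -exprS prednK// ler_wpM2r ?exprn_ge0 ?sqnorm_ge0//.
rewrite mul2n -addnn exprD; apply: eq_le_imp; apply: eq_bigr => i _.
rewrite -[X ^+ K * X ^+ K]/(X ^+ K *m X ^+ K) mxE; apply: eq_bigr => j _.
by rewrite expr2 -{2}(trmx_exp K XT) mxE.
Qed.

End TracePower.

Section Walks.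
Context {n : nat}.
Implicit Types (i j : 'I_n) (s : seq 'I_n).

Fixpoint walks (L : nat) : seq (seq 'I_n) :=
  if L is L'.+1 then [seq j :: s | j <- enum 'I_n, s <- walks L'] else [:: [::]].

Lemma big_walks (V : nmodType) L (F : seq 'I_n -> V) :
  \sum_(s <- walks L.+1) F s = \sum_j \sum_(s <- walks L) F (j :: s).
Proof. by rewrite /= big_allpairs_dep /= big_enum. Qed.

Lemma size_walks L s : s \in walks L -> size s = L.
Proof.
by elim: L s => [|L IH] s; [rewrite inE => /eqP ->|case/allpairsP => -[j t] [_ /IH <- ->]].
Qed.

Fixpoint walk_weight (R : comNzRingType) (X : 'I_n -> 'I_n -> R) i s : R :=
  if s is j :: s' then X i j * walk_weight X j s' else 1.

Definition edge i j : 'I_n * 'I_n := if (i < j)%N then (i, j) else (j, i).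

Lemma edgeC i j : edge i j = edge j i.
Proof.
by rewrite /edge; case: ltngtP => // /val_inj ->.
Qed.

Fixpoint walk_edges i s : seq ('I_n * 'I_n) :=
  if s is j :: s' then edge i j :: walk_edges j s' else [::].

(** The number of independent factors in the weight of the walk. *)
Definition distinct_edges i s := size (undup (walk_edges i s)).

Lemma distinct_edges_cons i j s :
  distinct_edges i (j :: s) = (distinct_edges j s + (edge i j \notin walk_edges j s))%N.
Proof.
by rewrite /distinct_edges /=; case: ifP => _ /=; rewrite ?addn0 ?addn1.
Qed.

(** A step that uses an old edge must go to an old vertex. This bounds the number of
    ways to extend a walk without a new edge by its length. *)
Lemma edge_endpoint i j s : edge i j \in walk_edges j s -> i \in j :: s.
Proof.
have mem x y t : (x, y) \in walk_edges j t -> (x \in j :: t) && (y \in j :: t).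
  elim: t j => [//|k t IH] j' /=; rewrite inE => /orP[/eqP|/IH].
    by rewrite /edge; case: ifP => _ [-> ->]; rewrite !inE !eqxx ?orbT.
  by rewrite !(in_cons j') => /andP[-> ->]; rewrite !orbT.
by rewrite {1}/edge; case: ifP => _ /mem /andP[].
Qed.

End Walks.

Section WalkSums.
Context {R : realType} {n : nat}.

(** Extend the walks at their beginning. A new first vertex either creates a new
    edge, at most n choices of weight c, or lies on the walk, at most L choices. *)
Lemma sum_walks_distinct_le (c : R) L : 0 <= c ->
  \sum_(i < n) \sum_(s <- walks L) c ^+ distinct_edges i s <=
  n%:R * (n%:R * c + L%:R) ^+ L.
Proof.
move=> c0; suff H l : (l <= L)%N ->
    \sum_(i < n) \sum_(s <- walks l) c ^+ distinct_edges i s <=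
    n%:R * (n%:R * c + L%:R) ^+ l by exact: H.
elim: l => [_|l IH lL].
  under eq_bigr do rewrite big_seq1 expr0.
  by rewrite sumr_const card_ord expr0 mulr1.
rewrite exprSr mulrA; apply: le_trans (ler_wpM2r _ (IH (ltnW lL))); last first.
  by rewrite addr_ge0 ?mulr_ge0.
under eq_bigr do rewrite big_walks.
rewrite exchange_big /= mulr_suml; apply: ler_sum => j _.
rewrite exchange_big /= mulr_suml !big_seq; apply: ler_sum => s /size_walks sl.
under eq_bigr do rewrite distinct_edges_cons exprD.
rewrite -mulr_sumr ler_wpM2l ?exprn_ge0//.
apply: (@le_trans _ _ (\sum_(i < n) (c + (i \in j :: s)%:R))).
  apply: ler_sum => i _; case: (boolP (edge i j \in _)) => [/edge_endpoint ->|_] /=.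
    by rewrite expr0 lerDr.
  by rewrite expr1 lerDl.
rewrite big_split /= sumr_const card_ord -[c *+ n]mulr_natl lerD2l -natr_sum ler_nat.
rewrite [X in (X <= _)%N](_ : _ = #|[pred i | i \in j :: s]|); last first.
  by rewrite -sum1_card [RHS]big_mkcond; apply: eq_bigr => i _ /=; case: (i \in j :: s).
apply: leq_trans (card_size (j :: s)) _ => //=.
by rewrite sl.
Qed.

Lemma trace_exp_walks (X : 'M[R]_n.+1) L :
  \tr (X ^+ L) = \sum_i \sum_(s <- walks L) (last i s == i)%:R * walk_weight X i s.
Proof.
have E i j : (X ^+ L) i j = \sum_(s <- walks L) (last i s == j)%:R * walk_weight X i s.
  elim: L i => [|L IH] i; first by rewrite big_seq1 expr0 mxE mulr1.
  rewrite big_walks exprS mxE; apply: eq_bigr => k _; rewrite IH mulr_sumr.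
  by apply: eq_bigr => s _ /=; rewrite mulrCA.
by apply: eq_bigr => i _; exact: E.
Qed.

End WalkSums.

(** * The operator norm of the centered graph *)

Section RandomGraph.
Context {R : realType} {n : nat}.
Implicit Types (a : {ffun 'I_n * 'I_n -> bool}) (p : R).

(** Only the pairs with j < k carry an edge; the other coordinates are almost surely
    false, so that they do not have to be excluded from the index type. *)
Definition pair_prob p (e : 'I_n * 'I_n) : R := if (e.1 < e.2)%N then p else 0.

Definition adj a (j k : 'I_n) : R := if j == k then 0 else (a (edge j k))%:R.

Definition centered_adj p a (j k : 'I_n) : R :=
  if j == k then 0 else (a (edge j k))%:R - p.

Lemma pair_prob01 p : 0 <= p <= 1 -> forall e, 0 <= pair_prob p e <= 1.
Proof. by move=> p01 e; rewrite /pair_prob; case: ifP => // _; rewrite lexx ler01. Qed.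

Lemma edge_lt (j k : 'I_n) : j != k -> ((edge j k).1 < (edge j k).2)%N.
Proof. by rewrite /edge; case: (ltngtP j k) => [jk|kj|/val_inj ->] //=; rewrite eqxx. Qed.

Fixpoint loopless (i : 'I_n) s := if s is j :: s' then (i != j) && loopless j s' else true.

Lemma big_count (I : finType) (f : I -> R) (l : seq I) :
  \prod_(e <- l) f e = \prod_e f e ^+ count_mem e l.
Proof.
elim: l => [|x l IH]; first by rewrite big_nil big1.
rewrite big_cons IH [RHS](bigD1 x)//= eqxx [in LHS](bigD1 x)//= exprD expr1 mulrA.
by congr (_ * _); apply: eq_bigr => e /negPf; rewrite eq_sym => ->.
Qed.

Lemma walk_weight_centered p a i s : walk_weight (centered_adj p a) i s =
  if loopless i s then \prod_e ((a e)%:R - p) ^+ count_mem e (walk_edges i s) else 0.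
Proof.
rewrite -(big_count (fun e => (a e)%:R - p)).
elim: s i => [|j s IH] i /=; first by rewrite big_nil.
rewrite IH {1}/centered_adj; case: eqVneq => [_|_] /=; first by rewrite mul0r.
by rewrite big_cons; case: ifP; rewrite ?mulr0.
Qed.

Lemma loopless_edges_lt i s e : loopless i s -> e \in walk_edges i s -> (e.1 < e.2)%N.
Proof.
elim: s i => [//|j s IH] i /= /andP[ij /IH {}IH]; rewrite inE => /orP[/eqP ->|//].
exact: edge_lt.
Qed.

(** A centered Bernoulli variable has mean 0 and, for m >= 2, m-th moment at most p.
    The parameter b distributes the weight: b^2 p for the edge, and 1 / b for each of
    its m occurrences. *)
Lemma centered_moment_le p b m : 0 <= p <= 1 -> 0 < b <= 1 ->
  `|p * (1 - p) ^+ m + (1 - p) * (- p) ^+ m| <= (b ^+ m)^-1 * (b ^+ 2 * p) ^+ (0 < m).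
Proof.
move=> /andP[p0 p1] /andP[b0 b1].
case: m => [|[|m]].
- by rewrite ltnn !expr0 invr1 !mulr1 addrC subrK normr1.
- have -> : p * (1 - p) ^+ 1 + (1 - p) * (- p) ^+ 1 = 0 by ring.
  by rewrite normr0 mulr_ge0 ?invr_ge0 ?exprn_ge0 ?mulr_ge0 ?exprn_ge0// ltW.
have q0 : 0 <= 1 - p by lra.
have pow_le (x : R) k : 0 <= x <= 1 -> x ^+ k.+1 <= x.
  by move=> /andP[x0 x1]; rewrite exprS ler_piMr// exprn_ile1.
have M : `|p * (1 - p) ^+ m.+2 + (1 - p) * (- p) ^+ m.+2| <= p.
  apply: (@le_trans _ _ (p * (1 - p) ^+ m.+2 + (1 - p) * p ^+ m.+2)).
    apply: (le_trans (ler_normD _ _)); rewrite (normrM p (_ ^+ m.+2)) (normrM (1 - p) ((- p) ^+ m.+2)) !normrX normrN.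
    by rewrite (ger0_norm p0) (ger0_norm q0).
  have h1 := @pow_le (1 - p) m; have h2 := @pow_le p m.
  have {}h1 : (1 - p) ^+ m.+2 <= (1 - p) * (1 - p) by rewrite exprS ler_wpM2l// h1; lra.
  have {}h2 : p ^+ m.+2 <= p * p by rewrite exprS ler_wpM2l// h2; lra.
  have := ler_wpM2l p0 h1; have := ler_wpM2l q0 h2; nra.
apply: (le_trans M); rewrite expr1 mulrA ler_peMl// mulrC -ler_pdivrMr ?invr_gt0 ?exprn_gt0//.
by rewrite mul1r invrK -[m.+2]addn2 exprD ler_piMl ?exprn_ge0 ?exprn_ile1// ltW.
Qed.

Lemma walk_mean_le p b i s : 0 <= p <= 1 -> 0 < b <= 1 ->
  `|bern_mean (pair_prob p) (fun a => walk_weight (centered_adj p a) i s)| <=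
  (b ^+ size s)^-1 * (b ^+ 2 * p) ^+ distinct_edges i s.
Proof.
move=> p01 b01; have /andP[p0 p1] := p01; have /andP[b0 b1] := b01.
have [ll|ll] := boolP (loopless i s); last first.
  rewrite (@eq_bern_mean _ _ _ _ (fun=> 0 * 1)) => [|a]; last first.
    by rewrite walk_weight_centered (negPf ll) mul0r.
  rewrite (bern_meanZ _ _ (fun=> 1)) mul0r normr0; apply: mulr_ge0.
    by rewrite invr_ge0 exprn_ge0// ltW.
  by rewrite exprn_ge0// mulr_ge0// exprn_ge0// ltW.
pose l := walk_edges i s.
rewrite (@eq_bern_mean _ _ _ _ (fun a => \prod_e ((a e)%:R - p) ^+ count_mem e l)) => [|a]; last first.
  by rewrite walk_weight_centered ll.
rewrite (bern_mean_prod _ (fun e (c : bool) => (c%:R - p) ^+ count_mem e l)) normr_prod.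
have -> : (b ^+ size s)^-1 * (b ^+ 2 * p) ^+ distinct_edges i s =
    \prod_e ((b ^+ count_mem e l)^-1 * (b ^+ 2 * p) ^+ (0 < count_mem e l)%N).
  have sl : size s = size l by rewrite /l; elim: (s) (i) => //= j t IH k; rewrite -IH.
  rewrite big_split /= prodfV; congr (_^-1 * _).
    by rewrite -(big_count (fun=> b)) big_const_seq count_predT sl; elim: (size l) => //= k IH; rewrite exprS IH.
  rewrite prodrXr; congr (_ ^+ _); rewrite /distinct_edges -/l -(card_uniqP (undup_uniq l)).
  rewrite -sum1_card big_mkcond /=; apply: eq_bigr => e _.
  by rewrite mem_undup -has_count has_pred1; case: (e \in l).
apply: ler_prod => e _; rewrite normr_ge0 /=.
rewrite /pair_prob; case: ifPn => [_|ne]; first by rewrite add0r; exact: centered_moment_le.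
suff -> : count_mem e l = 0%N by rewrite !expr0 mulr1 mul0r add0r subr0 normr1 invr1 mul1r.
by apply/count_memPn/negP => /(loopless_edges_lt ll); apply/negP.
Qed.

End RandomGraph.

Section OperatorNorm.
Context {R : realType} {n : nat}.

Definition centered_mx (p : R) (a : {ffun 'I_n * 'I_n -> bool}) : 'M[R]_n :=
  \matrix_(j, k) centered_adj p a j k.

Lemma trmx_centered p a : (centered_mx p a)^T = centered_mx p a.
Proof. by apply/matrixP => j k; rewrite !mxE /centered_adj edgeC eq_sym. Qed.

End OperatorNorm.

(** The choice b^2 = 2 L / N balances the two terms of [sum_walks_distinct_le]. *)
Lemma trace_moment_le (R : realType) (n L : nat) (p : R) :
  0 < p <= 1 -> (0 < L)%N -> (2 * L)%:R <= n.+1%:R * p ->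
  bern_mean (pair_prob p) (fun a => \tr ((centered_mx p a : 'M[R]_n.+1) ^+ (2 * L))) <=
  n.+1%:R * (8 * L%:R * (n.+1%:R * p)) ^+ L.
Proof.
move=> /andP[p0 p1] L0 LN; set N := n.+1%:R * p in LN *.
have N0 : 0 < N by rewrite mulr_gt0.
have L2 : 0 < (2 * L)%:R :> R by rewrite ltr0n muln_gt0.
pose b : R := Num.sqrt ((2 * L)%:R / N).
have b2 : b ^+ 2 = (2 * L)%:R / N by rewrite sqr_sqrtr// divr_ge0// ltW.
have b0 : 0 < b by rewrite sqrtr_gt0 divr_gt0.
have b1 : b <= 1 by rewrite -sqrtr1 ler_wsqrtr// ler_pdivrMr// mul1r.
have bN : n.+1%:R * (b ^+ 2 * p) = (2 * L)%:R.
  by rewrite mulrCA b2 -/N divfK// gt_eqF.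
rewrite (@eq_bern_mean _ _ _ _ (fun a => \sum_i \sum_(s <- walks (2 * L))
   (last i s == i)%:R * walk_weight (centered_adj p a) i s)) => [|a]; last first.
  rewrite trace_exp_walks; apply: eq_bigr => i _; apply: eq_bigr => s _; congr (_ * _).
  by elim: s i => //= j s IH i; rewrite mxE IH.
rewrite bern_mean_sum.
apply: (@le_trans _ _ (\sum_(i < n.+1) \sum_(s <- walks (2 * L))
   (b ^+ (2 * L))^-1 * (b ^+ 2 * p) ^+ distinct_edges i s)).
  apply: ler_sum => i _.
  rewrite (_ : bern_mean _ _ = \sum_(s <- walks (2 * L)) (last i s == i)%:R *
     bern_mean (pair_prob p) (fun a => walk_weight (centered_adj p a) i s)); last first.
    rewrite /bern_mean; under eq_bigr do rewrite mulr_sumr.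
    rewrite exchange_big /=; apply: eq_bigr => s _; rewrite mulr_sumr.
    by apply: eq_bigr => a _; rewrite mulrCA.
  rewrite !big_seq; apply: ler_sum => s /size_walks sL; rewrite -{1}sL.
  have p01 : 0 <= p <= 1 by rewrite (ltW p0).
  have b01 : 0 < b <= 1 by rewrite b0.
  apply: le_trans (walk_mean_le i s p01 b01); case: (last i s == i) => /=.
    by rewrite mul1r ler_norm.
  by rewrite mul0r normr_ge0.
under eq_bigr do rewrite -mulr_sumr; rewrite -mulr_sumr.
apply: (@le_trans _ _ ((b ^+ (2 * L))^-1 * (n.+1%:R * (n.+1%:R * (b ^+ 2 * p) + (2 * L)%:R) ^+ (2 * L)))).
  rewrite ler_wpM2l ?invr_ge0 ?exprn_ge0 ?(ltW b0)//; apply: sum_walks_distinct_le.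
  by rewrite mulr_ge0 ?exprn_ge0// ltW.
rewrite bN mulrCA ler_wpM2l//; apply: eq_le_imp.
rewrite exprM b2 [X in _ * X]exprM -exprVn -exprMn; congr (_ ^+ _).
rewrite natrM; field.
by rewrite gt_eqF//= pnatr_eq0 -lt0n.
Qed.

(** Markov for the trace of a high power, which dominates the corresponding power of
    the operator norm. For t of order N^2 and 2^m of order log n the bound is a
    negative power of n. *)
Lemma operator_norm_prob_le (R : realType) (n m : nat) (p t : R) :
  0 < p <= 1 -> 0 < t -> (2 * 2 ^ m)%:R <= n.+1%:R * p ->
  bern_mean (pair_prob p) (fun a =>
    (`[< exists v : 'cV[R]_n.+1, t * sqnorm v < sqnorm (centered_mx p a *m v) >])%:R) <=
  n.+1%:R * (8 * (2 ^ m)%:R * (n.+1%:R * p) / t) ^+ (2 ^ m).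
Proof.
move=> p01 t0 mN; have p01' : 0 <= p <= 1 by case/andP: p01 => /ltW -> ->.
set L := (2 ^ m)%N in mN *; have L0 : (0 < L)%N by rewrite expn_gt0.
apply: (@le_trans _ _ (bern_mean (pair_prob p) (fun a =>
   (t ^+ L)^-1 * \tr ((centered_mx p a : 'M[R]_n.+1) ^+ (2 * L))))).
  apply: bern_mean_le => [e|a]; first exact: pair_prob01.
  set X := centered_mx p a.
  have tr0 (v : 'cV[R]_n.+1) := sqnorm_trace_le v m (trmx_centered p a).
  have [/asboolP[v tv]|_] := boolP `[< _ >]; last first.
    rewrite mulr_ge0 ?invr_ge0 ?exprn_ge0 ?(ltW t0)//.
    rewrite mul2n -addnn exprD -[_ * _]/(X ^+ L *m X ^+ L) /mxtrace sumr_ge0// => i _.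
    rewrite mxE sumr_ge0// => j _; rewrite -{1}(trmx_exp L (trmx_centered p a)) mxE -expr2.
    exact: sqr_ge0.
  have v0 : 0 < sqnorm v.
    rewrite lt_neqAle sqnorm_ge0 andbT eq_sym; apply/eqP => v0; move: tv.
    have := tr0 v; rewrite -/L v0 mulr0 expr0n gtn_eqF// mulr0 => H.
    have : sqnorm (X *m v) ^+ L = 0 by apply/eqP; rewrite eq_le H exprn_ge0// sqnorm_ge0.
    by move/eqP; rewrite expf_eq0 => /andP[_ /eqP ->]; rewrite ltxx.
  rewrite mulrC ler_pdivlMr ?exprn_gt0// mul1r -(ler_pM2r (exprn_gt0 L v0)) -exprMn.
  apply: le_trans (tr0 v); rewrite lerXn2r ?nnegrE ?mulr_ge0 ?sqnorm_ge0//; exact: ltW.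
rewrite (bern_meanZ _ _ (fun a => \tr ((centered_mx p a : 'M[R]_n.+1) ^+ (2 * L)))).
apply: (le_trans (ler_wpM2l _ (trace_moment_le p01 L0 mN))).
  by rewrite invr_ge0 exprn_ge0// ltW.
by rewrite mulrCA expr_div_n [X in _ * X <= _]mulrC.
Qed.

(** * Degrees of the random graph *)

Section Degrees.
Context {R : realType} {n : nat}.
Implicit Types (a : {ffun 'I_n * 'I_n -> bool}) (p t e : R).

Definition degree a j : R := \sum_k adj a j k.

Lemma edge_inj (j k k' : 'I_n) : edge j k = edge j k' -> k = k'.
Proof. by rewrite /edge; case: ifP => _; case: ifP => _ [] // -> ->. Qed.

(** Different neighbours are joined by different edges, so that the degree is a sum
    of independent variables. *)
Lemma degree_mgf p t (j : 'I_n) : 0 <= p <= 1 ->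
  bern_mean (pair_prob p) (fun a => expR (t * degree a j)) <=
  expR (n.-1%:R * (p * (expR t - 1))).
Proof.
move=> /andP[p0 p1].
pose f (e : 'I_n * 'I_n) (b : bool) : R :=
  \prod_(k | (k != j) && (edge j k == e)) expR (t * b%:R).
have fE a : expR (t * degree a j) = \prod_e f e (a e).
  rewrite /degree mulr_sumr expR_sum (bigD1 j)//= /adj eqxx mulr0 expR0 mul1r.
  rewrite (partition_big (edge j) predT)//=; apply: eq_bigr => e _.
  apply: eq_bigr => k /andP[kj /eqP <-]; by rewrite eq_sym (negPf kj).
rewrite (eq_bern_mean _ fE) bern_mean_prod.
rewrite (_ : \prod_e _ = \prod_(k | k != j) (1 + p * (expR t - 1))); last first.
  (* The factor of e is nontrivial only if e is an edge at j. *)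
  rewrite [RHS](partition_big (edge j) predT)//=; apply: eq_bigr => e _; rewrite /f.
  have [/existsP[k /andP[kj /eqP ke]]|nk] :=
      boolP [exists k, (k != j) && (edge j k == e)].
    have uniq_k i : ((i != j) && (edge j i == e)) = (i == k).
      apply/andP/eqP => [[_ /eqP]|->]; first by rewrite -ke => /edge_inj.
      by rewrite kj ke.
    rewrite !(eq_bigl _ _ uniq_k) !big_pred1_eq /pair_prob -ke edge_lt 1?eq_sym//.
    by rewrite mulr1 mulr0 expR0; ring.
  have none i : ((i != j) && (edge j i == e)) = false.
    by apply: contraNF nk => H; apply/existsP; exists i.
  by rewrite !(eq_bigl _ _ none) !big_pred0_eq !mulr1 addrC subrK.
rewrite prodr_const (_ : #|_| = n.-1); last by rewrite cardC1 card_ord.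
rewrite [leRHS]expRM_natl; apply: lerXn2r; rewrite ?nnegrE ?expR_ge0//.
  have := expR_gt0 t; nra.
exact: expR_ge1Dx.
Qed.

End Degrees.

(** The exponential Markov inequality with t = e / 4. The factor 3 absorbs the
    difference of p between the mean degree and N in the lower tail. *)
Lemma degree_prob_le (R : realType) (n : nat) (p e : R) (j : 'I_n.+1) :
  0 < p <= 1 -> 0 < e <= 1 ->
  bern_mean (pair_prob p) (fun a =>
    (~~ (`|degree a j - n.+1%:R * p| <= e * (n.+1%:R * p)))%:R) <=
  3 * expR (- (e ^+ 2 / 8 * (n.+1%:R * p))).
Proof.
move=> /andP[p0 p1] /andP[e0 e1]; set N := n.+1%:R * p.
have N0 : 0 < N by rewrite mulr_gt0.
have p01 : 0 <= p <= 1 by rewrite ltW.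
pose t := e / 4.
have t12 : -(1/2) <= t <= 1/2 by rewrite /t; lra.
have mt12 : -(1/2) <= - t <= 1/2 by rewrite /t; lra.
apply: (@le_trans _ _ (bern_mean (pair_prob p) (fun a =>
   expR (- (t * (1 + e) * N)) * expR (t * degree a j) +
   expR (t * (1 - e) * N) * expR (- t * degree a j)))).
  apply: bern_mean_le => [i|a]; first exact: pair_prob01.
  rewrite -!expRD; case: (leP `|degree a j - N| (e * N)) => /= [_|H]; first by rewrite addr_ge0 ?expR_ge0.
  move: H; rewrite ltr_normr => /orP[H|H].
    apply: (@le_trans _ _ (expR (- (t * (1 + e) * N) + t * degree a j))); last first.
      by rewrite lerDl expR_ge0.
    rewrite -[leLHS]expR0 ler_expR; have t0 : 0 < t by rewrite /t; lra.
    have : 0 < t * (degree a j - N - e * N) by rewrite mulr_gt0// subr_gt0.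
    lra.
  apply: (@le_trans _ _ (expR (t * (1 - e) * N + - t * degree a j))); last first.
    by rewrite lerDr expR_ge0.
  rewrite -[leLHS]expR0 ler_expR; have t0 : 0 < t by rewrite /t; lra.
  have : 0 < t * (- (degree a j - N) - e * N) by rewrite mulr_gt0// subr_gt0.
  lra.
rewrite bern_meanD (bern_meanZ _ _ (fun a => expR (t * degree a j))).
rewrite (bern_meanZ _ _ (fun a => expR (- t * degree a j))).
have NE : n%:R * p = N - p by rewrite /N -[n.+1]addn1 natrD; ring.
have h1 : expR (- (t * (1 + e) * N)) * bern_mean (pair_prob p) (fun a => expR (t * degree a j)) <=
    expR (- (e ^+ 2 / 8 * N)).
  apply: (le_trans (ler_wpM2l (expR_ge0 _) (degree_mgf t j p01))).
  rewrite -expRD ler_expR /= mulrA NE; have := expR_le_quadratic t12.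
  have : 0 <= expR t - 1 by rewrite subr_ge0 -[leLHS]expR0 ler_expR /t; lra.
  set u := expR t - 1 => u0 u1.
  have : (N - p) * u <= N * u by rewrite ler_wpM2r//; lra.
  have : N * u <= N * (t + 2 * t ^+ 2) by rewrite ler_wpM2l ?(ltW N0)// /u; lra.
  have -> : N * (t + 2 * t ^+ 2) = t * (1 + e) * N - e ^+ 2 / 8 * N by rewrite /t; field.
  lra.
have h2 : expR (t * (1 - e) * N) * bern_mean (pair_prob p) (fun a => expR (- t * degree a j)) <=
    2 * expR (- (e ^+ 2 / 8 * N)).
  apply: (le_trans (ler_wpM2l (expR_ge0 _) (degree_mgf (- t) j p01))).
  have e2 : expR (1/2 : R) <= 2.
    have := @expR_le_quadratic R (1/2); lra.
  apply: (@le_trans _ _ (expR (1/2) * expR (- (e ^+ 2 / 8 * N)))); last first.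
    by rewrite ler_wpM2r ?expR_ge0.
  rewrite -!expRD ler_expR /= mulrA NE; have := expR_le_quadratic mt12.
  rewrite sqrrN; set u := expR (- t) - 1 => u1.
  have Np : 0 <= N - p by rewrite -NE mulr_ge0// ltW.
  have : (N - p) * u <= (N - p) * (- t + 2 * t ^+ 2) by rewrite ler_wpM2l// /u; lra.
  have : p * (t - 2 * t ^+ 2) <= 1 / 2.
    have : 0 <= t - 2 * t ^+ 2 <= 1/2 by rewrite /t; nra.
    by move=> /andP[q0 q1]; apply: le_trans q1; rewrite ler_piMl.
  have -> : (N - p) * (- t + 2 * t ^+ 2) =
     p * (t - 2 * t ^+ 2) - t * (1 - e) * N - e ^+ 2 / 8 * N by rewrite /t; field.
  lra.
lra.
Qed.

(** * Integrals against a law *)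

Section WeightedLaw.
Local Open Scope ereal_scope.
Context {R : realType} {d d' : measure_display}
  {T : measurableType d} {T' : measurableType d'}.
Variables (mu : {measure set T -> \bar R}) (nu : {measure set T' -> \bar R}).
Variables (X : T -> R) (Y : T' -> R) (h : T -> R) (k : T' -> R).
Hypotheses (mX : measurable_fun setT X) (mY : measurable_fun setT Y).
Hypotheses (mh : measurable_fun setT h) (mk : measurable_fun setT k).
Hypotheses (h0 : forall w, (0 <= h w)%R) (k0 : forall w, (0 <= k w)%R).
Hypothesis hk : forall V, measurable V ->
  \int[mu]_w (\1_V (X w) * h w)%:E = \int[nu]_w (\1_V (Y w) * k w)%:E.

Import HBNNSimple.

Let eq_nnsfun (g : {nnsfun R >-> R}) :
  \int[mu]_w (g (X w) * h w)%:E = \int[nu]_w (g (Y w) * k w)%:E.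
Proof.
have gE x : (g x)%:E = \sum_(v \in range g) v%:E * (\1_(g @^-1` [set v]) x)%:E.
  by rewrite fsumEFin //= fimfunE.
have expand e (S : measurableType e) (ka : {measure set S -> \bar R})
    (Z : S -> R) (l : S -> R) : measurable_fun setT Z ->
    measurable_fun setT l -> (forall w, (0 <= l w)%R) ->
    \int[ka]_w (g (Z w) * l w)%:E =
    \sum_(v \in range g)
      v%:E * \int[ka]_w (\1_(g @^-1` [set v]) (Z w) * l w)%:E.
  move=> mZ ml l0.
  have m1 v : measurable_fun setT
      (fun w : S => (\1_(g @^-1` [set v]) (Z w) * l w : R)%:E).
    apply/measurable_EFinP; apply: measurable_funM => //.
    exact: measurableT_comp.
  transitivity (\int[ka]_w \sum_(v \in range g)
      (v%:E * (\1_(g @^-1` [set v]) (Z w) * l w)%:E)).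
    apply: eq_integral => w _; rewrite EFinM gE ge0_mule_fsuml.
      by apply: eq_fsbigr => v _; rewrite EFinM muleA.
    by move=> v; exact: nnfun_muleindic_ge0.
  rewrite ge0_integral_fsum //; last 2 first.
  - by move=> v; exact: measurable_funeM.
  - move=> v w _; rewrite EFinM muleA mule_ge0//.
      exact: nnfun_muleindic_ge0.
    by rewrite lee_fin.
  apply: eq_fsbigr => v; rewrite inE => -[z _ <-{v}].
  rewrite ge0_integralZl//; last by rewrite lee_fin.
  by move=> w _; rewrite lee_fin mulr_ge0.
rewrite (expand _ _ mu X h) // (expand _ _ nu Y k) //.
apply: eq_fsbigr => v _; congr (_ * _); apply: hk.
exact: measurable_funPTI.
Qed.

(** A nonnegative function is a monotone limit of simple functions. The weights h and
    k make this usable for conditional means and for densities at the same time. *)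
Lemma eq_weighted_integral (f : R -> R) : measurable_fun setT f ->
  (forall x, (0 <= f x)%R) ->
  \int[mu]_w (f (X w) * h w)%:E = \int[nu]_w (f (Y w) * k w)%:E.
Proof.
move=> mf f0.
have mEf : measurable_fun setT (EFin \o f) by exact/measurable_EFinP.
pose g := nnsfun_approx measurableT mEf.
have limit e (S : measurableType e) (ka : {measure set S -> \bar R})
    (Z : S -> R) (l : S -> R) : measurable_fun setT Z ->
    measurable_fun setT l -> (forall w, (0 <= l w)%R) ->
    \int[ka]_w (f (Z w) * l w)%:E =
    limn (fun n => \int[ka]_w (g n (Z w) * l w)%:E).
  move=> mZ ml l0.
  have cv w : (fun n => (g n (Z w) * l w)%:E) @ \oo --> (f (Z w) * l w)%:E.
    under eq_fun do rewrite EFinM.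
    rewrite EFinM; apply: cvgeZr => //.
    by apply: (@cvg_nnsfun_approx _ _ _ _ measurableT _ mEf) => // x _; rewrite lee_fin.
  rewrite -monotone_convergence//.
  - by apply: eq_integral => w _; apply/esym/cvg_lim => //; exact: cv.
  - move=> n; apply/measurable_EFinP; apply: measurable_funM => //.
    exact: measurableT_comp.
  - by move=> n w _; rewrite lee_fin mulr_ge0.
  - move=> w _ a b ab; rewrite lee_fin ler_wpM2r//.
    exact/lefP/nd_nnsfun_approx.
rewrite (limit _ _ mu X h)// (limit _ _ nu Y k)//.
by congr (limn _); apply/funext => n; exact: eq_nnsfun.
Qed.

End WeightedLaw.

(** * Products of independent variables *)

Lemma measurable_fun_bigprod (R : realType) d (T : measurableType d)
    (I : Type) (s : seq I) (D : pred I) (f : I -> T -> R) :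
  (forall i, D i -> measurable_fun [set: T] (f i)) ->
  measurable_fun [set: T] (fun w => \prod_(i <- s | D i) f i w).
Proof.
move=> mf; elim: s => [|i s IH]; first by under eq_fun do rewrite big_nil; exact: measurable_cst.
case Di : (D i); under eq_fun do rewrite big_cons Di; last by [].
by apply: measurable_funM => //; exact: mf.
Qed.

Lemma measurable_fun_bigsum (R : realType) d (T : measurableType d)
    (I : Type) (s : seq I) (D : pred I) (f : I -> T -> R) :
  (forall i, D i -> measurable_fun [set: T] (f i)) ->
  measurable_fun [set: T] (fun w => \sum_(i <- s | D i) f i w).
Proof.
move=> mf; elim: s => [|i s IH]; first by under eq_fun do rewrite big_nil; exact: measurable_cst.
case Di : (D i); under eq_fun do rewrite big_cons Di; last by [].
by apply: measurable_funD => //; exact: mf.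
Qed.

Section IndependentProduct.
Context {R : realType} {d : measure_display} {T : measurableType d}.
Variables (P : probability T R) (I : finType) (F : I -> set (set T)).
Hypothesis F_measurable : forall i E, F i E -> measurable E.
Hypothesis F_indep : mutually_independent P F.
Variables (f : I -> T -> R) (e : I -> R).
Hypothesis mf : forall i, measurable_fun [set: T] (f i).
Hypothesis f0 : forall i w, 0 <= f i w.
Hypothesis fF : forall i V, measurable V -> F i (f i @^-1` V).
Hypothesis fe : forall i, (\int[P]_w (f i w)%:E = (e i)%:E)%E.

Let mixed (J : {set I}) (E : I -> set T) (w : T) i : R :=
  if i \in J then f i w else \1_(E i) w.

Let mixed0 J E w i : 0 <= mixed J E w i.
Proof. by rewrite /mixed; case: ifP. Qed.

Let measurable_mixed (D : pred I) (J : {set I}) (E : I -> set T) :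
  (forall i, F i (E i)) ->
  measurable_fun [set: T] (fun w => \prod_(i | D i) mixed J E w i).
Proof.
move=> FE; apply: measurable_fun_bigprod => i _; rewrite /mixed; case: (i \in J) => //.
by apply: measurable_indic; exact: F_measurable (FE i).
Qed.

Let integral_mixed (J : {set I}) (E : I -> set T) : (forall i, F i (E i)) ->
  (\int[P]_w (\prod_i mixed J E w i)%:E =
   (\prod_i (if i \in J then e i else fine (P (E i))))%:E)%E.
Proof.
have PE (B : set T) : measurable B -> ((fine (P B))%:E = P B)%E.
  by move=> mB; rewrite fineK// fin_num_measure.
have [m] := ubnP #|J|; elim: m => // m IH in J E *.
have [->{J} _ FE|[j jJ]] := set_0Vmem J.
  have mB : measurable (\bigcap_(i in [set` [set: I]%SET]) E i).
    by apply: fin_bigcap_measurable => // i _; exact: F_measurable (FE i).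
  transitivity (P (\bigcap_(i in [set` [set: I]%SET]) E i)).
    transitivity (\int[P]_w (\1_(\bigcap_(i in [set` [set: I]%SET]) E i) w)%:E)%E; last first.
      by rewrite integral_indic// setIT.
    apply: eq_integral => w _; congr _%:E.
    rewrite indicE; have [|] := boolP (w \in _).
      rewrite inE => wE; apply: big1 => i _; rewrite /mixed inE indicE mem_set//.
      by apply: wE; rewrite /= inE.
    rewrite notin_setE => nwE.
    have [i nEi] : exists i, ~ E i w.
      by apply: contrapT => nE; apply: nwE => i _; apply: contrapT => ?; apply: nE; exists i.
    by rewrite (bigD1 i)//= /mixed inE indicE memNset// mul0r.
  rewrite F_indep// -prodEFin; apply: eq_big => [i|i _]; first by rewrite inE.
  by rewrite inE PE//; exact: F_measurable (FE i).
rewrite (cardsD1 j) jJ ltnS => ltJ FE.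
pose J' := (J :\ j)%SET.
pose h w := \prod_(i | i != j) mixed J E w i.
pose c := \prod_(i | i != j) (if i \in J then e i else fine (P (E i))).
have c0 : 0 <= c.
  apply: prodr_ge0 => i _; case: ifP => // _; last by rewrite fine_ge0.
  by rewrite -lee_fin -fe; apply: integral_ge0 => w _; rewrite lee_fin.
have mh : measurable_fun [set: T] h by exact: (@measurable_mixed (predC1 j)).
have h0 w : 0 <= h w by apply: prodr_ge0.
have key : (\int[P]_w (`|f j w| * h w)%:E = \int[P]_w (`|f j w| * c)%:E)%E.
  apply: (@eq_weighted_integral _ _ _ _ _ P P (f j) (f j) h (cst c)) => //.
  move=> V mV.
  pose E' i := if i == j then f j @^-1` V else E i.
  have FE' i : F i (E' i).
    by rewrite /E'; case: eqP => [->|_]; [exact: fF|exact: FE].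
  have := IH J' E' ltJ FE'.
  have J'E i : i != j -> (i \in J') = (i \in J) by move=> ij; rewrite !inE ij.
  have jJ' : (j \in J') = false by rewrite !inE eqxx.
  have E'j : E' j = f j @^-1` V by rewrite /E' eqxx.
  rewrite [X in _ = X%:E](bigD1 j)//= jJ' E'j.
  rewrite (eq_bigr (fun i => if i \in J then e i else fine (P (E i)))); last first.
    by move=> i ij; rewrite J'E// /E' (negbTE ij).
  rewrite -/c => H.
  have mfV : measurable (f j @^-1` V) by exact: (F_measurable (fF _ _)).
  transitivity (\int[P]_w (\prod_i mixed J' E' w i)%:E)%E.
    apply: eq_integral => w _; congr _%:E; rewrite (bigD1 j)//=; congr (_ * _).
      by rewrite /mixed jJ' /E' eqxx.
    by apply: eq_bigr => i ij; rewrite /mixed J'E// /E' (negbTE ij).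
  rewrite H; under eq_integral do rewrite mulrC EFinM.
  rewrite ge0_integralZl ?lee_fin//.
    rewrite EFinM muleC PE//; congr (_ * _)%E; rewrite -[in LHS](setIT (_ @^-1` _)).
    by rewrite -integral_indic.
  by apply/measurable_EFinP; exact: measurable_indic.
transitivity (\int[P]_w (`|f j w| * h w)%:E)%E.
  apply: eq_integral => w _; congr _%:E; rewrite (bigD1 j)//=.
  by rewrite /mixed jJ ger0_norm.
rewrite key [in RHS](bigD1 j)//= jJ -/c.
under eq_integral do rewrite ger0_norm// mulrC EFinM.
rewrite ge0_integralZl ?lee_fin//.
- by rewrite fe EFinM muleC.
- exact/measurable_EFinP.
- by move=> w _; rewrite lee_fin.
Qed.

(** Independence is about products of indicators. Replace the indicators by the
    functions f i, one index at a time: with all other factors fixed, both sides are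
    integrals against weights that agree on the events of f i. *)
Lemma integral_prod_independent :
  (\int[P]_w (\prod_i f i w)%:E = (\prod_i e i)%:E)%E.
Proof.
have FT i : F i [set: T] by rewrite -(preimage_setT (f i)); exact: fF.
have := @integral_mixed [set: I]%SET (fun=> [set: T]) FT.
under eq_bigr do rewrite inE.
move=> <-; apply: eq_integral => w _; congr _%:E.
by apply: eq_bigr => i _; rewrite /mixed inE.
Qed.

End IndependentProduct.

(** * Gaussian integrals *)

Section GaussianIntegrals.
Context {R : realType}.

Lemma integral_normal_law d (T : measurableType d)
    (mu : {measure set T -> \bar R}) (X : T -> R) (m s : R) (f : R -> R) :
  measurable_fun [set: T] X ->
  (forall V, measurable V -> mu (X @^-1` V) = normal_prob m s V) ->
  measurable_fun [set: R] f -> (forall x, 0 <= f x) ->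
  (\int[mu]_w (f (X w))%:E =
   \int[@lebesgue_measure R]_x (f x * normal_pdf m s x)%:E)%E.
Proof.
move=> mX lawX mf f0.
transitivity (\int[mu]_w (f (X w) * cst 1 w)%:E)%E.
  by apply: eq_integral => w _; rewrite mulr1.
apply: (@eq_weighted_integral _ _ _ _ _ mu (@lebesgue_measure R)
  X id (cst 1) (normal_pdf m s)) => //; first exact: measurable_normal_pdf.
  exact: normal_pdf_ge0.
move=> V mV; transitivity (mu (X @^-1` V)).
  rewrite -[X in mu X]setIT -integral_indic//; last first.
    by rewrite -[_ @^-1` _]setTI; exact: mX.
  by apply: eq_integral => w _; rewrite mulr1.
rewrite lawX// /normal_prob [LHS]integral_mkcond; apply: eq_integral => x _.
rewrite /patch indicE; case: ifP => _; by rewrite ?mul1r ?mul0r.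
Qed.

(** Completing the square shifts the density. *)
Lemma mgf_normal d (T : measurableType d)
    (mu : {measure set T -> \bar R}) (X : T -> R) (s t : R) : s != 0 ->
  measurable_fun [set: T] X ->
  (forall V, measurable V -> mu (X @^-1` V) = normal_prob 0 s V) ->
  (\int[mu]_w (expR (t * X w))%:E = (expR (t ^+ 2 * s ^+ 2 / 2))%:E)%E.
Proof.
move=> s0 mX lawX.
have mexp : measurable_fun [set: R] (fun x => expR (t * x)).
  by apply: measurableT_comp => //; exact: measurable_funM.
rewrite (integral_normal_law mX lawX mexp) => [|x]; last exact: expR_ge0.
transitivity (\int[@lebesgue_measure R]_x ((expR (t ^+ 2 * s ^+ 2 / 2))%:E *
   (normal_pdf (t * s ^+ 2) s x)%:E))%E.
  apply: eq_integral => x _; rewrite -EFinM; congr _%:E.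
  rewrite /normal_pdf (negbTE s0) /normal_fun mulrCA [RHS]mulrCA; congr (_ * _).
  rewrite -!expRD; congr expR; field; exact: s0.
rewrite ge0_integralZl ?lee_fin ?expR_ge0//.
- by rewrite integral_normal_pdf mule1.
- by apply/measurable_EFinP; exact: measurable_normal_pdf.
- by move=> x _; rewrite lee_fin normal_pdf_ge0.
Qed.

Lemma integral_expR_sqr_normal (a : R) : a < 1 / 2 ->
  (\int[normal_prob (0 : R) 1]_x (expR (a * x ^+ 2))%:E =
   ((Num.sqrt (1 - 2 * a))^-1)%:E)%E.
Proof.
move=> a2; have b0 : 0 < 1 - 2 * a by rewrite subr_gt0; lra.
pose s := (Num.sqrt (1 - 2 * a))^-1.
have s0 : 0 < s by rewrite invr_gt0 sqrtr_gt0.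
have s2 : s ^+ 2 = (1 - 2 * a)^-1 by rewrite exprVn sqr_sqrtr// ltW.
have mexp : measurable_fun [set: R] (fun x => expR (a * x ^+ 2)).
  by apply: measurableT_comp => //; apply: measurable_funM => //; exact: exprn_measurable.
rewrite (@integral_normal_law _ _ (normal_prob (0:R) 1) id 0 1 (fun x => expR (a * x ^+ 2)))//.
transitivity (\int[@lebesgue_measure R]_x (s%:E * (normal_pdf 0 s x)%:E))%E.
  apply: eq_integral => x _; rewrite -EFinM; congr _%:E.
  rewrite /normal_pdf oner_eq0 (gt_eqF s0) /normal_fun mulrCA [RHS]mulrA.
  congr (_ * _); last first.
    rewrite -expRD; congr expR; rewrite s2; field; lra.
  rewrite /normal_peak expr1n mul1r -[in RHS]mulrnAr sqrtrM ?sqr_ge0//.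
  by rewrite sqrtr_sqr gtr0_norm// invfM mulrA divff ?mul1r ?gt_eqF.
rewrite ge0_integralZl ?lee_fin ?ltW//.
- by rewrite integral_normal_pdf mule1.
- by apply/measurable_EFinP; exact: measurable_normal_pdf.
- by move=> x _; rewrite lee_fin normal_pdf_ge0.
Qed.

End GaussianIntegrals.

(** * Exponential moments of sums of squares *)

Section SquaresOfGaussians.
Context {R : realType} {d : measure_display} {T : measurableType d}.
Variables (P : probability T R) (I : finType).
Variables (G : T -> R) (y : I -> T -> R) (a : I -> R) (q la : R).
Hypotheses (mG : measurable_fun [set: T] G) (G0 : forall w, 0 <= G w).
Hypothesis my : forall i, measurable_fun [set: T] (y i).
Hypothesis q0 : 0 <= q.
Hypotheses (la0 : 0 <= la) (laa : forall i, la * a i < 1).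
Hypothesis mgf : forall x : I -> R,
  (\int[P]_w (G w * expR (\sum_i x i * y i w))%:E <=
   (q * expR ((\sum_i a i * x i ^+ 2) / 4))%:E)%E.

Let c i : R := (Num.sqrt (1 - la * a i))^-1.

Let mixed (J : {set I}) (x : I -> R) (w : T) i : R :=
  if i \in J then la * y i w ^+ 2 else x i * y i w.

Let measurable_mixed (D : pred I) (J : {set I}) (x : I -> R) :
  measurable_fun [set: T] (fun w => G w * expR (\sum_(i | D i) mixed J x w i)).
Proof.
apply: measurable_funM => //; apply: measurableT_comp => //.
apply: measurable_fun_bigsum => i _; rewrite /mixed; case: (i \in J).
  by apply: measurable_funM => //; exact: measurable_funX.
exact: measurable_funM.
Qed.

Let mixed_bound (J : {set I}) (x : I -> R) :
  (\int[P]_w (G w * expR (\sum_i mixed J x w i))%:E <=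
   (q * \prod_i (if i \in J then c i else expR (a i * x i ^+ 2 / 4)))%:E)%E.
Proof.
have [m] := ubnP #|J|; elim: m => // m IH in J x *.
have [->{J} _|[j jJ]] := set_0Vmem J.
  apply: (@le_trans _ _ (\int[P]_w (G w * expR (\sum_i x i * y i w))%:E)%E).
    apply: eq_le_imp; apply: eq_integral => w _; congr (G w * expR _)%:E.
    by apply: eq_bigr => i _; rewrite /mixed inE.
  apply: (le_trans (mgf x)).
  rewrite lee_fin mulr_suml expR_sum; apply: eq_le_imp; congr (_ * _).
  by apply: eq_bigr => i _; rewrite inE.
rewrite (cardsD1 j) jJ ltnS => ltJ.
pose J' := (J :\ j)%SET.
have J'E i : i != j -> (i \in J') = (i \in J) by move=> ij; rewrite !inE ij.
have jJ' : (j \in J') = false by rewrite !inE eqxx.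
pose H w := G w * expR (\sum_(i | i != j) mixed J x w i).
have mH : measurable_fun [set: T] H by exact: (@measurable_mixed (predC1 j)).
have H0 w : 0 <= H w by rewrite mulr_ge0 ?expR_ge0.
pose s : R := Num.sqrt (2 * la).
have s2 : s ^+ 2 = 2 * la by rewrite sqr_sqrtr// mulr_ge0.
(* The auxiliary Gaussian that linearizes the square of y j. *)
pose ga := normal_prob (0 : R) 1.
have -> : (\int[P]_w (G w * expR (\sum_i mixed J x w i))%:E =
    \int[P]_w \int[ga]_g (H w * expR (s * y j w * g))%:E)%E.
  apply: eq_integral => w _.
  under [RHS]eq_integral do rewrite EFinM.
  rewrite ge0_integralZl; [|by []| |by move=> g _; rewrite lee_fin expR_ge0
    |by rewrite lee_fin]; last first.
    by apply/measurable_EFinP; apply: measurableT_comp => //; exact: measurable_funM.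
  rewrite (@mgf_normal _ _ _ ga id 1)// ?oner_eq0// -EFinM; congr _%:E.
  rewrite (bigD1 j)//= expRD mulrCA mulrC /H; congr (_ * expR _).
  by rewrite /mixed jJ exprMn s2 expr1n; field.
pose F (u : T * R) : \bar R := (H u.1 * expR (s * y j u.1 * u.2))%:E.
have F0 u : (0 <= F u)%E by rewrite lee_fin mulr_ge0 ?expR_ge0.
have mF : measurable_fun [set: T * R] F.
  apply/measurable_EFinP; apply: measurable_funM.
    exact: measurableT_comp.
  apply: measurableT_comp => //; apply: measurable_funM => //.
  apply: measurable_funM => //; exact: measurableT_comp.
rewrite (@fubini_tonelli _ _ _ _ _ P ga F)//.
pose C := q * \prod_(i | i != j) (if i \in J then c i else expR (a i * x i ^+ 2 / 4)).
have C0 : 0 <= C.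
  rewrite mulr_ge0// prodr_ge0// => i _; case: ifP => _; last exact: expR_ge0.
  by rewrite invr_ge0 sqrtr_ge0.
have step g : (\int[P]_w (H w * expR (s * y j w * g))%:E <=
    C%:E * (expR (la * a j / 2 * g ^+ 2))%:E)%E.
  pose x' i := if i == j then s * g else x i.
  have := IH J' x' ltJ.
  rewrite [in X in (_ <= X)%E -> _](bigD1 j)//= jJ' /x' eqxx.
  rewrite (eq_bigr (fun i => if i \in J then c i else expR (a i * x i ^+ 2 / 4))); last first.
    by move=> i ij; rewrite J'E// (negbTE ij).
  move=> H1.
  apply: (@le_trans _ _ (\int[P]_w (G w * expR (\sum_i mixed J' x' w i))%:E)%E).
    apply: eq_le_imp; apply: eq_integral => w _; congr _%:E.
    rewrite /H -mulrA -expRD [in RHS](bigD1 j)//= [in RHS]addrC.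
    have -> : mixed J' x' w j = s * y j w * g by rewrite /mixed jJ' /x' eqxx mulrAC.
    rewrite (eq_bigr (mixed J' x' w))// => i ij.
    by rewrite /mixed J'E// /x' (negbTE ij).
  apply: (le_trans H1); rewrite -EFinM lee_fin; apply: eq_le_imp.
  rewrite /C -[RHS]mulrA; congr (_ * _); rewrite mulrC; congr (_ * expR _).
  by rewrite exprMn s2; field.
have mexp : measurable_fun [set: R] (fun g => expR (la * a j / 2 * g ^+ 2)).
  apply: measurableT_comp => //; apply: measurable_funM; first exact: measurable_cst.
  exact: exprn_measurable.
apply: (@le_trans _ _ (\int[ga]_g (C%:E * (expR (la * a j / 2 * g ^+ 2))%:E))%E).
  apply: ge0_le_integral => //.
  - by move=> g _; apply: integral_ge0 => w _; rewrite lee_fin mulr_ge0 ?expR_ge0.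
  - exact: (@measurable_fun_fubini_tonelli_G _ _ _ _ _ P _ mF F0).
  - by apply: measurable_funeM; exact/measurable_EFinP.
  - by move=> g _; exact: step.
rewrite ge0_integralZl; [|by []|exact/measurable_EFinP
  |by move=> g _; rewrite lee_fin expR_ge0|by rewrite lee_fin].
rewrite integral_expR_sqr_normal; last by have := laa j; lra.
rewrite -EFinM lee_fin [in leRHS](bigD1 j)//= jJ [leRHS]mulrCA [leRHS]mulrC.
apply: eq_le_imp; by congr (_ * (Num.sqrt _)^-1); field.
Qed.

(** The identity exp (la y^2) = E exp (sqrt (2 la) y g), for g standard Gaussian,
    turns a square into a linear term. It is applied to one y i at a time, with the
    Gaussian integral moved outside; the hypothesis bounds linear terms only. The
    weight G restricts to an event. *)
Lemma integral_expR_sum_sqr :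
  (\int[P]_w (G w * expR (la * \sum_i y i w ^+ 2))%:E <=
   (q * \prod_i (Num.sqrt (1 - la * a i))^-1)%:E)%E.
Proof.
have := mixed_bound [set: I]%SET (fun=> 0).
rewrite (eq_bigr c) => [|i _]; last by rewrite inE.
apply: le_trans; apply: eq_le_imp; apply: eq_integral => w _; congr (_ * expR _)%:E.
by rewrite mulr_sumr; apply: eq_bigr => i _; rewrite /mixed inE.
Qed.

End SquaresOfGaussians.

(** * The joint law of graph and noise *)

Section ModelMgf.
Context {d : measure_display} {T : measurableType d} {R : realType}.
Context {P : probability T R} {n : nat}.
Variables (A : 'I_n -> 'I_n -> {RV P >-> bool}).
Variables (ReW ImW : 'I_n -> 'I_n -> {RV P >-> R}) (p : R).
Hypothesis model : sync_model A ReW ImW p.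
Hypothesis p01 : 0 <= p <= 1.
Implicit Types (a : {ffun 'I_n * 'I_n -> bool}).

Let upper := @upper_pair n.

Let measurable_eq_bool (b0 : bool) :
  measurable_fun [set: bool] (fun b : bool => (b == b0)%:R : R).
Proof. by []. Qed.

Definition graph_indicator a (w : T) : R :=
  \prod_(e : upper) (A (val e).1 (val e).2 w == a (val e))%:R.

(** The functions a that can occur as a graph. *)
Definition upper_graph a : bool := [forall e, a e ==> (e.1 < e.2)%N].

Lemma bern_weight_upper a : upper_graph a ->
  bern_weight (pair_prob p) a = \prod_(e : upper) (if a (val e) then p else 1 - p).
Proof.
move=> /forallP ua; rewrite /bern_weight (bigID (fun e : 'I_n * 'I_n => (e.1 < e.2)%N)) /=.
rewrite [X in _ * X]big1 ?mulr1 => [|e ne]; last first.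
  by have := ua e; rewrite (negPf ne) implybF /pair_prob (negPf ne) => /negPf ->; rewrite subr0.
rewrite -(big_sub (fun e : 'I_n * 'I_n => (e.1 < e.2)%N) (fun e => if a e then p else 1 - p)).
by apply: eq_bigr => e lte; rewrite /pair_prob lte.
Qed.

Lemma graph_indicator_ge0 a w : 0 <= graph_indicator a w.
Proof. by apply: prodr_ge0 => e _; exact: ler0n. Qed.

Lemma measurable_graph_indicator a : measurable_fun [set: T] (graph_indicator a).
Proof.
apply: measurable_fun_bigprod => e _.
exact: (measurableT_comp (measurable_eq_bool (a (val e))) (measurable_funP _)).
Qed.

(** Restricting to the event that the graph is a costs exactly the probability of a,
    because the noise is independent of the graph. *)
Lemma model_mgf a (r s : upper -> R) : upper_graph a ->
  (\int[P]_w (graph_indicator a w *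
     expR (\sum_(e : upper) (r e * ReW (val e).1 (val e).2 w + s e * ImW (val e).1 (val e).2 w)))%:E =
   (bern_weight (pair_prob p) a * expR ((\sum_(e : upper) (r e ^+ 2 + s e ^+ 2)) / 4))%:E)%E.
Proof.
move=> ua; have [laws indep] := model.
pose f (i : upper + (upper + upper)) (w : T) : R :=
  match i with
  | inl e => (A (val e).1 (val e).2 w == a (val e))%:R
  | inr (inl e) => expR (r e * ReW (val e).1 (val e).2 w)
  | inr (inr e) => expR (s e * ImW (val e).1 (val e).2 w)
  end.
pose ev (i : upper + (upper + upper)) : R :=
  match i with
  | inl e => if a (val e) then p else 1 - p
  | inr (inl e) => expR (r e ^+ 2 / 4)
  | inr (inr e) => expR (s e ^+ 2 / 4)
  end.
have mexp (c : R) : measurable_fun [set: R] (fun x => expR (c * x)).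
  by apply: measurableT_comp => //; exact: measurable_funM.
have mf i : measurable_fun [set: T] (f i).
  case: i => [e|[e|e]].
  - exact: (measurableT_comp (measurable_eq_bool (a (val e))) (measurable_funP _)).
  - exact: (measurableT_comp (mexp (r e)) (measurable_funP _)).
  - exact: (measurableT_comp (mexp (s e)) (measurable_funP _)).
have := @integral_prod_independent R d T P _ (model_sigma A ReW ImW) _ indep f ev mf.
rewrite /f /ev => H.
have {H} : (\int[P]_w (\prod_i f i w)%:E = (\prod_i ev i)%:E)%E.
  apply: H.
  - by case=> [e|[e|e]] E [B mB <-]; rewrite setTI; exact: measurable_funPTI.
  - by case=> [e|[e|e]] w; rewrite ?ler0n ?expR_ge0.
  - case=> [e|[e|e]] V mV.
    + exists ((fun b : bool => (b == a (val e))%:R : R) @^-1` V) => //.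
      by rewrite setTI.
    + exists ((fun x : R => expR (r e * x)) @^-1` V); last by rewrite setTI.
      by rewrite -[_ @^-1` _]setTI; exact: mexp.
    + exists ((fun x : R => expR (s e * x)) @^-1` V); last by rewrite setTI.
      by rewrite -[_ @^-1` _]setTI; exact: mexp.
  - have s2 : Num.sqrt (2^-1 : R) ^+ 2 = 2^-1 by rewrite sqr_sqrtr// invr_ge0.
    have s0 : Num.sqrt (2^-1 : R) != 0 by rewrite gt_eqF// sqrtr_gt0 invr_gt0.
    case=> [e|[e|e]]; have [lA lR lI] := laws _ _ (valP e).
    + transitivity (bernoulli_prob p [set a (val e)]).
        rewrite -lA// -[in RHS](setIT [set a (val e)]) -integral_indic//.
        rewrite ge0_integral_distribution//; apply: eq_integral => w _ /=.
        by rewrite indicE /=; congr _%:E; case: eqVneq => [->|ne]; [rewrite mem_set|rewrite memNset// => /eqP; rewrite (negPf ne)].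
      rewrite bernoulli_probE//; case: (a (val e)) => /=.
        by rewrite !diracE mem_set// memNset// mule1 mule0 adde0.
      by rewrite !diracE memNset// mem_set// mule1 mule0 add0e.
    + rewrite (mgf_normal _ s0) ?s2//.
        by congr (expR _)%:E; field.
    + rewrite (mgf_normal _ s0) ?s2//.
        by congr (expR _)%:E; field.
rewrite bern_weight_upper// /ev big_sumType /= => H.
transitivity (\int[P]_w (\prod_i f i w)%:E)%E.
  apply: eq_integral => w _; congr _%:E; rewrite big_sumType /= big_sumType /= /graph_indicator.
  by congr (_ * _); rewrite expR_sum -big_split /=; apply: eq_bigr => e _; rewrite expRD.
rewrite H; congr (_ * _)%:E; rewrite big_sumType /= mulr_suml expR_sum -big_split /=.
by apply: eq_bigr => e _; rewrite mulrDl expRD.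
Qed.

End ModelMgf.

(** * Noise sums as linear forms in the Gaussians *)

Lemma sum_upper_pairs (R : realType) (n : nat) (F : 'I_n -> 'I_n -> R) :
  (forall j, F j j = 0) ->
  \sum_j \sum_k F j k =
  \sum_(e : @upper_pair n) (F (val e).1 (val e).2 + F (val e).2 (val e).1).
Proof.
move=> F0; rewrite (pair_bigA _ (fun j k => F j k)) /=.
rewrite (bigID (fun e : 'I_n * 'I_n => (e.1 < e.2)%N)) /= big_split /=; congr (_ + _).
  exact: (big_sub (fun e : 'I_n * 'I_n => (e.1 < e.2)%N) (fun e => F e.1 e.2)).
rewrite (bigID (fun e : 'I_n * 'I_n => (e.2 < e.1)%N)) /= [X in _ + X]big1 ?addr0; last first.
  move=> [j k] /=; rewrite -!leqNgt => /andP[kj jk].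
  by rewrite (_ : k = j) ?F0//; apply/val_inj/eqP; rewrite eqn_leq kj jk.
rewrite -(big_sub (fun e : 'I_n * 'I_n => (e.1 < e.2)%N) (fun e => F e.2 e.1)).
rewrite (reindex (fun e : 'I_n * 'I_n => (e.2, e.1))) /=; last first.
  by exists (fun e => (e.2, e.1)) => -[].
apply: eq_bigl => -[j k] /=; rewrite -leqNgt andb_idl// => /ltnW; exact.
Qed.

(** Turns the exact Gaussian factor into an exponential, with an error of second
    order: this precision is needed where the constant is sharp. *)
Lemma inv_sqrt_le_expR (R : realType) (t : R) : 0 <= t <= 1 / 2 ->
  (Num.sqrt (1 - t))^-1 <= expR ((t + 2 * t ^+ 2) / 2).
Proof.
move=> /andP[t0 t1]; have s0 : 0 < 1 - t by lra.
have e0 := expR_gt0 ((t + 2 * t ^+ 2) / 2).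
rewrite -[leRHS]invrK lef_pV2 ?posrE ?sqrtr_gt0 ?invr_gt0//.
rewrite -(ler_pXn2r (n := 2)) ?nnegrE ?sqrtr_ge0 ?invr_ge0 ?expR_ge0//.
rewrite sqr_sqrtr ?(ltW s0)// exprVn -expRM_natl.
rewrite (_ : 2%:R * _ = t + 2 * t ^+ 2); last by field.
rewrite -[leLHS]mul1r ler_pdivrMr ?expR_gt0//.
have := expR_ge1Dx (t + 2 * t ^+ 2) => h.
have : (1 - t) * (1 + (t + 2 * t ^+ 2)) <= (1 - t) * expR (t + 2 * t ^+ 2) by rewrite ler_pM2l.
have : 0 <= t ^+ 2 * (1 - 2 * t) by rewrite mulr_ge0 ?sqr_ge0//; lra.
lra.
Qed.

Section NoiseForms.
Context {d : measure_display} {T : measurableType d} {R : realType}.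
Context {P : probability T R} {n : nat}.
Variables (A : 'I_n -> 'I_n -> {RV P >-> bool}).
Variables (ReW ImW : 'I_n -> 'I_n -> {RV P >-> R}) (p : R) (z : 'I_n -> R[i]).
Hypothesis model : sync_model A ReW ImW p.
Hypothesis p01 : 0 <= p <= 1.
Hypothesis z_unit : forall j, sqn (z j) = 1.
Variable a : {ffun 'I_n * 'I_n -> bool}.
Hypothesis ua : upper_graph a.
Local Open Scope complex_scope.

Let upper := @upper_pair n.

Definition masked_noise (w : T) : 'M[R[i]]_n :=
  \matrix_(j, k) ((adj a j k)%:C * (conjc (z j) * noise_mx ReW ImW w j k * z k)).

(** The j-th entry of T x, where b selects the real part (true) or the imaginary part
    (false): both are linear in the Gaussians and are treated together. *)
Definition noise_form (b : bool) (x : 'I_n -> R) (j : 'I_n) (w : T) : R :=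
  let s := \sum_k masked_noise w j k * (x k)%:C in
  if b then complex.Re s else complex.Im s.

(** The coefficient of the pair e in sum_j g j * (T x)_j, up to a phase. The entries
    (j, k) and (k, j) of T are conjugate and share one Gaussian; this decides the
    sign between the two terms. *)
Definition sym_coef (b : bool) (x g : 'I_n -> R) (e : upper) : R :=
  adj a (val e).1 (val e).2 *
  (g (val e).1 * x (val e).2 + (if b then 1 else -1) * (g (val e).2 * x (val e).1)).

Lemma adjC j k : adj a j k = adj a k j :> R.
Proof. by rewrite /adj edgeC eq_sym. Qed.

Lemma adj_diag j : adj a j j = 0 :> R.
Proof. by rewrite /adj eqxx. Qed.

Lemma adj_sqr j k : adj a j k ^+ 2 = adj a j k :> R.
Proof. by rewrite /adj; case: ifP => _; [rewrite expr0n|case: (a _); rewrite ?expr1n ?expr0n]. Qed.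

Lemma adj_ge0 j k : 0 <= adj a j k :> R.
Proof. by rewrite -adj_sqr sqr_ge0. Qed.

Lemma noise_form_linear b x g w :
  \sum_j g j * noise_form b x j w =
  \sum_(e : upper)
    (sym_coef b x g e * (if b then complex.Re (conjc (z (val e).1) * z (val e).2)
                              else complex.Im (conjc (z (val e).1) * z (val e).2)) *
       ReW (val e).1 (val e).2 w +
     sym_coef b x g e * (if b then - complex.Im (conjc (z (val e).1) * z (val e).2)
                              else complex.Re (conjc (z (val e).1) * z (val e).2)) *
       ImW (val e).1 (val e).2 w).
Proof.
pose F j k := g j * (adj a j k * x k *
  (if b then complex.Re (conjc (z j) * noise_mx ReW ImW w j k * z k)
        else complex.Im (conjc (z j) * noise_mx ReW ImW w j k * z k))).
transitivity (\sum_j \sum_k F j k).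
  apply: eq_bigr => j _; rewrite -mulr_sumr; congr (_ * _); rewrite /noise_form.
  by case: b @F => F /=; rewrite ?Re_sum ?Im_sum; apply: eq_bigr => k _; rewrite mxE ?ReM ?ImM /=;
    rewrite ?(ReM (_%:C)) ?(ImM (_%:C)) /=; ring.
rewrite sum_upper_pairs; last by move=> j; rewrite /F adj_diag !mul0r mulr0.
apply: eq_bigr => e _; rewrite /F /sym_coef (adjC (val e).2).
have lte : ((val e).1 < (val e).2)%N := valP e.
rewrite !mxE lte ltnNge (ltnW lte) /=.
case: (z (val e).1) => a1 a2; case: (z (val e).2) => b1 b2.
by case: b @F => F /=; ring.
Qed.

Lemma measurable_noise_form b x j : measurable_fun [set: T] (noise_form b x j).
Proof.
rewrite (_ : noise_form b x j = fun w => \sum_i (i == j)%:R * noise_form b x i w); last first.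
  apply/funext => w; rewrite (bigD1 j)//= eqxx mul1r big1 ?addr0// => i /negPf ->.
  by rewrite mul0r.
rewrite (funext (noise_form_linear b x (fun i => (i == j)%:R))).
apply: measurable_fun_bigsum => e _; apply: measurable_funD; apply: measurable_funM => //;
  exact: measurable_funP.
Qed.

(** The phase conj(z_j) z_k rotates the pair of Gaussians and leaves its law
    unchanged. *)
Lemma noise_form_mgf b x g :
  (\int[P]_w (graph_indicator A a w * expR (\sum_j g j * noise_form b x j w))%:E =
   (bern_weight (pair_prob p) a * expR ((\sum_(e : upper) sym_coef b x g e ^+ 2) / 4))%:E)%E.
Proof.
under eq_integral do rewrite noise_form_linear.
rewrite (model_mgf model p01)//; congr (_ * expR (_ / 4))%:E; apply: eq_bigr => e _.
have zz : complex.Re (conjc (z (val e).1) * z (val e).2) ^+ 2 + complex.Im (conjc (z (val e).1) * z (val e).2) ^+ 2 = 1.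
  by rewrite -/(sqn _) sqnM sqn_conj !z_unit mulr1.
move: zz; move: (sym_coef b x g e) => q; set c := complex.Re _; set s := complex.Im _ => zz.
by case: b; rewrite !exprMn -mulrDr ?sqrrN ?zz ?mulr1// addrC zz mulr1.
Qed.

Definition local_degree (x : 'I_n -> R) j : R := \sum_k adj a j k * x k ^+ 2.

Lemma sum_sym_coef_le b x g :
  \sum_(e : upper) sym_coef b x g e ^+ 2 <= \sum_j (2 * local_degree x j) * g j ^+ 2.
Proof.
have -> : \sum_j (2 * local_degree x j) * g j ^+ 2 =
    \sum_j \sum_k 2 * (adj a j k * (g j ^+ 2 * x k ^+ 2)).
  apply: eq_bigr => j _; rewrite /local_degree mulr_sumr mulr_suml.
  by apply: eq_bigr => k _; ring.
rewrite sum_upper_pairs; last by move=> j; rewrite adj_diag mul0r mulr0.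
apply: ler_sum => e _; rewrite /sym_coef exprMn adj_sqr (adjC (val e).2) -mulrDr -mulrDr.
rewrite [leRHS]mulrCA ler_wpM2l ?adj_ge0//.
set u := g _ * x _; set v := g (val e).2 * x _.
rewrite -!exprMn -/u -/v.
have := sqr_ge0 (u - v); have := sqr_ge0 (u + v); case: b; nra.
Qed.

(** The quadratic form of the graph Laplacian. The imaginary parts of T 1 are
    antisymmetric flows, and their covariance is half of the Laplacian; with degrees
    close to N its norm is close to N, which gives the sharp variance N / 2. *)
Lemma sum_sym_coef_diff g :
  \sum_(e : upper) sym_coef false (fun=> 1) g e ^+ 2 =
  \sum_j degree a j * g j ^+ 2 - \sum_j \sum_k adj a j k * (g j * g k).
Proof.
have -> : \sum_j degree a j * g j ^+ 2 = \sum_j \sum_k adj a j k * g j ^+ 2.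
  by apply: eq_bigr => j _; rewrite /degree mulr_suml.
rewrite -sumrB; under [RHS]eq_bigr do rewrite -sumrB.
rewrite sum_upper_pairs; last by move=> j; rewrite adj_diag !mul0r subrr.
apply: eq_bigr => e _; rewrite /sym_coef exprMn adj_sqr (adjC (val e).2); ring.
Qed.

End NoiseForms.

(** * Noise moments on a concentrated graph *)

Section NoiseTails.
Context {d : measure_display} {T : measurableType d} {R : realType}.
Context {P : probability T R} {n : nat}.
Variables (A : 'I_n -> 'I_n -> {RV P >-> bool}).
Variables (ReW ImW : 'I_n -> 'I_n -> {RV P >-> R}) (p : R) (z : 'I_n -> R[i]).
Hypothesis model : sync_model A ReW ImW p.
Hypothesis p01 : 0 <= p <= 1.
Hypothesis z_unit : forall j, sqn (z j) = 1.
Variable a : {ffun 'I_n * 'I_n -> bool}.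
Hypothesis ua : upper_graph a.

Let G := graph_indicator (R := R) A a.
Let q := bern_weight (pair_prob p) a.
Let form := noise_form ReW ImW z a.

Let q0 : 0 <= q.
Proof. by apply: bern_weight_ge0 => e; rewrite /pair_prob; case: ifP => _; rewrite ?lexx ?ler01. Qed.

Lemma noise_square_mgf_le (D : pred 'I_n) (b : bool) (x al : 'I_n -> R) (la : R) :
  0 <= la -> (forall j, 0 <= al j) -> (forall j, la * al j <= 1 / 2) ->
  (forall g, \sum_(e : @upper_pair n) sym_coef a b x g e ^+ 2 <= \sum_j al j * g j ^+ 2) ->
  (\int[P]_w (G w * expR (la * \sum_(j | D j) form b x j w ^+ 2))%:E <=
   (q * expR (\sum_(j | D j) (la * al j + 2 * (la * al j) ^+ 2) / 2))%:E)%E.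
Proof.
move=> la0 al0 al1 quad.
pose al' j := if D j then al j else 0.
pose y j w := (D j)%:R * form b x j w.
have t01 j : 0 <= la * al' j <= 1 / 2.
  rewrite /al'; case: ifP => _; first by rewrite al1 mulr_ge0.
  by rewrite mulr0 lexx; lra.
have := @integral_expR_sum_sqr R d T P _ G y al' q la (measurable_graph_indicator A a)
  (graph_indicator_ge0 A a).
move=> H; apply: le_trans (le_trans (H _ _ _ _ _) _) => {H}.
- apply: eq_le_imp; apply: eq_integral => w _; congr (_ * expR (_ * _))%:E.
  rewrite big_mkcond; apply: eq_bigr => j _; rewrite /y; case: ifP => _; last by rewrite mul0r expr0n.
  by rewrite mul1r.
- by move=> j; apply: measurable_funM => //; exact: measurable_noise_form.
- exact: q0.
- exact: la0.
- by move=> j; have /andP[_] := t01 j; lra.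
- move=> g; pose g' j := (D j)%:R * g j.
  rewrite (_ : (\int[P]_w _)%E = (\int[P]_w (G w * expR (\sum_j g' j * form b x j w))%:E)%E); last first.
    apply: eq_integral => w _; congr (_ * expR _)%:E; apply: eq_bigr => j _.
    by rewrite /g' /y; ring.
  rewrite (noise_form_mgf model p01 z_unit ua) lee_fin ler_wpM2l// ler_expR ler_wpM2r ?invr_ge0//.
  apply: (le_trans (quad _)); apply: eq_le_imp; apply: eq_bigr => j _.
  by rewrite /g' /al'; case: (D j); rewrite ?mul1r// !mul0r expr0n mulr0.
- rewrite lee_fin ler_wpM2l// expR_sum [leRHS]big_mkcond ler_prod// => j _.
  rewrite invr_ge0 sqrtr_ge0 /=; have := inv_sqrt_le_expR (t01 j).
  by rewrite /al'; case: ifP => // _; rewrite mulr0 expr0n mulr0 addr0 mul0r expR0.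
Qed.

Variables (N eps : R).
Hypotheses (N0 : 0 < N) (eps01 : 0 < eps <= 1 / 100).
Hypothesis degree_close : forall j, `|degree a j - N| <= eps * N.

Let degree_le j : degree a j <= 2 * N.
Proof.
have := degree_close j; rewrite ler_norml => /andP[_]; have [h h'] := andP eps01.
have := N0; nra.
Qed.

Lemma local_degree_ge0 (x : 'I_n -> R) j : 0 <= local_degree a x j.
Proof. by apply: sumr_ge0 => k _; rewrite mulr_ge0 ?adj_ge0 ?sqr_ge0. Qed.

Let local_degree_le (x : 'I_n -> R) j : (forall k, x k ^+ 2 <= 1) -> local_degree a x j <= 2 * N.
Proof.
move=> x1; apply: le_trans (degree_le j); apply: ler_sum => k _.
by rewrite -[leRHS]mulr1 ler_wpM2l ?adj_ge0.
Qed.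

Let sum_local_degree (x : 'I_n -> R) : \sum_j local_degree a x j <= 2 * N * \sum_k x k ^+ 2.
Proof.
rewrite exchange_big mulr_sumr; apply: ler_sum => k _.
rewrite -mulr_suml ler_wpM2r ?sqr_ge0//; apply: le_trans (degree_le k); apply: eq_le_imp.
by apply: eq_bigr => j _; exact: adjC.
Qed.

(** Since la = 1 / (8 N) the exponents la a_j are at most 1/2, and they sum to at
    most |x|^2 / 2 by counting edges from the other side. *)
Lemma noise_form_mgf_le b (x : 'I_n -> R) : (forall k, x k ^+ 2 <= 1) ->
  (\int[P]_w (G w * expR ((8 * N)^-1 * \sum_j form b x j w ^+ 2))%:E <=
   (q * expR ((\sum_k x k ^+ 2) / 2))%:E)%E.
Proof.
move=> x1; have N' := N0.
have la0 : 0 <= (8 * N)^-1 by rewrite invr_ge0 mulr_ge0// ltW.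
have al0 j : 0 <= 2 * local_degree a x j by rewrite mulr_ge0// local_degree_ge0.
have al1 j : (8 * N)^-1 * (2 * local_degree a x j) <= 1 / 2.
  rewrite mulrC ler_pdivrMr ?mulr_gt0//; have := local_degree_le j x1; lra.
have := @noise_square_mgf_le predT b x _ _ la0 al0 al1 (sum_sym_coef_le a b x).
move=> /le_trans; apply; rewrite lee_fin ler_wpM2l// ler_expR.
apply: (@le_trans _ _ (\sum_j (8 * N)^-1 * (2 * local_degree a x j))).
  apply: ler_sum => j _; have := al1 j.
  have : 0 <= (8 * N)^-1 * (2 * local_degree a x j) by apply: mulr_ge0.
  move: (_ * (2 * _)) => t; nra.
rewrite -mulr_sumr -mulr_sumr mulrC ler_pdivrMr ?mulr_gt0//.
by have := sum_local_degree x; lra.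
Qed.

Lemma noise_form1_mgf_le j :
  (\int[P]_w (G w * expR ((8 * N)^-1 * form true (fun=> 1) j w ^+ 2))%:E <= (q * 2)%:E)%E.
Proof.
have x1 (k : 'I_n) : (1 : R) ^+ 2 <= 1 by rewrite expr1n.
have la0 : 0 <= (8 * N)^-1 by rewrite invr_ge0 mulr_ge0// ltW.
have al0 i : 0 <= 2 * local_degree a (fun=> 1 : R) i by apply: mulr_ge0 => //; exact: local_degree_ge0.
have al1 i : (8 * N)^-1 * (2 * local_degree a (fun=> 1 : R) i) <= 1 / 2.
  have N' := N0; rewrite mulrC ler_pdivrMr ?mulr_gt0//.
  have := @local_degree_le (fun=> 1) i x1; clear x1; lra.
clear x1; have := @noise_square_mgf_le (pred1 j) true _ _ _ la0 al0 al1 (sum_sym_coef_le a true _).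
rewrite big_pred1_eq; under eq_integral do rewrite big_pred1_eq.
move=> /le_trans; apply; rewrite lee_fin ler_wpM2l//.
apply: (@le_trans _ _ (expR (1 / 2))); last by have := @expR_le_quadratic R (1 / 2); lra.
rewrite ler_expR; have := al1 j.
have : 0 <= (8 * N)^-1 * (2 * local_degree a (fun=> 1 : R) j) by apply: mulr_ge0.
move: (_ * (2 * _)) => t; nra.
Qed.

Hypothesis p_ge0 : 0 <= p.
Hypothesis adj_close : forall x : 'I_n -> R,
  \sum_j (\sum_k (adj a j k - p) * x k) ^+ 2 <= (eps * N) ^+ 2 * \sum_k x k ^+ 2.

(** The Laplacian is D - A, where D <= (1 + eps) N and - A <= - p J + eps N. The term
    - p J has the good sign. *)
Lemma im_noise_quad_le g :
  \sum_(e : @upper_pair n) sym_coef a false (fun=> 1) g e ^+ 2 <=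
  \sum_j (1 + 2 * eps) * N * g j ^+ 2.
Proof.
rewrite sum_sym_coef_diff.
have epsN : 0 < eps * N by have /andP[h _] := eps01; rewrite mulr_gt0.
have eN0 : N != 0 by rewrite gt_eqF.
have eps0 : eps != 0 by rewrite gt_eqF//; have /andP[] := eps01.
have h1 : \sum_j degree a j * g j ^+ 2 <= (1 + eps) * N * \sum_j g j ^+ 2.
  rewrite mulr_sumr; apply: ler_sum => j _; rewrite ler_wpM2r ?sqr_ge0//.
  by have := degree_close j; rewrite ler_norml => /andP[_]; lra.
have h2 : - \sum_j \sum_k adj a j k * (g j * g k) <= eps * N * \sum_j g j ^+ 2.
  pose y j := \sum_k (adj a j k - p) * g k.
  have -> : \sum_j \sum_k adj a j k * (g j * g k) = \sum_j g j * y j + p * (\sum_j g j) ^+ 2.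
    rewrite expr2 mulr_suml mulr_sumr -big_split; apply: eq_bigr => j _ /=.
    rewrite !mulr_sumr -big_split; apply: eq_bigr => k _ /=; ring.
  have : 0 <= p * (\sum_j g j) ^+ 2 by rewrite mulr_ge0// sqr_ge0.
  have : - \sum_j g j * y j <= \sum_j (eps * N / 2 * g j ^+ 2 + (2 * (eps * N))^-1 * y j ^+ 2).
    rewrite -sumrN; apply: ler_sum => j _.
    have : 0 <= (2 * (eps * N))^-1 * (eps * N * g j + y j) ^+ 2.
      by rewrite mulr_ge0 ?sqr_ge0// invr_ge0 mulr_ge0// ltW.
    rewrite [X in 0 <= X -> _](_ : _ = eps * N / 2 * g j ^+ 2 + (2 * (eps * N))^-1 * y j ^+ 2 + g j * y j); last first.
      by field; rewrite ?eN0 ?eps0.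
    lra.
  rewrite big_split /= -!mulr_sumr => h.
  have : (2 * (eps * N))^-1 * \sum_j y j ^+ 2 <= (2 * (eps * N))^-1 * ((eps * N) ^+ 2 * \sum_k g k ^+ 2).
    by rewrite ler_wpM2l ?adj_close// invr_ge0 mulr_ge0// ltW.
  rewrite [X in _ <= X -> _](_ : _ = eps * N / 2 * \sum_k g k ^+ 2); last first.
    by field; rewrite ?eN0 ?eps0.
  move: h; lra.
rewrite -mulr_sumr; lra.
Qed.

Lemma im_noise_mgf_le :
  (\int[P]_w (G w * expR (eps / 4 / N * \sum_j form false (fun=> 1) j w ^+ 2))%:E <=
   (q * expR (eps / 4 * (1 + 4 * eps) / 2 * n%:R - eps ^+ 2 / 8 * n%:R))%:E)%E.
Proof.
have [e0 e1] := andP eps01.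
have la0 : 0 <= eps / 4 / N by rewrite divr_ge0 ?divr_ge0// ltW.
have al0 : 0 <= (1 + 2 * eps) * N by rewrite mulr_ge0 ?(ltW N0)//; lra.
have laE : eps / 4 / N * ((1 + 2 * eps) * N) = eps / 4 * (1 + 2 * eps).
  by field; rewrite gt_eqF.
have al1 : eps / 4 / N * ((1 + 2 * eps) * N) <= 1 / 2 by rewrite laE; nra.
have := @noise_square_mgf_le predT false _ (fun=> (1 + 2 * eps) * N) _ la0 (fun=> al0) (fun=> al1) im_noise_quad_le.
move=> /le_trans; apply; rewrite lee_fin ler_wpM2l// ler_expR laE.
rewrite sumr_const card_ord -[leLHS]mulr_natr -mulrBl ler_wpM2r//; nra.
Qed.

End NoiseTails.

(** * Union bounds for the noise *)

Section TernaryVectors.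
Context {R : realType} {n : nat}.
Implicit Types (y : {ffun 'I_n -> option bool}).

(** The sum factorizes over the coordinates, each of which has one zero and two
    nonzero values. *)
Lemma sum_expR_supp (ka : R) :
  \sum_(y : {ffun 'I_n -> option bool}) expR (- (ka * (supp_size y)%:R)) <= expR (2 * expR (- ka) * n%:R).
Proof.
pose F (o : option bool) : R := if o is None then 1 else expR (- ka).
rewrite (eq_bigr (fun y : {ffun 'I_n -> option bool} => \prod_k F (y k))); last first.
  move=> y _; rewrite (_ : (supp_size y)%:R = \sum_k (y k != None)%:R :> R); last first.
    by rewrite /supp_size -sum1_card natr_sum big_mkcond /=; apply: eq_bigr => k _; rewrite inE; case: ifP.
  rewrite mulr_sumr -sumrN expR_sum; apply: eq_bigr => k _; rewrite /F.
  by case: (y k) => [c|] /=; rewrite ?mulr1// mulr0 oppr0 expR0.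
rewrite -(bigA_distr_bigA (fun _ : 'I_n => F)) prodr_const card_ord mulrC expRM_natl.
rewrite lerXn2r ?nnegrE ?expR_ge0//; first by rewrite sumr_ge0// => o _; rewrite /F; case: o => // _; exact: expR_ge0.
rewrite (bigD1 None)//= (bigD1 (Some true))//= (bigD1 (Some false))//= big1 ?addr0 => [|[[]|]]//.
have := expR_ge1Dx (2 * expR (- ka) : R); lra.
Qed.

(** The number of vectors with at most theta n nonzero entries is bounded by an
    exponential Markov inequality, with parameter ka. *)
Lemma sum_sparse_le (ka theta tau : R) : 0 <= ka ->
  ka * theta + 2 * expR (- ka) + theta / 2 <= tau / 32 ->
  \sum_(y : {ffun 'I_n -> option bool} | (supp_size y)%:R <= theta * n%:R)
    expR ((supp_size y)%:R / 2 - tau / 16 * n%:R) <= expR (- (tau / 32) * n%:R).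
Proof.
move=> ka0 H; apply: (@le_trans _ _ (\sum_(y : {ffun 'I_n -> option bool}) expR ((ka * theta + theta / 2 - tau / 16) * n%:R) *
    expR (- (ka * (supp_size y)%:R)))).
  rewrite [leRHS](bigID (fun y => (supp_size y)%:R <= theta * n%:R)) /= ler_wpDr//.
    by apply: sumr_ge0 => y _; rewrite mulr_ge0 ?expR_ge0.
  apply: ler_sum => y sy; rewrite -expRD ler_expR.
  have : ka * (supp_size y)%:R <= ka * (theta * n%:R) by rewrite ler_wpM2l.
  lra.
rewrite -mulr_sumr; apply: (@le_trans _ _ (expR ((ka * theta + theta / 2 - tau / 16) * n%:R) *
    expR (2 * expR (- ka) * n%:R))); first by rewrite ler_wpM2l ?expR_ge0 ?sum_expR_supp.
rewrite -expRD ler_expR -mulrDl ler_wpM2r//; lra.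
Qed.

Lemma supp_size_le y : (supp_size y <= n)%N.
Proof. by rewrite -[leqRHS](card_ord n) max_card. Qed.

Lemma sum_all_le : \sum_(y : {ffun 'I_n -> option bool}) expR ((supp_size y)%:R / 2 - 4 * n%:R) <= expR (- n%:R) :> R.
Proof.
apply: (@le_trans _ _ (\sum_(y : {ffun 'I_n -> option bool}) expR (- 3 * n%:R) * expR (- (0 * (supp_size y)%:R)))).
  apply: ler_sum => y _; rewrite -expRD ler_expR.
  have : (supp_size y)%:R <= n%:R :> R by rewrite ler_nat supp_size_le.
  have : (0 : R) <= n%:R by [].
  lra.
have := sum_expR_supp (0 : R); rewrite oppr0 expR0 mulr1 => h.
rewrite -mulr_sumr; apply: (@le_trans _ _ (expR (- 3 * n%:R) * expR (2 * n%:R))).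
  by rewrite ler_wpM2l ?expR_ge0.
by rewrite -expRD ler_expR; lra.
Qed.

Lemma tval_sqr (o : option bool) : (tval o : R) ^+ 2 = (o != None)%:R.
Proof. by case: o => [[]|] /=; rewrite ?expr0n//= ?sqrrN expr1n. Qed.

Lemma sum_tval_sqr y : \sum_k (tval (y k) : R) ^+ 2 = (supp_size y)%:R.
Proof.
rewrite /supp_size -sum1_card natr_sum [RHS]big_mkcond /=; apply: eq_bigr => k _.
by rewrite tval_sqr inE; case: ifP.
Qed.

End TernaryVectors.

Section NoiseCost.
Context {d : measure_display} {T : measurableType d} {R : realType}.
Context {P : probability T R} {n : nat}.
Variables (A : 'I_n -> 'I_n -> {RV P >-> bool}).
Variables (ReW ImW : 'I_n -> 'I_n -> {RV P >-> R}) (p : R) (z : 'I_n -> R[i]).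
Variable a : {ffun 'I_n * 'I_n -> bool}.
Variables (N sg eps tau theta ka : R).
Hypothesis n0 : (0 < n)%N.
Hypotheses (N0 : 0 < N) (sg0 : 0 < sg) (eps01 : 0 < eps <= 1 / 100).
Let om := N / sg ^+ 2.

Let form := noise_form ReW ImW z a.
Let square b (x : 'I_n -> R) w := \sum_j form b x j w ^+ 2.

(** Each term is an exponential that exceeds 1 as soon as one of the required bounds
    fails: the sparse bound, the global one, the bound for the imaginary parts, and
    the count of large real parts. *)
Definition noise_cost (w : T) : R :=
  \sum_(b : bool) \sum_(y : {ffun 'I_n -> option bool} | (supp_size y)%:R <= theta * n%:R)
    expR ((8 * N)^-1 * square b (fun k => tval (y k)) w - tau / 16 * n%:R) +
  \sum_(b : bool) \sum_(y : {ffun 'I_n -> option bool})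
    expR ((8 * N)^-1 * square b (fun k => tval (y k)) w - 4 * n%:R) +
  expR (eps / 4 / N * square false (fun=> 1) w - eps / 4 * (1 + 4 * eps) / 2 * n%:R) +
  om / (eps * n%:R) *
    \sum_j expR ((8 * N)^-1 * form true (fun=> 1) j w ^+ 2 - eps ^+ 2 / 8 * om).

(** The bound for the mean of [noise_cost] given the graph. *)
Definition noise_risk : R :=
  2 * expR (- (tau / 32) * n%:R) + 2 * expR (- n%:R) + expR (- (eps ^+ 2 / 8) * n%:R) +
  2 * (om / eps) * expR (- (eps ^+ 2 / 8) * om).

Let T_ := masked_noise ReW ImW z a.

Let om0 : 0 < om. Proof. by rewrite divr_gt0 ?exprn_gt0. Qed.
Let nn0 : 0 < n%:R :> R. Proof. by rewrite ltr0n. Qed.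
Let eps0 : 0 < eps. Proof. by case/andP: eps01. Qed.

Let sqnE (x : 'I_n -> R) w j :
  sqn (\sum_k T_ w j k * (x k)%:C%C) = form true x j w ^+ 2 + form false x j w ^+ 2.
Proof. by []. Qed.

Let square_le b x c w : expR ((8 * N)^-1 * square b x w - c / 16 * n%:R) < 1 ->
  square b x w <= c * (n%:R * N) / 2.
Proof.
rewrite expR_lt1 subr_lt0 mulrC ltr_pdivrMr ?mulr_gt0// => h; apply: ltW; move: h.
by rewrite (_ : c / 16 * n%:R * (8 * N) = c * (n%:R * N) / 2)//; field.
Qed.

Lemma noise_events w : noise_cost w < 1 ->
  [/\ forall y : {ffun 'I_n -> option bool},
        \sum_j sqn (\sum_k T_ w j k * (tval (y k))%:C%C) <= 64 * (n%:R * N),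
      forall y : {ffun 'I_n -> option bool}, (supp_size y)%:R <= theta * n%:R ->
        \sum_j sqn (\sum_k T_ w j k * (tval (y k))%:C%C) <= tau * (n%:R * N),
      \sum_j complex.Im (\sum_k T_ w j k) ^+ 2 <= (1 + 4 * eps) * (n%:R * N / 2) &
      \sum_j (~~ (`|sg * complex.Re (\sum_k T_ w j k)| <= eps * N))%:R <= eps * n%:R / om].
Proof.
rewrite /noise_cost; set s1 := \sum_b \sum_(y | _) _; set s2 := \sum_b \sum_y _.
set s3 := expR _; set s4 := _ * \sum_j _ => lt1.
have s1_ge0 : 0 <= s1 by do 2 apply: sumr_ge0 => ? _; exact: expR_ge0.
have s2_ge0 : 0 <= s2 by do 2 apply: sumr_ge0 => ? _; exact: expR_ge0.
have s3_ge0 : 0 <= s3 by exact: expR_ge0.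
have s4_ge0 : 0 <= s4.
  apply: mulr_ge0; last by apply: sumr_ge0 => ? _; exact: expR_ge0.
  by apply: divr_ge0; [exact: ltW|apply: mulr_ge0; exact: ltW].
have term_le (D : pred {ffun 'I_n -> option bool}) c b y : D y ->
    expR ((8 * N)^-1 * square b (fun k => tval (y k)) w - c * n%:R) <=
    \sum_(b : bool) \sum_(y | D y) expR ((8 * N)^-1 * square b (fun k => tval (y k)) w - c * n%:R).
  move=> Dy; rewrite (bigD1 b)//= (bigD1 y)//= -addrA lerDl addr_ge0//.
    by apply: sumr_ge0 => ? _; exact: expR_ge0.
  by do 2 apply: sumr_ge0 => ? _; exact: expR_ge0.
have one j : \sum_k T_ w j k = \sum_k T_ w j k * (1 : R)%:C%C.
  by apply: eq_bigr => k _; rewrite mulr1.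
split.
- move=> y; under eq_bigr do rewrite sqnE; rewrite big_split /=.
  have h b : square b (fun k => tval (y k)) w <= 64 * (n%:R * N) / 2.
    apply: square_le; rewrite (_ : 64 / 16 = 4 :> R); last by field.
    apply: (@le_lt_trans _ _ s2); first exact: (term_le predT).
    lra.
  by have := h true; have := h false; rewrite /square; lra.
- move=> y sy; under eq_bigr do rewrite sqnE; rewrite big_split /=.
  have h b : square b (fun k => tval (y k)) w <= tau * (n%:R * N) / 2.
    apply: square_le; apply: (@le_lt_trans _ _ s1); last lra.
    exact: (term_le (fun y => (supp_size y)%:R <= theta * n%:R)).
  by have := h true; have := h false; rewrite /square; lra.
- have : s3 < 1 by lra.
  rewrite /s3 expR_lt1 subr_lt0 => H.
  rewrite (_ : \sum_j _ = square false (fun=> 1) w); last first.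
    by apply: eq_bigr => j _; rewrite one.
  have : eps / 4 / N * square false (fun=> 1) w <= eps / 4 / N * ((1 + 4 * eps) * (n%:R * N / 2)).
    by apply: le_trans (ltW H) _; apply: eq_le_imp; field; rewrite gt_eqF.
  by rewrite ler_pM2l// divr_gt0// divr_gt0.
- have : s4 < 1 by lra.
  rewrite /s4 mulrC -[om / _]invf_div ltr_pdivrMr ?divr_gt0 ?mulr_gt0// mul1r => /ltW.
  apply: le_trans; apply: ler_sum => j _; rewrite one -[complex.Re _]/(form true (fun=> 1) j w).
  case: (leP (`|sg * form true (fun=> 1) j w|) (eps * N)) => h /=; first exact: expR_ge0.
  rewrite -[leLHS]expR0 ler_expR subr_ge0.
  have : (eps * N) ^+ 2 <= (sg * form true (fun=> 1) j w) ^+ 2.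
    by rewrite -[leRHS]real_normK ?num_real// lerXn2r ?nnegrE ?(ltW h)// ltW// mulr_gt0.
  rewrite !exprMn -ler_pdivrMl ?exprn_gt0// => h2.
  apply: le_trans (_ : _ <= (8 * N)^-1 * _) _; last first.
    by apply: ler_wpM2l; [rewrite invr_ge0 mulr_ge0// ltW|exact: h2].
  by apply: eq_le_imp; rewrite /om; field; rewrite !gt_eqF.
Qed.

Hypothesis model : sync_model A ReW ImW p.
Hypothesis p01 : 0 <= p <= 1.
Hypothesis z_unit : forall j, sqn (z j) = 1.
Hypothesis ua : upper_graph a.
Hypothesis degree_close : forall j, `|degree a j - N| <= eps * N.
Hypothesis adj_close : forall x : 'I_n -> R,
  \sum_j (\sum_k (adj a j k - p) * x k) ^+ 2 <= (eps * N) ^+ 2 * \sum_k x k ^+ 2.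
Hypothesis ka0 : 0 <= ka.
Hypothesis sparse : ka * theta + 2 * expR (- ka) + theta / 2 <= tau / 32.

Let G := graph_indicator (R := R) A a.
Let q := bern_weight (pair_prob p) a.

Let mean_le (F : T -> R) (c : R) : Prop :=
  [/\ measurable_fun [set: T] F, forall w, 0 <= F w &
      (\int[P]_w (G w * F w)%:E <= (q * c)%:E)%E].

Let mean_leD F F' c c' : mean_le F c -> mean_le F' c' -> mean_le (fun w => F w + F' w) (c + c').
Proof.
move=> [mF F0 Fc] [mF' F'0 Fc'].
have mG := measurable_graph_indicator A a : measurable_fun [set: T] G.
have G0 := graph_indicator_ge0 A a : forall w, 0 <= G w.
split; [exact: measurable_funD|by move=> w; exact: addr_ge0|].
under eq_integral do rewrite mulrDr EFinD.
rewrite ge0_integralD//.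
- by rewrite mulrDr EFinD leeD.
- by move=> w _; rewrite lee_fin mulr_ge0.
- by apply/measurable_EFinP; exact: measurable_funM.
- by move=> w _; rewrite lee_fin mulr_ge0.
- by apply/measurable_EFinP; exact: measurable_funM.
Qed.

Let mean_leZ F c k : 0 <= k -> mean_le F c -> mean_le (fun w => k * F w) (k * c).
Proof.
move=> k0 [mF F0 Fc].
have mG := measurable_graph_indicator A a : measurable_fun [set: T] G.
have G0 := graph_indicator_ge0 A a : forall w, 0 <= G w.
split; [exact: measurable_funM|by move=> w; exact: mulr_ge0|].
under eq_integral do rewrite mulrCA EFinM.
rewrite ge0_integralZl; [|by []|by apply/measurable_EFinP; exact: measurable_funM
  |by move=> w _; rewrite lee_fin mulr_ge0|by rewrite lee_fin].
by rewrite mulrCA EFinM lee_wpmul2l// lee_fin.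
Qed.

Let q0 : 0 <= q.
Proof. by apply: bern_weight_ge0 => e; rewrite /pair_prob; case: ifP => _; rewrite ?lexx ?ler01. Qed.

Let mean_le_sum (J : finType) (D : pred J) (F : J -> T -> R) (c : J -> R) :
  (forall j, D j -> mean_le (F j) (c j)) ->
  mean_le (fun w => \sum_(j | D j) F j w) (\sum_(j | D j) c j).
Proof.
move=> H; elim: (index_enum J) => [|j s IH].
  under eq_fun do rewrite big_nil; rewrite big_nil; split => //.
  by under eq_integral do rewrite mulr0; rewrite integral0 mulr0.
under eq_fun do rewrite big_cons; rewrite big_cons; case: ifP => // Dj.
exact: mean_leD (H j Dj) IH.
Qed.

Let mean_le_shift F c c' x :
  mean_le (fun w => expR (F w)) c -> expR (- x) * c <= c' -> mean_le (fun w => expR (F w - x)) c'.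
Proof.
move=> /(mean_leZ (expR_ge0 (- x))) H cc'.
have -> : (fun w => expR (F w - x)) = (fun w => expR (- x) * expR (F w)).
  by apply/funext => w; rewrite -expRD addrC.
have [m h0 h1] := H; split => //; apply: (le_trans h1).
by rewrite lee_fin ler_wpM2l.
Qed.

Let measurable_exp_square (la : R) b x : measurable_fun [set: T] (fun w => expR (la * square b x w)).
Proof.
apply: measurableT_comp => //; apply: measurable_funM => //.
by apply: measurable_fun_bigsum => j _; apply: measurable_funX; exact: measurable_noise_form.
Qed.

Let tval_le1 (y : {ffun 'I_n -> option bool}) k : (tval (y k) : R) ^+ 2 <= 1.
Proof. by rewrite tval_sqr; case: (_ != _). Qed.

Let mean_le_form b (y : {ffun 'I_n -> option bool}) :
  mean_le (fun w => expR ((8 * N)^-1 * square b (fun k => tval (y k)) w)) (expR ((supp_size y)%:R / 2)).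
Proof.
split; [exact: measurable_exp_square|by move=> w; exact: expR_ge0|].
by have := noise_form_mgf_le model p01 z_unit ua N0 eps01 degree_close b (tval_le1 y);
  rewrite sum_tval_sqr.
Qed.

(** Exponential moments beat the union bounds: at most 3^n sign vectors cost
    exp (2 n) against exp (- 4 n). *)
Lemma noise_cost_mean_le :
  [/\ measurable_fun [set: T] noise_cost, forall w, 0 <= noise_cost w &
    (\int[P]_w (G w * noise_cost w)%:E <= (q * noise_risk)%:E)%E].
Proof.
have h1 : mean_le (fun w => \sum_(b : bool) \sum_(y : {ffun 'I_n -> option bool} | (supp_size y)%:R <= theta * n%:R)
    expR ((8 * N)^-1 * square b (fun k => tval (y k)) w - tau / 16 * n%:R))
    (\sum_(b : bool) \sum_(y : {ffun 'I_n -> option bool} | (supp_size y)%:R <= theta * n%:R)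
    expR ((supp_size y)%:R / 2 - tau / 16 * n%:R)).
  apply: mean_le_sum => b _; apply: mean_le_sum => y _.
  by apply: mean_le_shift (mean_le_form b y) _; rewrite -expRD addrC.
have h2 : mean_le (fun w => \sum_(b : bool) \sum_(y : {ffun 'I_n -> option bool})
    expR ((8 * N)^-1 * square b (fun k => tval (y k)) w - 4 * n%:R))
    (\sum_(b : bool) \sum_(y : {ffun 'I_n -> option bool})
    expR ((supp_size y)%:R / 2 - 4 * n%:R)).
  apply: mean_le_sum => b _; apply: mean_le_sum => y _.
  by apply: mean_le_shift (mean_le_form b y) _; rewrite -expRD addrC.
have h3 : mean_le (fun w => expR (eps / 4 / N * square false (fun=> 1) w - eps / 4 * (1 + 4 * eps) / 2 * n%:R))
    (expR (- (eps ^+ 2 / 8) * n%:R)).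
  apply: (@mean_le_shift _ (expR (eps / 4 * (1 + 4 * eps) / 2 * n%:R - eps ^+ 2 / 8 * n%:R))).
    split; [exact: measurable_exp_square|by move=> w; exact: expR_ge0|].
    have /andP[p_ge0 _] := p01.
    by have := im_noise_mgf_le model p01 z_unit ua N0 eps01 degree_close p_ge0 adj_close.
  by rewrite -expRD ler_expR; lra.
have h4 : mean_le (fun w => om / (eps * n%:R) *
    \sum_j expR ((8 * N)^-1 * form true (fun=> 1) j w ^+ 2 - eps ^+ 2 / 8 * om))
    (om / (eps * n%:R) * \sum_(j : 'I_n) 2 * expR (- (eps ^+ 2 / 8) * om)).
  apply: mean_leZ.
    by apply: divr_ge0; [exact: ltW|apply: mulr_ge0; exact: ltW].
  apply: mean_le_sum => j _.
  apply: (@mean_le_shift _ 2); last by rewrite mulrC mulNr.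
  split; [|by move=> w; exact: expR_ge0|].
    apply: measurableT_comp => //; apply: measurable_funM => //; apply: measurable_funX.
    exact: measurable_noise_form.
  by have := noise_form1_mgf_le model p01 z_unit ua N0 eps01 degree_close j.
have [m c0 c1] := mean_leD (mean_leD (mean_leD h1 h2) h3) h4.
split; [exact: m|exact: c0|apply: (le_trans c1)].
rewrite lee_fin ler_wpM2l// /noise_risk !big_bool /= sumr_const card_ord.
have := sum_sparse_le ka0 sparse (n := n); have := @sum_all_le R n.
have -> : om / (eps * n%:R) * (2 * expR (- (eps ^+ 2 / 8) * om) *+ n) =
    2 * (om / eps) * expR (- (eps ^+ 2 / 8) * om).
  by rewrite -[_ *+ n]mulr_natr; field; rewrite !gt_eqF.
lra.
Qed.

End NoiseCost.

(** * The synchronization event *)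

Lemma probability_lt1_ge (R : realType) d (T : measurableType d) (P : probability T R)
    (f : T -> R) (c : R) :
  measurable_fun [set: T] f -> (forall w, 0 <= f w) ->
  (\int[P]_w (f w)%:E <= c%:E)%E ->
  measurable [set w | f w < 1] /\ ((1 - c)%:E <= P [set w | (f w < 1)%R])%E.
Proof.
move=> mf f0 fc; have mE : measurable [set w | f w < 1].
  rewrite [X in measurable X](_ : _ = [set: T] `&` f @^-1` `]-oo, 1[).
    by apply: mf => //; exact: measurable_itv.
  by apply/seteqP; split => w /=; rewrite in_itv /=; [move=> ->|case].
split => //; have mC := measurableC mE.
have : (P (~` [set w | (f w < 1)%R]) <= c%:E)%E.
  apply: le_trans fc; rewrite -(setIT (~` _)) -integral_indic//.
  apply: ge0_le_integral => //.
  - by apply/measurable_EFinP; exact: measurable_indic.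
  - exact/measurable_EFinP.
  - move=> w _; rewrite lee_fin indicE; case: (boolP (w \in _)) => [|_]; last exact: f0.
    by rewrite inE /= => /negP; rewrite -leNgt.
rewrite probability_setC// EFinB => H.
rewrite leeBlDr// -leeBlDl//.
by rewrite fin_num_measure.
Qed.

(** The centered matrix has zero diagonal, so it differs from A - p J by p times the
    identity, which is negligible. *)
Lemma adj_close_of_operator_norm (R : realType) (n : nat) (p c : R)
    (a : {ffun 'I_n * 'I_n -> bool}) : 0 <= p -> 0 <= c -> 2 * p <= c ->
  (forall v : 'cV[R]_n, sqnorm (centered_mx p a *m v) <= (c / 2) ^+ 2 * sqnorm v) ->
  forall x : 'I_n -> R,
    \sum_j (\sum_k (adj a j k - p) * x k) ^+ 2 <= c ^+ 2 * \sum_k x k ^+ 2.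
Proof.
move=> p0 c0 pc opn x; pose v : 'cV[R]_n := \col_k x k.
have vE : sqnorm v = \sum_k x k ^+ 2 by apply: eq_bigr => k _; rewrite mxE.
have split_row j : \sum_k (adj a j k - p) * x k = (centered_mx p a *m v) j 0 - p * x j.
  rewrite mxE (bigD1 j)//= [in RHS](bigD1 j)//= !mxE /centered_adj /adj eqxx mul0r !add0r mulNr addrC.
  congr (_ - _); apply: eq_bigr => k kj; by rewrite !mxE /centered_adj eq_sym (negPf kj).
under eq_bigr do rewrite split_row.
apply: (@le_trans _ _ (\sum_j (2 * (centered_mx p a *m v) j 0 ^+ 2 + 2 * p ^+ 2 * x j ^+ 2))).
  apply: ler_sum => j _; move: ((_ *m _) j 0) => s.
  by have := sqr_ge0 (s + p * x j); lra.
rewrite big_split /= -!mulr_sumr -/(sqnorm _).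
have := opn v; rewrite vE; set S := \sum_k _.
have S0 : 0 <= S by apply: sumr_ge0 => k _; exact: sqr_ge0.
have : p ^+ 2 * S <= (c / 2) ^+ 2 * S by rewrite ler_wpM2r// lerXn2r ?nnegrE ?divr_ge0//; lra.
lra.
Qed.

Lemma noise_risk_ge0 (R : realType) (n : nat) (N sg eps tau : R) :
  0 <= N -> 0 <= eps -> 0 <= noise_risk (n:=n) N sg eps tau.
Proof.
move=> N0 eps0; have om0 : 0 <= N / sg ^+ 2 by rewrite divr_ge0 ?sqr_ge0.
by rewrite !addr_ge0 ?expR_ge0// mulr_ge0 ?expR_ge0// mulr_ge0// divr_ge0.
Qed.

Section Synchronization.
Context {d : measure_display} {T : measurableType d} {R : realType}.
Context {P : probability T R} {n : nat}.
Variables (A : 'I_n.+1 -> 'I_n.+1 -> {RV P >-> bool}).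
Variables (ReW ImW : 'I_n.+1 -> 'I_n.+1 -> {RV P >-> R}) (p : R) (z : 'cV[R[i]]_n.+1).
Variables (sg eps tau theta epsA ka : R) (m : nat).
Let N := n.+1%:R * p.
Let om := N / sg ^+ 2.
Let t := (epsA * N / 2) ^+ 2.
Hypothesis model : sync_model A ReW ImW p.
Hypotheses (p01 : 0 < p <= 1) (sg0 : 0 < sg) (eps01 : 0 < eps <= 1 / 100).
Hypothesis z_unit : forall j, `|z j 0| = 1.
Hypotheses (tau0 : 0 < tau) (theta0 : 0 < theta) (theta1 : theta <= 1) (epsA0 : 0 < epsA).
Hypotheses (epsA1 : epsA <= eps ^+ 2) (epsA_theta : epsA <= theta * tau / 16).
Hypothesis tau_eps : 292 * 8 ^+ 6 * tau <= eps ^+ 4.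
Hypothesis ka0 : 0 <= ka.
Hypothesis sparse : ka * theta + 2 * expR (- ka) + theta / 2 <= tau / 32.
Hypothesis om_large : 128 * 8 ^+ 6 <= (theta * tau / 16) ^+ 2 * om.
Hypothesis n_large : 2 <= epsA * n.+1%:R.
Hypothesis m_small : (2 * 2 ^ m)%:R <= N.

(** The threshold on the norm is half of epsA N, which leaves room for the diagonal
    in [adj_close_of_operator_norm]. *)
Definition bad_graph (a : {ffun 'I_n.+1 * 'I_n.+1 -> bool}) : bool :=
  ~~ [forall j, `|degree a j - N| <= eps * N] ||
  `[< exists v : 'cV[R]_n.+1, t * sqnorm v < sqnorm (centered_mx p a *m v) >].

Definition graph_risk : R :=
  n.+1%:R * (3 * expR (- (eps ^+ 2 / 8 * N))) +
  n.+1%:R * (8 * (2 ^ m)%:R * N / t) ^+ (2 ^ m).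

Let cost (a : {ffun 'I_n.+1 * 'I_n.+1 -> bool}) (w : T) : R :=
  if bad_graph a then 1
  else noise_cost ReW ImW (fun j => z j 0) a N sg eps tau theta w.

Let total (w : T) : R := \sum_(a | upper_graph a) graph_indicator A a w * cost a w.

Let risk : R := graph_risk + noise_risk (n:=n.+1) N sg eps tau.

Let p_gt0 : 0 < p. Proof. by case/andP: p01. Qed.
Let p_01 : 0 <= p <= 1. Proof. by case/andP: p01 => h ->; rewrite ltW. Qed.
Let N0 : 0 < N. Proof. by rewrite mulr_gt0. Qed.
Let epsN0 : 0 < eps * N. Proof. by have /andP[h _] := eps01; rewrite mulr_gt0. Qed.
Let t0 : 0 < t. Proof. by rewrite exprn_gt0// divr_gt0// mulr_gt0. Qed.
Let zz j : sqn (z j 0) = 1. Proof. by exact: sqn_unit (z_unit j). Qed.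

Lemma bad_graph_prob_le :
  bern_mean (pair_prob p) (fun a => (bad_graph a)%:R) <= graph_risk.
Proof.
have pp := pair_prob01 p_01.
apply: (@le_trans _ _ (bern_mean (pair_prob p) (fun a =>
   \sum_j (~~ (`|degree a j - N| <= eps * N))%:R +
   (`[< exists v : 'cV[R]_n.+1, t * sqnorm v < sqnorm (centered_mx p a *m v) >])%:R))).
  apply: bern_mean_le => // a; rewrite /bad_graph; case: forallP => [_|] /=.
    by rewrite lerDr sumr_ge0.
  move=> /forallP; rewrite negb_forall => /existsP[j nj].
  rewrite (bigD1 j)//= nj -addrA lerDl addr_ge0//; exact: sumr_ge0.
rewrite bern_meanD bern_mean_sum /graph_risk lerD//.
  have /andP[e0 e1] := eps01.
  apply: (@le_trans _ _ (\sum_(j < n.+1) 3 * expR (- (eps ^+ 2 / 8 * N)))).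
    by apply: ler_sum => j _; apply: degree_prob_le => //; rewrite e0 /=; lra.
  by rewrite sumr_const card_ord -[leLHS]mulr_natl.
exact: operator_norm_prob_le.
Qed.

Let good_graph a : ~~ bad_graph a ->
  (forall j, `|degree a j - N| <= eps * N) /\
  forall x : 'I_n.+1 -> R,
    \sum_j (\sum_k (adj a j k - p) * x k) ^+ 2 <= (epsA * N) ^+ 2 * \sum_k x k ^+ 2.
Proof.
rewrite /bad_graph negb_or negbK => /andP[/forallP h1 /asboolPn h2]; split => //.
apply: adj_close_of_operator_norm.
- exact: ltW.
- by rewrite mulr_ge0// ltW.
- have : 2 * p <= epsA * n.+1%:R * p by rewrite ler_pM2r.
  by rewrite /N mulrA.
- by move=> v; rewrite leNgt; apply/negP => h; apply: h2; exists v.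
Qed.

Let adj_close_eps a : ~~ bad_graph a -> forall x : 'I_n.+1 -> R,
  \sum_j (\sum_k (adj a j k - p) * x k) ^+ 2 <= (eps * N) ^+ 2 * \sum_k x k ^+ 2.
Proof.
move=> /good_graph[_ h] x; apply: (le_trans (h x)); rewrite ler_wpM2r//.
  by apply: sumr_ge0 => k _; exact: sqr_ge0.
have /andP[e0 e1] := eps01.
rewrite lerXn2r ?nnegrE ?(ltW epsN0)//; first by rewrite mulr_ge0// ltW.
by rewrite ler_pM2r//; apply: (le_trans epsA1); nra.
Qed.

Let risk_ge0 : 0 <= noise_risk (n:=n.+1) N sg eps tau.
Proof. by apply: noise_risk_ge0; [exact: ltW|case/andP: eps01 => /ltW]. Qed.

Let cost_ok a : upper_graph a ->
  [/\ measurable_fun [set: T] (cost a), forall w, 0 <= cost a w &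
   (\int[P]_w (graph_indicator A a w * cost a w)%:E <=
    (bern_weight (pair_prob p) a * ((bad_graph a)%:R + noise_risk (n:=n.+1) N sg eps tau))%:E)%E].
Proof.
move=> ua; rewrite /cost; case: (boolP (bad_graph a)) => ba.
  split => //; under eq_integral do rewrite mulr1.
  have := @model_mgf _ _ _ _ _ A ReW ImW p model p_01 a (fun=> 0) (fun=> 0) ua.
  rewrite (_ : (fun w => _) = fun w => (graph_indicator A a w)%:E); last first.
    by apply/funext => w; rewrite big1 ?expR0 ?mulr1// => e _; rewrite !mul0r addr0.
  move=> ->; rewrite [X in expR (X / 4)]big1 => [|e _]; last by rewrite expr0n addr0.
  rewrite mul0r expR0 mulr1 lee_fin ler_peMr ?bern_weight_ge0//; first exact: pair_prob01.
  by rewrite lerDl.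
have [deg _] := good_graph ba.
have := @noise_cost_mean_le d T R P n.+1 A ReW ImW p (fun j => z j 0) a N sg eps tau theta ka
  isT N0 sg0 eps01 model p_01 zz ua deg (adj_close_eps ba) ka0 sparse.
by move=> [h1 h2 h3]; split => //; rewrite add0r.
Qed.

Let total_le : [/\ measurable_fun [set: T] total, forall w, 0 <= total w &
  (\int[P]_w (total w)%:E <= risk%:E)%E].
Proof.
have mt a : upper_graph a -> measurable_fun [set: T] (fun w => graph_indicator A a w * cost a w).
  by move=> ua; have [h _ _] := cost_ok ua; apply: measurable_funM => //; exact: measurable_graph_indicator.
have t_ge0 a w : upper_graph a -> 0 <= graph_indicator A a w * cost a w.
  by move=> ua; have [_ h _] := cost_ok ua; rewrite mulr_ge0// graph_indicator_ge0.
split.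
- exact: measurable_fun_bigsum.
- by move=> w; apply: sumr_ge0 => a; exact: t_ge0.
- apply: (@le_trans _ _ (\sum_(a | upper_graph a)
      (bern_weight (pair_prob p) a * ((bad_graph a)%:R + noise_risk (n:=n.+1) N sg eps tau))%:E)%E); last first.
    rewrite sumEFin lee_fin.
    apply: (@le_trans _ _ (bern_mean (pair_prob p) (fun a => (bad_graph a)%:R + noise_risk (n:=n.+1) N sg eps tau))).
      rewrite /bern_mean [leRHS](bigID upper_graph) /= lerDl; apply: sumr_ge0 => a _.
      by apply: mulr_ge0; [apply: bern_weight_ge0; exact: pair_prob01|apply: addr_ge0].
    have E : bern_mean (@pair_prob R n.+1 p) (fun=> noise_risk (n:=n.+1) N sg eps tau) = noise_risk (n:=n.+1) N sg eps tau.
      transitivity (noise_risk (n:=n.+1) N sg eps tau * bern_mean (@pair_prob R n.+1 p) (fun=> 1)).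
        by rewrite -bern_meanZ; apply: eq_bigr => a _; rewrite mulr1.
      by rewrite bern_mean1 mulr1.
    rewrite bern_meanD E.
    by rewrite lerD2r bad_graph_prob_le.
  pose f a w : \bar R := if upper_graph a then (graph_indicator A a w * cost a w)%:E else 0%E.
  rewrite (_ : (\int[P]_w (total w)%:E)%E = (\int[P]_w \sum_a f a w)%E); last first.
    by apply: eq_integral => w _; rewrite /total -sumEFin big_mkcond.
  rewrite ge0_integral_sum//; rewrite /f.
  + rewrite [X in (_ <= X)%E]big_mkcond; apply: lee_sum => a _; case: ifP => ua; last by rewrite integral0.
    by have [_ _] := cost_ok ua.
  + by move=> a; case ua: (upper_graph a) => //; apply/measurable_EFinP; exact: mt.
  + by move=> a w _; case: ifP => // ua; rewrite lee_fin t_ge0.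
Qed.

(** Take the sum, over all graphs a, of the indicator of a times the cost of the noise
    given a, where a bad graph has cost 1. Its mean is at most the total risk; where
    it is smaller than 1, the graph is good and all noise bounds hold. *)
Lemma sync_event : exists E : set T, [/\ measurable E, ((1 - risk)%:E <= P E)%E &
  forall w, E w -> forall Z u,
    sdp_maximizer (observed_mx A ReW ImW sg z w) Z -> leading_eigenvector Z u ->
    (n.+1%:R ^+ 2)^-1 * frobenius_norm (Z - z *m z ^t*) ^+ 2 <=
      (1 + 40 * eps) * (sg ^+ 2 / (n.+1%:R * p)) /\
    phase_loss (phases u) z <= (1 + 40 * eps) * (sg ^+ 2 / (2 * n.+1%:R * p))].
Proof.
have [mt t_ge0 tr] := total_le.
have [mE PE] := probability_lt1_ge mt t_ge0 tr.
exists [set w | total w < 1]; split => // w /= lt1 Z u Zmax ulead.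
(* The observed graph. *)
pose a : {ffun 'I_n.+1 * 'I_n.+1 -> bool} := [ffun e : 'I_n.+1 * 'I_n.+1 => (e.1 < e.2)%N && A e.1 e.2 w].
have ua : upper_graph a.
  by apply/forallP => e; rewrite ffunE; apply/implyP => /andP[].
have Ga : graph_indicator A a w = 1 :> R.
  by rewrite /graph_indicator big1// => e _; rewrite ffunE (valP e) eqxx.
have cost_lt1 : cost a w < 1.
  apply: le_lt_trans lt1; rewrite /total (bigD1 a)//= Ga mul1r lerDl.
  apply: sumr_ge0 => a' /andP[ua' _]; have [_ h _] := cost_ok ua'.
  by rewrite mulr_ge0 ?graph_indicator_ge0.
have ba : ~~ bad_graph a by move: cost_lt1; rewrite /cost; case: ifP; rewrite ?ltxx.
move: cost_lt1; rewrite /cost (negPf ba) => /(noise_events (isT : (0 < n.+1)%N) N0 sg0 eps01).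
move=> [T_all T_sparse T_im T_re].
have [deg close] := good_graph ba.
apply: (@deterministic_bounds R n.+1 (adj a) (noise_mx ReW ImW w) z u Z sg p eps tau theta epsA) => //.
- exact: ltW.
- by move=> j k; exact: adjC.
- by move=> j; exact: adj_diag.
- move=> j k jk; rewrite !mxE; case: (ltngtP j k) => [_|_|/val_inj e]; rewrite ?conjcKK//.
  by rewrite e eqxx in jk.
- rewrite (_ : \matrix_(j, k) _ = observed_mx A ReW ImW sg z w)//.
  apply/matrixP => j k; rewrite !mxE big_ord1 !mxE; congr (_ * _).
  rewrite /adj /edge; case: (ltngtP j k) => [jk|kj|/val_inj ->]; rewrite ?eqxx//.
  + rewrite ffunE jk /= (_ : (j == k) = false); last by apply/negbTE; rewrite neq_ltn jk.
    by case: (A j k w).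
  + rewrite ffunE kj /= (_ : (j == k) = false); last by apply/negbTE; rewrite neq_ltn kj orbT.
    by case: (A k j w) => /=; apply: complex_inj; rewrite /= ?oppr0.
Qed.

End Synchronization.

(** * The size of the failure probability *)

Section Risk.
Context {R : realType}.

(** The moment method needs a power of two of the order of log n. *)
Lemma exists_power_two (x : R) : 1 <= x -> exists m, x <= (2 ^ m)%:R <= 2 * x.
Proof.
move=> x1; have x0 : 0 <= x by lra.
have : exists m, x <= (2 ^ m)%:R.
  exists (Num.bound x); apply: (le_trans (ltW (archi_boundP x0))).
  by rewrite ler_nat ltnW// ltn_expl.
move=> ex; case: (ex_minnP ex) => m xm min; exists m; rewrite xm /=.
case: m xm min => [|m] _ min; first by rewrite expn0; lra.
have : (2 ^ m)%:R < x by rewrite ltNge; apply/negP => /min; rewrite ltnn.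
by rewrite expnS natrM; lra.
Qed.

Lemma expR1_le4 : expR 1 <= 4 :> R.
Proof.
have h : expR (1 / 2) <= 2 :> R by have := @expR_le_quadratic R (1 / 2); lra.
have -> : 1 = 2%:R * (1 / 2) :> R by field.
rewrite expRM_natl; apply: (@le_trans _ _ (2 ^+ 2)); last by rewrite expr2; lra.
by rewrite lerXn2r ?nnegrE ?expR_ge0.
Qed.

(** The only term of the risk that is governed by om alone. The expected proportion of
    large real parts is exponentially small in om, and comparing it with eps / om
    costs a factor om / eps; the power 1/4 leaves ample room for both. *)
Lemma noise_ratio_risk_le (eps om : R) : 0 < eps <= 1 / 100 ->
  (8 * (2 / eps + 5) / eps ^+ 2) ^+ 4 <= om ->
  2 * (om / eps) * expR (- (eps ^+ 2 / 8) * om) <= expR (- (om `^ 4^-1)).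
Proof.
move=> /andP[e0 e1]; set s0 := _ / _ => som.
have s0_ge0 : 0 <= s0 by rewrite /s0 divr_ge0 ?sqr_ge0// mulr_ge0// addr_ge0// divr_ge0// ltW.
have om0 : 0 <= om by apply: le_trans som; exact: exprn_ge0.
set s := om `^ _; have s_ge0 : 0 <= s by exact: powR_ge0.
have s4 : s ^+ 4 = om by rewrite -powR_mulrn// -powRrM mulVf// powRr1.
have ss : s0 <= s by rewrite -(ler_pXn2r (n := 4)) ?nnegrE// s4.
have s0e : eps ^+ 2 / 8 * s0 = 2 / eps + 5 by rewrite /s0; field; rewrite gt_eqF.
have s1 : 1 <= s.
  apply: le_trans ss; rewrite /s0 ler_pdivlMr ?exprn_gt0// mul1r.
  have : 0 <= 2 / eps by rewrite divr_ge0// ltW.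
  nra.
rewrite -s4; clear som om0 s4; clearbody s; clearbody s0.
have h1 : 2 / eps <= expR (2 / eps) by have := expR_ge1Dx (2 / eps); lra.
have h2 : s ^+ 4 <= expR (4%:R * s).
  by rewrite expRM_natl lerXn2r ?nnegrE ?expR_ge0//; have := expR_ge1Dx s; lra.
have -> : 2 * (s ^+ 4 / eps) = 2 / eps * s ^+ 4 by field; rewrite gt_eqF.
apply: (@le_trans _ _ (expR (2 / eps) * expR (4%:R * s) * expR (- (eps ^+ 2 / 8) * s ^+ 4))).
  by rewrite ler_wpM2r ?expR_ge0// ler_pM// ?exprn_ge0// divr_ge0// ltW.
rewrite -!expRD ler_expR.
have k0 : 0 <= eps ^+ 2 / 8 by rewrite divr_ge0// sqr_ge0.
have : eps ^+ 2 / 8 * s0 <= eps ^+ 2 / 8 * s by rewrite ler_wpM2l.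
rewrite s0e => h3.
have h4 : (2 / eps + 5) * s <= eps ^+ 2 / 8 * s * s by rewrite ler_wpM2r.
have h5 : eps ^+ 2 / 8 * s * s <= eps ^+ 2 / 8 * s ^+ 4.
  rewrite -mulrA ler_wpM2l//; rewrite (_ : s ^+ 4 = s * s * s ^+ 2); last by ring.
  by rewrite ler_peMr ?mulr_ge0// exprn_ege1.
have h6 : 2 / eps <= 2 / eps * s by rewrite ler_peMr// divr_ge0// ltW.
lra.
Qed.

(** With L = log n, every exponent is at least 11 L, so that each contribution of the
    graph is at most n^-10 up to a constant, and each of the other
    ones, except the last, at most n^-11 up to a constant. *)
Lemma risk_le (n m : nat) (p sg eps epsA tau K : R) :
  let n1 := n.+1%:R : R in let L := ln n1 in
  0 < p <= 1 -> 0 < sg -> 0 < eps <= 1 / 100 -> 0 < tau -> 0 < epsA ->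
  4 <= n1 -> K * L <= n1 * p -> 11 <= K -> 88 <= eps ^+ 2 * K -> 352 <= tau * K ->
  2816 <= epsA ^+ 2 * K ->
  11 * L <= (2 ^ m)%:R <= 22 * L ->
  (8 * (2 / eps + 5) / eps ^+ 2) ^+ 4 <= n1 * p / sg ^+ 2 ->
  graph_risk (n := n) p eps epsA m + noise_risk (n := n.+1) (n1 * p) sg eps tau <=
  n1 ^- 8 + expR (- ((n1 * p / sg ^+ 2) `^ 4^-1)).
Proof.
move=> n1 L /andP[p0 p1] sg0 eps01 tau0 epsA0 n4 KL K11 Keps Ktau KepsA /andP[m1 m2] om_large.
have [e0 e1] := andP eps01.
have n0 : 0 < n1 by lra.
have L1 : 1 <= L.
  rewrite -ler_expR /L lnK ?posrE//; apply: le_trans n4; exact: expR1_le4.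
pose v := n1 ^- 11.
have v0 : 0 < v by rewrite invr_gt0 exprn_gt0.
have vE : expR (- (11%:R * L)) = v by rewrite expRN expRM_natl /L lnK ?posrE.
have small x : 11 * L <= x -> expR (- x) <= v by move=> h; rewrite -vE ler_expR lerN2.
set N := n1 * p in KL om_large *.
have Nn : N <= n1 by rewrite /N ler_piMr// ltW.
have N0 : 0 < N by rewrite mulr_gt0.
have scaled (c : R) : 0 <= c -> 11 <= c * K -> 11 * L <= c * N.
  move=> c0 cK; apply: (@le_trans _ _ (c * (K * L))); last by rewrite ler_wpM2l.
  by rewrite mulrA ler_wpM2r//; lra.
have scaled' (c : R) : 0 <= c -> 11 <= c * K -> 11 * L <= c * n1.
  by move=> c0 cK; apply: le_trans (scaled _ c0 cK) _; rewrite ler_wpM2l.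
have eps2 : 0 <= eps ^+ 2 / 8 by rewrite divr_ge0// sqr_ge0.
have r1 : expR (- (eps ^+ 2 / 8 * N)) <= v by apply: small; apply: scaled => //; lra.
have r2 : expR (- (tau / 32) * n1) <= v.
  by rewrite mulNr; apply: small; apply: scaled'; lra.
have r3 : expR (- n1) <= v.
  by apply: small; have := @scaled' 1; rewrite !mul1r; apply => //; lra.
have r4 : expR (- (eps ^+ 2 / 8) * n1) <= v.
  by rewrite mulNr; apply: small; apply: scaled' => //; lra.
have r5 : (8 * (2 ^ m)%:R * N / (epsA * N / 2) ^+ 2) ^+ (2 ^ m) <= v.
  have q0 : 0 < (2 ^ m)%:R :> R by rewrite ltr0n expn_gt0.
  apply: (@le_trans _ _ (expR (- 1) ^+ (2 ^ m))); last first.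
    by rewrite -expRM_natl mulrN mulr1; exact: small.
  have base : 8 * (2 ^ m)%:R * N / (epsA * N / 2) ^+ 2 <= expR (- 1).
    apply: (@le_trans _ _ (1 / 4)); last first.
      by rewrite expRN mul1r lef_pV2 ?posrE ?expR_gt0// expR1_le4.
    rewrite ler_pdivrMr ?exprn_gt0// ?divr_gt0 ?mulr_gt0//.
    have : epsA ^+ 2 * (K * L) * N <= epsA ^+ 2 * N * N.
      by rewrite ler_wpM2r ?(ltW N0)// ler_wpM2l ?sqr_ge0.
    have : 2816 * L * N <= epsA ^+ 2 * K * L * N.
      rewrite ler_wpM2r ?(ltW N0)// ler_wpM2r//; lra.
    have : (2 ^ m)%:R * N <= 22 * L * N by rewrite ler_wpM2r ?(ltW N0).
    lra.
  rewrite lerXn2r ?nnegrE ?expR_ge0//.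
  by apply: divr_ge0; [apply: mulr_ge0; [exact: mulr_ge0|exact: ltW]|exact: sqr_ge0].
have r6 := noise_ratio_risk_le eps01 om_large.
have v8 : 9 * (n1 * v) <= n1 ^- 8.
  rewrite /v (_ : 9 * (n1 * n1 ^- 11) = 9 / n1 ^+ 2 * n1 ^- 8); last by field; rewrite gt_eqF.
  rewrite ler_piMl ?invr_ge0 ?exprn_ge0 ?(ltW n0)// ler_pdivrMr ?exprn_gt0//; nra.
rewrite /graph_risk /noise_risk -/n1 -/N.
have : n1 * (3 * expR (- (eps ^+ 2 / 8 * N))) <= n1 * (3 * v).
  by rewrite ler_wpM2l ?(ltW n0)// ler_wpM2l.
have : n1 * (8 * (2 ^ m)%:R * N / (epsA * N / 2) ^+ 2) ^+ (2 ^ m) <= n1 * v.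
  by rewrite ler_wpM2l ?(ltW n0).
have : v <= n1 * v by rewrite ler_peMl//; lra.
move: r2 r3 r4 r6 v8.
move: (expR (- (tau / 32) * n1)) (expR (- n1)) (expR (- (eps ^+ 2 / 8) * n1)) (_ * expR (_ * (N / _))) => e2 e3 e4 e6.
move: (expR (- _ `^ _)) (n1 * (3 * expR _)) (n1 * _ ^+ (2 ^ m)) (n1 ^- 8) => e7 e8 e9 e10.
have -> : n1 * (3 * v) = 3 * (n1 * v) by ring.
move: (n1 * v) => nv; lra.
Qed.

End Risk.

(** * Constants for a given accuracy *)

Lemma exists_large (R : realFieldType) (s : seq (R * R)) :
  all (fun bc => 0 < bc.2) s -> exists K : R, all (fun bc => bc.1 <= bc.2 * K) s.
Proof.
elim: s => [|[b c] s IH] /=; first by exists 0.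
move=> /andP[c0 /[dup] s0 /IH[K /allP HK]]; exists (Num.max K (b / c)).
rewrite -ler_pdivrMl// mulrC le_max lexx orbT /=; apply/allP => -[b' c'] ins.
apply: le_trans (HK _ ins) _; rewrite ler_wpM2l ?le_max ?lexx//.
exact: ltW (allP s0 _ ins).
Qed.

(** The constants are chosen in the order tau, ka, theta, epsA, each in terms of eps
    and of the previous ones only; K is then so large that the remaining
    hypotheses hold. *)
Lemma large_sync_event (R : realType) (eps : R) : 0 < eps <= 1 / 100 ->
  exists K : R, 0 < K /\
  forall (n : nat) d (T : measurableType d) (P : probability T R)
    (A : 'I_n -> 'I_n -> {RV P >-> bool}) (ReW ImW : 'I_n -> 'I_n -> {RV P >-> R})
    (p sg : R) (z : 'cV[R[i]]_n),
  (0 < n)%N -> K <= n%:R -> K * ln n%:R <= n%:R * p -> K <= n%:R * p / sg ^+ 2 ->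
  sync_model A ReW ImW p -> 0 < p <= 1 -> 0 < sg -> (forall j, `|z j 0| = 1) ->
  exists E : set T, [/\ measurable E,
    ((1 - n%:R ^- 8 - expR (- (n%:R * p / sg ^+ 2) `^ 4^-1))%:E <= P E)%E &
    forall w, E w -> forall Z u,
    sdp_maximizer (observed_mx A ReW ImW sg z w) Z -> leading_eigenvector Z u ->
    (n%:R ^+ 2)^-1 * frobenius_norm (Z - z *m z ^t*) ^+ 2 <=
      (1 + 40 * eps) * (sg ^+ 2 / (n%:R * p)) /\
    phase_loss (phases u) z <= (1 + 40 * eps) * (sg ^+ 2 / (2 * n%:R * p))].
Proof.
move=> eps01; have [e0 e1] := andP eps01.
have [c8 [c8E c8_1]] : exists c, c = 8 ^+ 6 /\ 1 <= c :> R.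
  by exists (8 ^+ 6); split => //; rewrite exprn_ege1// ler1n.
pose tau := eps ^+ 4 / (292 * c8).
have tau0 : 0 < tau by apply: divr_gt0; [exact: exprn_gt0|lra].
have tauE : 292 * c8 * tau = eps ^+ 4 by rewrite /tau; field; rewrite gt_eqF//; lra.
have tau1 : tau <= 1.
  have : eps ^+ 4 <= 1 by rewrite exprn_ile1//; lra.
  have : tau <= 292 * c8 * tau by rewrite ler_peMl ?(ltW tau0)//; lra.
  lra.
pose ka := 256 / tau.
have ka0 : 0 < ka by apply: divr_gt0; [rewrite ltr0n|].
pose theta := tau / (64 * (ka + 1)).
have theta0 : 0 < theta by rewrite divr_gt0// mulr_gt0// addr_gt0.
have thetaE : theta * (ka + 1) = tau / 64 by rewrite /theta; field; rewrite gt_eqF//; lra.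
have theta1 : theta <= 1.
  have : theta <= theta * (ka + 1) by rewrite ler_peMr ?(ltW theta0)//; lra.
  lra.
have sparse : ka * theta + 2 * expR (- ka) + theta / 2 <= tau / 32.
  have : expR (- ka) <= tau / 256.
    have -> : tau / 256 = ka^-1 by rewrite /ka invf_div.
    by rewrite expRN lef_pV2 ?posrE ?expR_gt0//; have := expR_ge1Dx ka; lra.
  lra.
pose epsA := eps ^+ 2 * (theta * tau / 16).
have tt0 : 0 < theta * tau / 16 by rewrite divr_gt0// mulr_gt0.
have tt1 : theta * tau / 16 <= 1 by nra.
have eps2 : 0 < eps ^+ 2 by rewrite exprn_gt0.
have epsA0 : 0 < epsA by rewrite mulr_gt0.
have epsA1 : epsA <= eps ^+ 2 by rewrite ler_piMr// ltW.
have epsA2 : epsA <= theta * tau / 16 by rewrite ler_piMl ?(ltW tt0)//; nra.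
pose s0 := (8 * (2 / eps + 5) / eps ^+ 2) ^+ 4.
have pos : all (fun bc : R * R => 0 < bc.2) [:: (44, 1); (88, eps ^+ 2); (352, tau);
    (2816, epsA ^+ 2); (128 * c8, (theta * tau / 16) ^+ 2); (2, epsA); (s0, 1)].
  by rewrite /= ltr01 eps2 tau0 (exprn_gt0 _ epsA0) (exprn_gt0 _ tt0) epsA0.
have [K] := exists_large pos.
rewrite /= !mul1r => /and5P[K44 K1 K2 K3 /and4P[K4 K5 K6 _]].
have K0 : 0 < K by apply: lt_le_trans K44; rewrite ltr0n.
have s0E : s0 = (8 * (2 / eps + 5) / eps ^+ 2) ^+ 4 by [].
clearbody tau ka theta epsA s0; exists K; split => //.
case=> // n d T P A ReW ImW p sg z _ Kn KL Kom model p01 sg0 z1.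
have [p0 p1] := andP p01.
set n1 := n.+1%:R in Kn KL Kom *.
have n4 : 4 <= n1 by apply: le_trans Kn; apply: le_trans K44; rewrite ler_nat.
have L1 : 1 <= ln n1.
  by rewrite -ler_expR lnK ?posrE ?ltr0n//; apply: le_trans n4; exact: expR1_le4.
have L11 : 1 <= 11 * ln n1 by clear -L1; lra.
have [m /andP[m1 m2]] := exists_power_two L11.
have m_small : (2 * 2 ^ m)%:R <= n1 * p.
  rewrite natrM; apply: le_trans KL.
  apply: (@le_trans _ _ (44 * ln n1)); last by rewrite ler_wpM2r// (le_trans ler01).
  by clear -m2; lra.
have om_large : 128 * 8 ^+ 6 <= (theta * tau / 16) ^+ 2 * (n1 * p / sg ^+ 2).
  by rewrite -c8E; apply: le_trans K4 _; rewrite ler_wpM2l// sqr_ge0.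
have n_large : 2 <= epsA * n1 by apply: le_trans K5 _; rewrite ler_wpM2l// ltW.
have tau_eps : 292 * 8 ^+ 6 * tau <= eps ^+ 4 by rewrite -c8E tauE.
have [E [mE PE HE]] := sync_event model p01 sg0 eps01 z1 tau0 theta0 theta1 epsA0 epsA1
  epsA2 tau_eps (ltW ka0) sparse om_large n_large m_small.
exists E; split => //; apply: le_trans PE; rewrite lee_fin.
have := @risk_le R n m p sg eps epsA tau K p01 sg0 eps01 tau0 epsA0 n4 KL.
rewrite m1 /= -/n1 => H; have {H} : graph_risk (n := n) p eps epsA m + noise_risk (n := n.+1) (n1 * p) sg eps tau <=
  n1 ^- 8 + expR (- ((n1 * p / sg ^+ 2) `^ 4^-1)).
  apply: H.
  - by apply: le_trans K44; rewrite ler_nat.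
  - exact: K1.
  - exact: K2.
  - exact: K3.
  - by move: m2; rewrite mulrA (_ : 2 * 11 = 22)//; ring.
  - by rewrite -s0E; exact: le_trans Kom.
move: (graph_risk _ _ _ _) (noise_risk _ _ _ _) (n1 ^- 8) (expR _) => r1 r2 r3 r4; clear; lra.
Qed.

(** * The main result *)

Theorem theorem1p1 (R : realType)
  (sigma p : nat -> R) (z : forall n, 'cV[R[i]]_n)
  (d : nat -> measure_display) (T : forall n, measurableType (d n))
  (P : forall n, probability (T n) R)
  (A : forall n, 'I_n -> 'I_n -> {RV (P n) >-> bool})
  (ReW ImW : forall n, 'I_n -> 'I_n -> {RV (P n) >-> R})
  (Zhat : forall n, T n -> 'M[R[i]]_n) (u : forall n, T n -> 'cV[R[i]]_n)
  (sigma_gt0 : forall n, 0 < sigma n)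
  (p_range : forall n, 0 < p n <= 1)
  (z_unit : forall n j, `|z n j 0| = 1)
  (model : forall n, sync_model (A n) (ReW n) (ImW n) (p n))
  (snr_infty : n%:R * p n / sigma n ^+ 2 @[n --> \oo] --> +oo)
  (degree_infty : n%:R * p n / ln n%:R @[n --> \oo] --> +oo)
  (Zhat_max : forall n (w : T n),
    sdp_maximizer (observed_mx (A n) (ReW n) (ImW n) (sigma n) (z n) w)
                  (Zhat n w))
  (u_leading : forall n (w : T n), (0 < n)%N ->
    leading_eigenvector (Zhat n w) (u n w)) :
  exists delta : nat -> R,
    delta n @[n --> \oo] --> 0 /\
    forall n, (0 < n)%N ->
      with_prob_ge (P n)
        (1 - n%:R ^- 8 - expR (- (n%:R * p n / sigma n ^+ 2) `^ 4^-1))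
        [set w : T n |
          (n%:R ^+ 2)^-1 * frobenius_norm (Zhat n w - z n *m (z n) ^t*) ^+ 2
            <= (1 + delta n) * (sigma n ^+ 2 / (n%:R * p n)) /\
          phase_loss (phases (u n w)) (z n)
            <= (1 + delta n) * (sigma n ^+ 2 / (2 * n%:R * p n))].
Proof.
pose om n : R := n%:R * p n / sigma n ^+ 2.
pose q n : R := 1 - n%:R ^- 8 - expR (- om n `^ 4^-1).
pose event (n : nat) (c : R) := [set w : T n |
  (n%:R ^+ 2)^-1 * frobenius_norm (Zhat n w - z n *m (z n) ^t*) ^+ 2
    <= (1 + c) * (sigma n ^+ 2 / (n%:R * p n)) /\
  phase_loss (phases (u n w)) (z n)
    <= (1 + c) * (sigma n ^+ 2 / (2 * n%:R * p n))].
pose ok n (c : R) := 0 <= c /\ with_prob_ge (P n) (q n) (event n c).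
pose e (k : nat) : R := k.+1%:R^-1 / 100.
have eps01 k : 0 < e k <= 1 / 100.
  have h100 : (0 : R) < 100 by rewrite ltr0n.
  rewrite /e divr_gt0 ?invr_gt0//= ler_wpM2r ?invr_ge0 ?(ltW h100)//.
  by rewrite invf_le1// ler1n.
have eventually_ok k : \forall n \near \oo, ok n (40 * e k).
  have [K [K0 HK]] := large_sync_event (eps01 k).
  near=> n.
  have n0 : (0 < n)%N by near: n; exact: nbhs_infty_gt.
  have Kn : K <= n%:R by near: n; exact: nbhs_infty_ger.
  have Kom : K <= om n by near: n; move/cvgryPge: snr_infty; exact.
  have KL : K <= n%:R * p n / ln n%:R by near: n; move/cvgryPge: degree_infty; exact.
  have L0 : 0 < ln (n%:R : R).
    rewrite lt_neqAle ln_ge0 ?ler1n// andbT; apply/eqP => L0.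
    by move: KL; rewrite -L0 invr0 mulr0 leNgt K0.
  have KL' : K * ln n%:R <= n%:R * p n by rewrite -ler_pdivlMr.
  have [E [mE PE HE]] := HK n _ _ _ _ _ _ _ _ _ n0 Kn KL' Kom (model n) (p_range n) (sigma_gt0 n) (z_unit n).
  split; first by have /andP[h _] := eps01 k; rewrite mulr_ge0// ltW.
  by exists E; split => // w Ew; exact: HE w Ew _ _ (Zhat_max n w) (u_leading n w n0).
have trivial_ok n : (0 < n)%N -> ok n (8 * om n).
  move=> n0; have n0R : 0 < n%:R :> R by rewrite ltr0n.
  have /andP[p0 _] := p_range n; have s0 := sigma_gt0 n.
  have om0 : 0 < om n by rewrite divr_gt0 ?exprn_gt0// mulr_gt0.
  split; first by rewrite mulr_ge0// ltW.
  exists setT; split => //.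
    rewrite probability_setT lee_fin /q.
    have : 0 <= n%:R ^- 8 :> R by rewrite invr_ge0 exprn_ge0.
    by have := expR_ge0 (- om n `^ 4^-1); lra.
  move=> w _; split.
    apply: le_trans (frobenius_le4 n0 (Zhat_max n w).1 (z_unit n)) _.
    rewrite (_ : _ * _ = (om n)^-1 + 8); last by rewrite /om; field; rewrite !gt_eqF.
    have omV0 : 0 < (om n)^-1 by rewrite invr_gt0.
    by rewrite -[leLHS]add0r lerD ?(ltW omV0)// ler_nat.
  apply: le_trans (phase_loss_le4 (u n w) n0 (z_unit n)) _.
  rewrite (_ : _ * _ = (om n)^-1 / 2 + 4); last by rewrite /om; field; rewrite !gt_eqF.
  by rewrite lerDr divr_ge0// invr_ge0 ltW.
(* The best accuracy that holds at n among the first n ones. The bound at 8 om is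
   the one that holds for all estimates, and it matters for small n only. *)
pose delta n := \big[Num.min/8 * om n]_(k < n | `[< ok n (40 * e k) >]) (40 * e k).
have delta_ok n : (0 < n)%N -> ok n (delta n).
  move=> n0; rewrite /delta; elim/big_ind: _ => [|x y okx oky|k /asboolP//].
    exact: trivial_ok.
  by rewrite minEle; case: ifP.
exists delta; split; last by move=> n n0; have [] := delta_ok n n0.
apply/cvgrPdist_lt => eps eps0.
have [k ek] : exists k, 40 * e k < eps.
  exists (Num.bound eps^-1).
  have h : 40 * e (Num.bound eps^-1) <= (Num.bound eps^-1).+1%:R^-1.
    rewrite /e mulrCA ger_pMr ?invr_gt0// ler_pdivrMr ?ltr0n// mul1r ler_nat//.
  apply: le_lt_trans h _; rewrite -[ltRHS]invrK ltf_pV2 ?posrE ?invr_gt0//.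
  apply: lt_trans (archi_boundP _) _; first by rewrite invr_ge0 ltW.
  by rewrite ltr_nat.
near=> n.
have okn : ok n (40 * e k) by near: n; exact: eventually_ok.
have kn : (k < n)%N by near: n; exact: nbhs_infty_gt.
have [d0 _] := delta_ok n (leq_ltn_trans (leq0n k) kn).
rewrite sub0r normrN ger0_norm//; apply: le_lt_trans ek.
rewrite /delta; apply: (bigmin_le_cond _ (j := Ordinal kn)).
exact/asboolP.
Unshelve. all: by end_near.
Qed.
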